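(* Let $\eta$ be a nonnegative Schwartz function on $\mathbb{R}^2$ with $\int\eta(x)\,dx=1$, let $\omega_\epsilon(x,t)$ be the solution of the Euler equation with initial vorticity $$\omega_{0,\epsilon}(x)=\sum_{m=1}^M\frac{\gamma_m}{\epsilon^2}\,\eta\Big(\frac{x-p_m^0}{\epsilon}\Big),$$ and let $0<T<T^*$. Then for every $a<\frac12$ and every $\gamma>0$ there exists $\epsilon_0=\epsilon_0(a,\gamma,T)>0$ such that for all $0<\epsilon\le\epsilon_0$ and all $t\in[0,T]$, $$\int_{B(t)^c}|\omega_\epsilon(x,t)|\,dx\le\epsilon^{\gamma},\qquad\text{where } B(t)=\bigcup_{m=1}^M B_{\epsilon^a}(p_m(t)).$$
   Context: $B_r(p)$ is the open ball in $\mathbb{R}^2$ with center $p$ and radius $r$; $B(t)^c$ is the complement of $B(t)$ in $\mathbb{R}^2$; $(x_1,x_2)^\perp=(-x_2,x_1)$. Euler equation: $\partial_t\omega_\epsilon+u_\epsilon\cdot\nabla\omega_\epsilon=0$ on $\mathbb{R}^2\times[0,\infty)$, $\omega_\epsilon(\cdot,0)=\omega_{0,\epsilon}$, with $u_\epsilon(x,t)=\frac1{2\pi}\int\frac{(x-y)^\perp}{|x-y|^2}\omega_\epsilon(y,t)\,dy$. For data in $L^1\cap L^\infty$, ''the solution'' is the unique global (Yudovich) weak solution; it is transported by the measure-preserving flow of $u_\epsilon$. Point vortices: $\gamma_1,\dots,\gamma_M$ are nonzero reals, $p_1^0,\dots,p_M^0\in\mathbb{R}^2$ are distinct points, and $p(t)=(p_1(t),\dots,p_M(t))$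 is the solution of the Helmholtz system $\frac{dp_m}{dt}=\sum_{l\ne m}\frac{\gamma_l}{2\pi}\frac{(p_m-p_l)^\perp}{|p_m-p_l|^2}$, $p_m(0)=p_m^0$, with maximal time of existence $T^*\in(0,\infty]$; $p_m(t)\ne p_l(t)$ for all $t\in[0,T^* )$ and $m\ne l$. *)

(* Defs.v *)
From HB Require Import structures.
From mathcomp Require Import all_boot all_order all_algebra.
From mathcomp Require Import all_classical all_reals all_analysis.
Set Implicit Arguments.
Unset Strict Implicit.
Unset Printing Implicit Defensive.
Import Order.TTheory GRing.Theory Num.Theory numFieldNormedType.Exports.
Local Open Scope classical_set_scope.
Local Open Scope ring_scope.

Section Plane.
Context {R : realType}.

(* [measurableTypeR R] is [R] with its Borel sets. *)
Definition leb2 :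
    {measure set (measurableTypeR R * measurableTypeR R)%type -> \bar R} :=
  (@lebesgue_measure R \x @lebesgue_measure R)%E.

(* The library norm on a product is the sup norm, hence a separate Euclidean
   norm and Euclidean balls. *)
Definition normsq (x : R * R) : R := x.1 ^+ 2 + x.2 ^+ 2.
Definition enorm (x : R * R) : R := Num.sqrt (normsq x).
Definition eball (p : R * R) (r : R) : set (R * R) :=
  [set x | enorm (x - p) < r].

Definition perp (x : R * R) : R * R := (- x.2, x.1).

(* The value at 0 is 0, since inverses are total; it is never relevant. *)
Definition bs_kernel (x : R * R) : R * R :=
  (2 * pi)^-1 *: ((normsq x)^-1 *: perp x).

Definition biot_savart (w : R * R -> R) (x : R * R) : R * R :=
  (\int[leb2]_y ((bs_kernel (x - y)).1 * w y),
   \int[leb2]_y ((bs_kernel (x - y)).2 * w y)).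

Definition iter_derive {V : normedModType R} (vs : seq V) (f : V -> R) :
    V -> R :=
  foldr (fun v g x => 'D_v g x) f vs.

(* C^oo: all iterated directional derivatives exist and are (Frechet)
   differentiable. *)
Definition smooth {V : normedModType R} (f : V -> R) : Prop :=
  forall (vs : seq V) (x : V), differentiable (iter_derive vs f) x.

Definition schwartz (f : R * R -> R) : Prop :=
  smooth f /\
  forall (vs : seq (R * R)) (j k : nat), exists C : R, forall x : R * R,
    `|x.1 ^+ j * x.2 ^+ k * iter_derive vs f x| <= C.

(* Derivative along [0, +oo[: two-sided for 0 < t, one-sided at t = 0. *)
Definition has_velocity (c : R -> R * R) (t : R) (v : R * R) : Prop :=
  (s - t)^-1 *: (c s - c t) @[s --> within [set s | 0 <= s] t^'] --> v.

(* Test functions on R^2 x [0, +oo[ are the restrictions of those on R^2 x R;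
   a space-time point is ((x_1, x_2), t). *)
Definition test_function (phi : R * R * R -> R) : Prop :=
  smooth phi /\ compact (closure [set z | phi z != 0]).

Definition weak_euler (w0 : R * R -> R) (w : R -> R * R -> R) : Prop :=
  forall phi, test_function phi -> forall t, 0 <= t ->
    \int[leb2]_x (phi (x, t) * w t x) - \int[leb2]_x (phi (x, 0) * w0 x) =
    \int[lebesgue_measure]_(s in `[0, t]) \int[leb2]_x
      (('D_((0, 0), 1) phi (x, s) + 'D_(biot_savart (w s) x, 0) phi (x, s))
       * w s x).

Definition homeomorphism (f : R * R -> R * R) : Prop :=
  continuous f /\
  exists g : R * R -> R * R, [/\ cancel f g, cancel g f & continuous g].

Definition measure_preserving (f : R * R -> R * R) : Prop :=
  forall A, measurable A ->
    measurable (f @^-1` A) /\ leb2 (f @^-1` A) = leb2 A.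

Definition is_flow (u : R -> R * R -> R * R) (X : R -> R * R -> R * R) : Prop :=
  [/\ forall x, X 0 x = x,
      forall t x, 0 <= t -> has_velocity (X ^~ x) t (u t (X t x)) &
      forall t, 0 <= t -> homeomorphism (X t)].

(* [w t] represents the vorticity at time [t] up to a null set; its values for
   [t < 0] play no role. The last field is a known property of the Yudovich
   solution (which is unique): it is carried by the flow of its own velocity. *)
Record yudovich_solution (w0 : R * R -> R) (w : R -> R * R -> R) : Prop := {
  yudovich_measurable :
    measurable_fun ([set z | 0 <= z.2] : set (R * R * R))
                   (fun z : R * R * R => w z.2 z.1);
  yudovich_bounds : exists C : R, forall t, 0 <= t ->
    (\int[leb2]_x `|w t x|%:E <= C%:E)%E /\
    {ae leb2, forall x, `|w t x| <= C};
  yudovich_weak : weak_euler w0 w;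
  yudovich_transport : exists X : R -> R * R -> R * R,
    [/\ is_flow (fun t => biot_savart (w t)) X,
        forall t, 0 <= t -> measure_preserving (X t) &
        forall t, 0 <= t -> {ae leb2, forall x, w t (X t x) = w0 x}]
}.

Section Vortices.
Variables (M : nat) (gam : 'I_M -> R) (p0 : 'I_M -> R * R).

(* Solution of the Helmholtz system on [0, S[, for S in ]0, +oo]. *)
Definition helmholtz_on (S : \bar R) (p : R -> 'I_M -> R * R) : Prop :=
  (forall m, p 0 m = p0 m) /\
  forall t, 0 <= t -> (t%:E < S)%E ->
    (forall m l, m != l -> p t m <> p t l) /\
    (forall m, has_velocity (p ^~ m) t
       (\sum_(l < M | l != m) gam l *: bs_kernel (p t m - p t l))).

Definition maximal_helmholtz (Tstar : \bar R) (p : R -> 'I_M -> R * R) : Prop :=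
  [/\ (0 < Tstar)%E,
      helmholtz_on Tstar p &
      forall (S : \bar R) (q : R -> 'I_M -> R * R),
        (0 < S)%E -> helmholtz_on S q -> (S <= Tstar)%E].

Definition initial_vorticity (eta : R * R -> R) (eps : R) (x : R * R) : R :=
  \sum_(m < M) gam m / eps ^+ 2 * eta (eps^-1 *: (x - p0 m)).

End Vortices.

End Plane.

(* Main.v *)
(* Write the vorticity emitted by the [m]-th blob as the image of the probability
   [P = eta dx] under [X_m(t, z) = F_t(p_m^0 + eps z)], [F] being the flow.  Then
   [X_m' = sum_l gam_l E[K(X_m - X_l)]], with centre of mass [c_m = E X_m] and
   [V_m = X_m - c_m].  Let [Y_k = sum_m E g_k(|V_m|^2)], where [g_k(r)] is a smoothed
   [min(r, de^2)^k] and [de] is small against the distances between vortices.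

   The flow preserves area, so each [X_m(t)] has density at most [D / eps^2] and
   [E 1_A / |x - X_l| <= P(A) / r + C r / eps^2] for all [r > 0].
   The self-interaction in [Y_k'] is symmetrized: with [A] the cross product of
   [x] and [y] and [h(r) = g_k'(r) / r], it involves
   [A (g_k'(|x|^2) - g_k'(|y|^2)) / |x - y|^2], which is [A (h(|x|^2) - h(|y|^2))],
   of mean zero since [E V_m = 0], up to a remainder that splits into products of
   functions of [x] and [y].  Far blobs act through a Lipschitz field, up to their
   tails.  As long as [Y_5 <= eps^5] and [sum_m |c_m - p_m|^2 <= de^2], Gronwall
   gives [Y_k <= C eps^(k+1)] for odd [k] and [|c_m - p_m| <= C eps], so both
   persist on [0, T] for small [eps].  Chebyshev's inequality of order [k]
   bounds the mass outside the balls by [C eps^(k + 1 - 2 a k)], and [k] is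
   arbitrary while [2 a < 1]. *)

Require Import Defs.
From HB Require Import structures.
From mathcomp Require Import all_boot all_order all_algebra.
From mathcomp Require Import all_classical all_reals all_analysis.
From mathcomp Require Import measurable_realfun.
From mathcomp Require Import zify ring lra.
Set Implicit Arguments.
Unset Strict Implicit.
Unset Printing Implicit Defensive.
Import Order.TTheory GRing.Theory Num.Theory numFieldNormedType.Exports.
Local Open Scope classical_set_scope.
Local Open Scope ring_scope.

(** The profile has no compact support, so from time 0 on a little mass sits near the other
    vortices, where only a velocity bound of size [C / eps] is available. Truncating the moments
    removes these points: the derivative of the weight vanishes beyond [de]. The price is paid
    twice. Truncation breaks the conservation of the moment of inertia, which costs [Y_1 / de^2],
    and it leaves a first-moment tail that needs its own bound. The self-interaction at order [k] is
    fed by [(Y_1 + O(eps^2)) * Y_(k-2)]. Hence the orders go up by two from [k = 1], each step gains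
    [eps^2], and only odd orders occur. Order 5 enters the bootstrap because the far field needs a
    tail of mass at most [eps^4]: with [r = eps^3] both terms of the bound on [1 / |x - X_l|] become
    [O(eps)]. Order 3 would give [C eps^4], with no power of [eps] to spare. Order 5 is assumed at
    [eps^5] and recovered at [C eps^6], and the spare [eps] closes the argument. All constants are
    chosen before [eps] and the flow, which is what makes the final threshold uniform. *)

Lemma eqW d (T : porderType d) (x y : T) : x = y -> (x <= y)%O.
Proof. by move=> ->. Qed.

(** * Euclidean geometry of the plane and truncated power weights *)

Section Truncation.
Context {R : realType}.
Implicit Types (x y z : R * R) (r s sig : R).

Definition cross x y : R := x.1 * y.2 - x.2 * y.1.
Definition dotp x y : R := x.1 * y.1 + x.2 * y.2.

Lemma normsq_ge0 x : 0 <= normsq x.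
Proof. by rewrite /normsq addr_ge0 ?sqr_ge0. Qed.

Lemma enorm_ge0 x : 0 <= enorm x.
Proof. by rewrite /enorm sqrtr_ge0. Qed.

Lemma sqr_enorm x : enorm x ^+ 2 = normsq x.
Proof. by rewrite /enorm sqr_sqrtr// normsq_ge0. Qed.

Lemma normsqN x : normsq (- x) = normsq x.
Proof. by rewrite /normsq /= !sqrrN. Qed.

Lemma enormN x : enorm (- x) = enorm x.
Proof. by rewrite /enorm normsqN. Qed.

Lemma enormBC x y : enorm (x - y) = enorm (y - x).
Proof. by rewrite -enormN opprB. Qed.

Lemma normsqB x y : normsq (x - y) = normsq x + normsq y - 2 * dotp x y.
Proof. by rewrite /normsq /dotp /=; ring. Qed.

Lemma cross_sqr x y : cross x y ^+ 2 + dotp x y ^+ 2 = normsq x * normsq y.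
Proof. by rewrite /normsq /dotp /cross; ring. Qed.

Lemma norm_dotp x y : `|dotp x y| <= enorm x * enorm y.
Proof.
rewrite -[leRHS]ger0_norm ?mulr_ge0 ?enorm_ge0// -ler_sqr ?nnegrE//.
rewrite -!normrX !ger0_norm ?sqr_ge0// exprMn !sqr_enorm -cross_sqr.
by rewrite lerDr sqr_ge0.
Qed.

Lemma norm_cross x y : `|cross x y| <= enorm x * enorm y.
Proof.
rewrite -[leRHS]ger0_norm ?mulr_ge0 ?enorm_ge0// -ler_sqr ?nnegrE//.
rewrite -!normrX !ger0_norm ?sqr_ge0// exprMn !sqr_enorm -cross_sqr.
by rewrite lerDl sqr_ge0.
Qed.

Lemma crossC x y : cross y x = - cross x y.
Proof. by rewrite /cross; ring. Qed.

Lemma norm_crossB x y : `|cross x y| <= enorm y * enorm (x - y).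
Proof.
rewrite (_ : cross x y = cross (x - y) y) ?(mulrC (enorm y)) ?norm_cross//.
by rewrite /cross /=; ring.
Qed.

Lemma ler_enormD x y : enorm (x + y) <= enorm x + enorm y.
Proof.
rewrite -ler_sqr ?nnegrE ?addr_ge0 ?enorm_ge0// sqrrD !sqr_enorm.
have := norm_dotp x y; rewrite ler_norml => /andP[_].
have -> : normsq (x + y) = normsq x + 2 * dotp x y + normsq y.
  by rewrite /normsq /dotp /=; ring.
by move=> H; rewrite -mulr_natl; lra.
Qed.

Lemma ler_enormB x y : enorm x - enorm y <= enorm (x - y).
Proof. by rewrite lerBlDr (le_trans _ (ler_enormD _ _))// subrK. Qed.

Lemma norm_fst_enorm x : `|x.1| <= enorm x.
Proof.
rewrite -ler_sqr ?nnegrE ?enorm_ge0// sqr_enorm /normsq -normrX.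
by rewrite ger0_norm ?sqr_ge0// lerDl sqr_ge0.
Qed.

Lemma norm_snd_enorm x : `|x.2| <= enorm x.
Proof.
rewrite -ler_sqr ?nnegrE ?enorm_ge0// sqr_enorm /normsq -normrX.
by rewrite ger0_norm ?sqr_ge0// lerDr sqr_ge0.
Qed.

Lemma enorm_le_sum x : enorm x <= `|x.1| + `|x.2|.
Proof.
rewrite -ler_sqr ?nnegrE ?enorm_ge0 ?addr_ge0// sqr_enorm /normsq sqrrD.
rewrite -!normrX !(ger0_norm (sqr_ge0 _)) -mulr_natl.
by have := mulr_ge0 (normr_ge0 x.1) (normr_ge0 x.2); lra.
Qed.

Lemma enorm_eq0 x : enorm x = 0 -> x = 0.
Proof.
move=> x0; have := norm_fst_enorm x; have := norm_snd_enorm x.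
rewrite x0 !normr_le0; case: x {x0} => a b /= /eqP-> /eqP->; reflexivity.
Qed.

(* Slopes of the weights: [slope] is the derivative of [weight], and
   [slope1 = slope / r], [slope2 = slope / r ^ 2] wherever [slope] is nonzero;
   the weight is [r ^ k] truncated at [sig]. *)
Definition weight k sig r : R :=
  Num.min r sig ^+ k -
  k%:R / k.+1%:R * (Num.min r sig ^+ k.+1 / sig).
Definition slope k sig r : R :=
  k%:R * Num.min r sig ^+ k.-1 * (1 - Num.min r sig / sig).

Lemma min_ge0 r sig : 0 <= sig -> 0 <= r -> 0 <= Num.min r sig.
Proof. by move=> s0 r0; rewrite le_min r0. Qed.

(** The mean value bound for powers, multiplied by [r] so that the exponent [n - 1] does not appear
    and [n = 0] is included. *)
Lemma subrX_le n r s : 0 <= s -> s <= r ->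
  r * (r ^+ n - s ^+ n) <= n%:R * r ^+ n * (r - s).
Proof.
move=> s0 sr; have r0 : 0 <= r by exact: le_trans sr.
elim: n => [|n IH]; first by rewrite !expr0 subrr mulr0 !mul0r.
rewrite !exprS.
have h1 : s ^+ n <= r ^+ n by rewrite lerXn2r.
have h2 : 0 <= r ^+ n - s ^+ n by lra.
have h3 : s * (r ^+ n - s ^+ n) <= r * (r ^+ n - s ^+ n) by exact: ler_wpM2r.
have h4 := ler_wpM2l r0 IH.
have h5 : 0 <= r * r ^+ n * (r - s) - r * s ^+ n * (r - s).
  by rewrite -mulrBl -mulrBr !mulr_ge0// subr_ge0.
by rewrite -natr1; lra.
Qed.

Lemma subrXS_le n r s : 0 <= s -> s <= r ->
  r ^+ n.+1 - s ^+ n.+1 <= n.+1%:R * r ^+ n * (r - s).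
Proof.
move=> s0 sr; have r0 : 0 <= r by exact: le_trans sr.
have := subrX_le n s0 sr.
have h1 : s ^+ n <= r ^+ n by rewrite lerXn2r.
have h5 : 0 <= (r ^+ n - s ^+ n) * (r - s).
  by rewrite mulr_ge0// subr_ge0.
rewrite !exprS -natr1; lra.
Qed.

End Truncation.

(** * Pointwise bound on the symmetrized self-interaction, orders at least 3 *)

Section SelfInteraction.
Context {R : realType}.
Implicit Types (x y z : R * R) (r s sig : R).

Definition slope1 k sig r : R :=
  k%:R * Num.min r sig ^+ k.-2 * (1 - Num.min r sig / sig).

(** Quadratic near the origin but linear, not constant, beyond [sqrt sig]: when one point lies
    beyond the truncation level and the other does not, the cross product still grows linearly in
    the far point. *)
Definition qweight sig x : R := Num.min (normsq x) (Num.sqrt sig * enorm x).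

(** The factor [n + 3] comes from the slope, [6 n + 7 = 2 (2 n + 3) + (2 n + 1)] from the two
    differences bounded in [self_core], and 2 from [r - s <= 2 a d]. *)
Definition selfC (n : nat) : R := (2 * n.+3 * (6 * n + 7))%:R.

Lemma selfC_ge n : (n.+3 * 3)%:R <= selfC n.
Proof. by rewrite /selfC ler_nat (mulnC 2%N) -mulnA leq_pmul2l//; lia. Qed.

Lemma qweight_ge0 sig x : 0 <= qweight sig x.
Proof. by rewrite le_min normsq_ge0 mulr_ge0 ?sqrtr_ge0// enorm_ge0. Qed.

Lemma normB_le (a b c d : R) : 0 <= a <= c -> 0 <= b <= d ->
  `|a - b| <= c + d.
Proof. by move=> /andP[? ?] /andP[? ?]; rewrite ler_norml; lra. Qed.

(* [a], [b], [d] stand for [|x|], [|y|], [|x - y|] *)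
Lemma self_core n sig (a b d A P : R) : 0 < sig -> 0 <= b -> b <= a -> 0 < d ->
  a - b <= d -> d ^+ 2 = a ^+ 2 + b ^+ 2 - 2 * P ->
  `|A| <= b * d -> `|A| <= a * b -> `|P| <= a * b ->
  `|A * (slope n.+3 sig (a ^+ 2) - slope n.+3 sig (b ^+ 2)) / d ^+ 2
    - A * (slope1 n.+3 sig (a ^+ 2) - slope1 n.+3 sig (b ^+ 2))|
  <= selfC n * (Num.min (b ^+ 2) (Num.sqrt sig * b) * Num.min (a ^+ 2) sig ^+ n.+1
              + Num.min (a ^+ 2) (Num.sqrt sig * a) * Num.min (b ^+ 2) sig ^+ n.+1).
Proof.
move=> sig0 b0 ba d0 abd dE Abd Aab Pab.
have a0 : 0 <= a by exact: le_trans ba.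
set r := a ^+ 2; set s := b ^+ 2.
have r0 : 0 <= r by rewrite sqr_ge0.
have s0 : 0 <= s by rewrite sqr_ge0.
have sr : s <= r by rewrite lerXn2r.
set de := Num.sqrt sig.
have de0 : 0 < de by rewrite sqrtr_gt0.
have deE : de ^+ 2 = sig by rewrite sqr_sqrtr// ltW.
have D0 : 0 < d ^+ 2 by rewrite exprn_gt0.
have C0 : 0 <= selfC n by rewrite ler0n.
have q0 : 0 <= Num.min s (de * b) by rewrite le_min s0 mulr_ge0// ltW.
have q1 : 0 <= Num.min r (de * a) by rewrite le_min r0 mulr_ge0// ltW.
have X0 : 0 <= Num.min r sig ^+ n.+1 by rewrite exprn_ge0// min_ge0// ltW.
have Y0 : 0 <= Num.min s sig ^+ n.+1 by rewrite exprn_ge0// min_ge0// ltW.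
have sgn : sig / sig = 1 by rewrite divff// gt_eqF.
have k0 : 0 <= n.+3%:R :> R by rewrite ler0n.
(* If both points are beyond the truncation level, the factor [1 - min / sig] makes all slopes
   vanish. *)
have [sigs|ssig] := leP sig s.
  rewrite /slope /slope1 !(min_r (le_trans sigs sr)) !(min_r sigs) sgn.
  rewrite subrr !mulr0 subrr !mulr0 mul0r subrr normr0.
  by rewrite mulr_ge0// addr_ge0// mulr_ge0// exprn_ge0// ltW.
have bde : b <= de.
  by rewrite -ler_sqr ?nnegrE ?(ltW de0) // deE ?(ltW ssig).
have [sigr|rsig] := leP sig r.
  have dea : de <= a by rewrite -ler_sqr ?nnegrE ?(ltW de0) // deE ?(ltW ssig).
  rewrite /slope /slope1 !(min_r sigr) !(min_l (ltW ssig)) sgn subrr !mulr0.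
  rewrite !sub0r /=.
  have -> : A * - (n.+3%:R * s ^+ n.+2 * (1 - s / sig)) / d ^+ 2 -
     A * - (n.+3%:R * s ^+ n.+1 * (1 - s / sig)) =
     n.+3%:R * s ^+ n.+1 * (A * (1 - s / sig) -
        A * ((1 - s / sig)) * s / d ^+ 2).
    by rewrite exprS; ring.
  have -> : Num.min r (de * a) = de * a.
    by rewrite min_r// /r expr2 ler_wpM2r.
  have sY : 0 <= s ^+ n.+1 by rewrite exprn_ge0.
  set u := 1 - s / sig.
  have u0 : 0 <= u by rewrite /u subr_ge0 ler_pdivrMr ?mul1r// ltW.
  have u1 : u <= 1 by rewrite /u gerBl divr_ge0// ltW.
  (* Only the larger radius is beyond the level here. The smallness of [1 - s / sig] compensates the
     singular quotient: [de * u = (de - b) (1 + b / de)], and [de - b <= a - b <= d]. *)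
  have ud : de * u <= 2 * d.
    have -> : de * u = (de - b) * (1 + b / de).
      rewrite /u -deE /s; field; exact: lt0r_neq0.
    have h1 : b / de <= 1 by rewrite ler_pdivrMr// mul1r.
    have h2 : 0 <= b / de by rewrite divr_ge0// ltW.
    have h3 : de - b <= d by lra.
    have h4 : 0 <= de - b by rewrite subr_ge0.
    by apply: le_trans (ler_pM h4 _ h3 (_ : 1 + b / de <= 2)) _; lra.
  have h1 : `|A * u| <= de * a.
    rewrite normrM (ger0_norm u0).
    have := mulr_ge0 a0 (normr_ge0 A) => _.
    have h2 : `|A| * u <= a * b * 1 by apply: ler_pM.
    have h3 : a * b <= a * de by rewrite ler_wpM2l.
    by lra.
  have h2 : `|A * u * s / d ^+ 2| <= 2 * (de * a).
    rewrite normf_div (ger0_norm (ltW D0)).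
    rewrite ler_pdivrMr// (normrM _ s) (normrM A) (ger0_norm u0) (ger0_norm s0).
    have h3 : `|A| * u * s <= b * d * u * s.
      by rewrite ler_wpM2r// ler_wpM2r.
    have h4 : b * d * u * s <= de * d * u * s.
      by rewrite ler_wpM2r// ler_wpM2r// ler_wpM2r// ltW.
    have h5 : de * d * u * s <= 2 * d * d * s.
      have : 0 <= (2 * d - de * u) * (d * s).
        by rewrite mulr_ge0 ?subr_ge0// mulr_ge0// ltW.
      lra.
    have h6 : s <= de * a.
      by rewrite /s expr2; apply: ler_pM.
    have : 0 <= (de * a - s) * d ^+ 2 by rewrite mulr_ge0 ?subr_ge0// ltW.
    rewrite expr2; lra.
  rewrite normrM normrM (ger0_norm k0) (ger0_norm sY).
  have h3 : `|A * u - A * u * s / d ^+ 2| <= 3 * (de * a).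
    by apply: le_trans (ler_normB _ _) _; lra.
  have h4 : n.+3%:R * s ^+ n.+1 * `|A * u - A * u * s / d ^+ 2| <=
            n.+3%:R * s ^+ n.+1 * (3 * (de * a)).
    by rewrite ler_wpM2l// mulr_ge0.
  apply: le_trans h4 _.
  have h5 : (n.+3 * 3)%:R <= selfC n :> R := selfC_ge n.
  have h6 : 0 <= Num.min s (de * b) * sig ^+ n.+1.
    by rewrite mulr_ge0// exprn_ge0// ltW.
  have h7 : 0 <= de * a * s ^+ n.+1 by rewrite !mulr_ge0// ltW.
  apply: (@le_trans _ _ ((n.+3 * 3)%:R * (de * a * s ^+ n.+1))).
    by rewrite natrM; lra.
  apply: le_trans (ler_wpM2r h7 h5) _.
  by rewrite ler_wpM2l// lerDr.
have sn := le_trans s0 (ltW ssig).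
rewrite /slope /slope1 !(min_l (ltW rsig)) !(min_l (ltW ssig)) /=.
have -> : Num.min s (de * b) = s by rewrite min_l// /s expr2 ler_wpM2r.
set k := n.+3%:R.
set hr := k * r ^+ n.+1 * (1 - r / sig).
set hs := k * s ^+ n.+1 * (1 - s / sig).
set E1 := k * r ^+ n * (1 - r / sig) - k * s ^+ n * (1 - s / sig).
(* Each slope is [r] times its [slope1], and [d^2 = r + s - 2 P]. After subtraction the diagonal
   terms cancel and [2 P (hr - hs) + r hs - s hr] is left, whose last two terms equal [- r s E1].
   The quotient [hr / r] inside [E1] must still be a polynomial, hence the order [n + 3]. *)
have -> : A * (k * r ^+ n.+2 * (1 - r / sig) - k * s ^+ n.+2 * (1 - s / sig))
     / d ^+ 2 - A * (hr - hs) =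
     A * (2 * P * (hr - hs) - s * (r * E1)) / d ^+ 2.
  rewrite -[X in _ - X](mulfK (lt0r_neq0 D0)) -mulrBl dE -/r -/s; congr (_ / _).
  by rewrite /hr /hs /E1 !(exprS r) !(exprS s); ring.
have rs1 : r / sig <= 1 by rewrite ler_pdivrMr// mul1r ltW.
have rs0 : 0 <= r / sig by rewrite divr_ge0// ltW.
have rn0 : 0 <= r ^+ n by rewrite exprn_ge0.
have dif0 : 0 <= r - s by rewrite subr_ge0.
have powle m : s ^+ m <= r ^+ m by rewrite lerXn2r.
have hE1 : `|r * E1| <= k * ((2 * n + 1)%:R * r ^+ n * (r - s)).
  have -> : r * E1 = k * (r * (r ^+ n - s ^+ n) -
                         (r / sig) * (r ^+ n.+1 - s ^+ n.+1)).
    by rewrite /E1 !(exprS r) !(exprS s); ring.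
  rewrite normrM ger0_norm// ler_wpM2l//.
  have -> : (2 * n + 1)%:R * r ^+ n * (r - s) =
        n%:R * r ^+ n * (r - s) + n.+1%:R * r ^+ n * (r - s) :> R.
    by rewrite -natr1 natrD natrM; ring.
  apply: normB_le.
    by rewrite subrX_le// mulr_ge0// subr_ge0.
  rewrite mulr_ge0 ?subr_ge0//=.
  apply: le_trans (ler_wpM2l rs0 (subrXS_le n s0 sr)) _.
  by rewrite ler_piMl// !mulr_ge0.
have hE2 : `|hr - hs| <= k * ((2 * n + 3)%:R * r ^+ n * (r - s)).
  have -> : hr - hs = k * ((r ^+ n.+1 - s ^+ n.+1) -
                         (r ^+ n.+2 - s ^+ n.+2) / sig).
    by rewrite /hr /hs !(exprS r) !(exprS s); ring.
  rewrite normrM ger0_norm// ler_wpM2l//.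
  have -> : (2 * n + 3)%:R * r ^+ n * (r - s) =
        n.+1%:R * r ^+ n * (r - s) + n.+2%:R * r ^+ n * (r - s) :> R.
    by rewrite -!natr1 natrD natrM; ring.
  apply: normB_le.
    by rewrite subrXS_le// subr_ge0 powle.
  rewrite mulr_ge0 ?subr_ge0 ?invr_ge0 ?(ltW sig0) ?powle //=.
  rewrite ler_pdivrMr//.
  apply: le_trans (subrXS_le _ s0 sr) _.
  have : 0 <= (sig - r) * (n.+2%:R * r ^+ n * (r - s)).
    by rewrite mulr_ge0 ?mulr_ge0 ?subr_ge0 ?(ltW rsig).
  by rewrite exprS; lra.
have ab0 : 0 <= a * b by rewrite mulr_ge0.
have sab : s <= a * b by rewrite /s expr2 ler_wpM2r.
set B := k * (r ^+ n * (r - s)) * (a * b) * (6 * n + 7)%:R.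
have hB : `|2 * P * (hr - hs) - s * (r * E1)| <= B.
  apply: le_trans (ler_normB _ _) _.
  rewrite (normrM _ (hr - hs)) (normrM _ P) (normrM s) (ger0_norm s0) (ger0_norm (ler0n _ 2)).

  set U := r ^+ n * (r - s).
  have U0 : 0 <= k * U by rewrite !mulr_ge0.
  have t1 : 2 * `|P| * `|hr - hs| <= 2 * (a * b) * (k * U * (2 * n + 3)%:R).
    apply: ler_pM => //; rewrite ?mulr_ge0 ?ler_pM2l//.
    by apply: le_trans hE2 _; rewrite /U; apply: eqW; ring.
  have t2 : s * `|r * E1| <= a * b * (k * U * (2 * n + 1)%:R).
    apply: ler_pM => //.
    by apply: le_trans hE1 _; rewrite /U; apply: eqW; ring.
  apply: le_trans (lerD t1 t2) _.
  rewrite /B -/U; apply: eqW.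
  by ring.
(* One power of [d] from here and one from [|A| <= b d] cancel the denominator [d^2]. *)
have rs_ad : r - s <= 2 * a * d.
  have -> : r - s = (a - b) * (a + b) by rewrite /r /s; ring.
  rewrite (mulrC _ d).
  apply: ler_pM; rewrite ?subr_ge0// ?addr_ge0//; lra.
have ABd : `|A * (2 * P * (hr - hs) - s * (r * E1)) / d ^+ 2| <=
   selfC n * (s * r ^+ n.+1).
  rewrite normf_div (ger0_norm (ltW D0)).
  rewrite ler_pdivrMr// normrM.
  apply: le_trans (ler_pM (normr_ge0 _) (normr_ge0 _) Abd hB) _.
  have h : 0 <= b * d * (k * r ^+ n * (a * b) * (6 * n + 7)%:R) *
       (2 * a * d - (r - s)).
    by rewrite !mulr_ge0 ?subr_ge0// ltW.
  apply: le_trans (_ : b * d * (k * (r ^+ n * (2 * a * d)) * (a * b) *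
       (6 * n + 7)%:R) <= _); first by rewrite /B; lra.
  apply: eqW.
  by rewrite /selfC !natrM (exprS r) /s /r -/k; ring.
apply: le_trans ABd _.
rewrite ler_wpM2l// lerDl !mulr_ge0//.
by rewrite exprn_ge0.
Qed.

(** The subtracted term will have mean zero. What remains is a sum of products of a function of [x]
    and a function of [y]: one factor is of quadratic size, the other is a truncated power of order
    [n + 1], two below the order of the weight. Both sides are symmetric in [x] and [y], so the
    larger norm may be assigned to [x]. *)
Lemma self_pointwise n sig x y : 0 < sig ->
  `|cross x y * (slope n.+3 sig (normsq x) - slope n.+3 sig (normsq y))
    / normsq (x - y) -
  cross x y * (slope1 n.+3 sig (normsq x) - slope1 n.+3 sig (normsq y))| <=
  selfC n * (qweight sig y * Num.min (normsq x) sig ^+ n.+1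
           + qweight sig x * Num.min (normsq y) sig ^+ n.+1).
Proof.
wlog yx : x y / enorm y <= enorm x.
  move=> W sig0; have [|yx] := leP (enorm y) (enorm x); first by move=> ?; exact: W.
  have := W y x (ltW yx) sig0.
  rewrite -(normsqN (y - x)) opprB (crossC x y) (addrC (qweight sig x * _)).
  apply: le_trans; apply: eqW; congr (`|_|).
  by ring.
move=> sig0.
have [xy0|xy0] := eqVneq (enorm (x - y)) 0.
  have /eqP := enorm_eq0 xy0; rewrite subr_eq0 => /eqP <-.
  rewrite !subrr !mulr0 mul0r subrr normr0.
  rewrite mulr_ge0// addr_ge0// mulr_ge0 ?qweight_ge0//;
    by rewrite exprn_ge0// min_ge0 ?normsq_ge0// ltW.
rewrite /qweight -!sqr_enorm; apply: (@self_core _ _ _ _ _ _ (dotp x y)) => //.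
- exact: enorm_ge0.
- by rewrite lt_neqAle enorm_ge0 andbT eq_sym.
- exact: ler_enormB.
- by rewrite !sqr_enorm normsqB.
- exact: norm_crossB.
- exact: norm_cross.
- exact: norm_dotp.
Qed.

End SelfInteraction.

(** * Truncated norms, weights and the Biot-Savart kernel *)

Section KernelBounds.
Context {R : realType}.
Implicit Types (x y z v : R * R) (r s de : R).

Definition tnorm de v : R := Num.min (enorm v) de.
Definition far de v : R := (de <= enorm v)%R%:R.

Lemma tnorm_ge0 de v : 0 <= de -> 0 <= tnorm de v.
Proof. by move=> d0; rewrite min_ge0// enorm_ge0. Qed.

Lemma tnorm_le de v : tnorm de v <= de.
Proof. by rewrite ge_min lexx orbT. Qed.

Lemma far_ge0 de v : 0 <= far de v.
Proof. by rewrite /far ler0n. Qed.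

Lemma sqr_tnorm de v : 0 <= de ->
  tnorm de v ^+ 2 = Num.min (normsq v) (de ^+ 2).
Proof.
move=> d0; rewrite /tnorm; have [h|h] := leP (enorm v) de.
  by rewrite sqr_enorm min_l// -sqr_enorm lerXn2r// nnegrE enorm_ge0.
by rewrite min_r// -sqr_enorm lerXn2r ?nnegrE ?enorm_ge0// ltW.
Qed.

Lemma tnorm_far de v : 0 <= de -> de * far de v <= tnorm de v.
Proof.
move=> d0; rewrite /far /tnorm minC; have [h|h] := leP de (enorm v).
  by rewrite mulr1.
by rewrite mulr0 enorm_ge0.
Qed.

Lemma ltr_tnorm de v : enorm v < de -> tnorm de v = enorm v.
Proof. by move=> h; rewrite /tnorm min_l// ltW. Qed.

(** This is the purpose of the truncation: points at distance at least [de] from the center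
    contribute nothing to the derivative of the moments. *)
Lemma slope_far k de v : 0 < de -> de <= enorm v ->
  slope k (de ^+ 2) (normsq v) = 0.
Proof.
move=> d0 dv; rewrite /slope min_r; last first.
  by rewrite -sqr_enorm lerXn2r// nnegrE ?enorm_ge0// ltW.
by rewrite divff ?subrr ?mulr0// expf_neq0// gt_eqF.
Qed.

Lemma slope_ge0 k sig r : 0 < sig -> 0 <= r -> 0 <= slope k sig r.
Proof.
move=> s0 r0; rewrite /slope !mulr_ge0 ?ler0n ?exprn_ge0//.
  by rewrite min_ge0// ltW.
by rewrite subr_ge0 ler_pdivrMr// mul1r ge_min lexx orbT.
Qed.

Lemma slope1_ge0 k sig r : 0 < sig -> 0 <= r -> 0 <= slope1 k sig r.
Proof.
move=> s0 r0; rewrite /slope1 !mulr_ge0 ?ler0n ?exprn_ge0//.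
  by rewrite min_ge0// ltW.
by rewrite subr_ge0 ler_pdivrMr// mul1r ge_min lexx orbT.
Qed.

Lemma slope_le k sig r : 0 < sig -> 0 <= r ->
  slope k sig r <= k%:R * Num.min r sig ^+ k.-1.
Proof.
move=> s0 r0; rewrite /slope ler_piMr//.
  by rewrite mulr_ge0 ?ler0n// exprn_ge0// min_ge0// ltW.
by rewrite gerBl divr_ge0 ?min_ge0// ltW.
Qed.

Lemma slope_vec_le n de v : 0 < de ->
  slope n.+1 (de ^+ 2) (normsq v) * enorm v <=
  n.+1%:R * tnorm de v ^+ (2 * n + 1).
Proof.
move=> d0; have [h|h] := leP de (enorm v).
  by rewrite slope_far// mul0r mulr_ge0// exprn_ge0// tnorm_ge0// ltW.
rewrite exprD exprM expr1 (sqr_tnorm _ (ltW d0)) (ltr_tnorm h) mulrA.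
rewrite ler_wpM2r ?enorm_ge0// (le_trans (slope_le _ _ _))//.
  by rewrite exprn_gt0.
exact: normsq_ge0.
Qed.

Lemma weight_le k sig r : 0 < sig -> 0 <= r ->
  weight k sig r <= Num.min r sig ^+ k.
Proof.
move=> s0 r0; rewrite /weight gerBl !mulr_ge0 ?invr_ge0 ?ler0n//.
  by rewrite exprn_ge0// min_ge0// ltW.
exact: ltW.
Qed.

(** Since [min r sig <= sig], the correction term is at most [k / (k + 1)] of the main one. Gronwall
    can thus be run on the differentiable weights and read off on the truncated moments. *)
Lemma weight_ge k sig r : 0 < sig -> 0 <= r ->
  k.+1%:R^-1 * Num.min r sig ^+ k <= weight k sig r.
Proof.
move=> s0 r0; rewrite /weight.
have m0 : 0 <= Num.min r sig by rewrite min_ge0// ltW.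
have h : Num.min r sig ^+ k.+1 / sig <= Num.min r sig ^+ k.
  by rewrite ler_pdivrMr// exprSr ler_wpM2l ?exprn_ge0// ge_min lexx orbT.
have k0 : 0 <= k%:R / k.+1%:R :> R by rewrite divr_ge0.
have {}h := ler_wpM2l k0 h.
have kE : k.+1%:R^-1 = 1 - k%:R / k.+1%:R :> R.
  by rewrite -natr1; field; rewrite natr1 pnatr_eq0.
by rewrite [X in X * _ <= _]kE mulrBl mul1r lerD2l lerN2.
Qed.

(** Without truncation the slope would be constant and the left side zero, which is the conservation
    of the moment of inertia. Only the part [- min r sig / sig] survives. It is a Lipschitz function
    of the truncated norm, so nothing has to be subtracted at order 1. *)
Lemma self_pointwise1 sig x y : 0 < sig ->
  `|cross x y * (slope 1 sig (normsq x) - slope 1 sig (normsq y))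
    / normsq (x - y)| <=
  (Num.min (normsq x) sig + Num.min (normsq y) sig) / sig.
Proof.
move=> s0.
wlog yx : x y / enorm y <= enorm x.
  move=> W; have [|yx] := leP (enorm y) (enorm x); first by move=> ?; exact: W.
  have := W y x (ltW yx).
  rewrite -(normsqN (y - x)) opprB (crossC x y) (addrC (Num.min (normsq y) _)).
  apply: le_trans; apply: eqW; congr (`|_|).
  by ring.
have [xy0|xy0] := eqVneq (enorm (x - y)) 0.
  have /eqP := enorm_eq0 xy0; rewrite subr_eq0 => /eqP <-.
  by rewrite !subrr !mulr0 mul0r normr0 divr_ge0 ?addr_ge0 ?min_ge0 ?normsq_ge0 ?ltW.
have xyp : 0 < enorm (x - y) by rewrite lt_neqAle enorm_ge0 andbT eq_sym.
have de0 : 0 < Num.sqrt sig by rewrite sqrtr_gt0.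
have deE : Num.sqrt sig ^+ 2 = sig by rewrite sqr_sqrtr// ltW.
rewrite -deE /slope !expr0 !mulr1 !mul1r -!(sqr_tnorm _ (ltW de0)) -sqr_enorm.
set de := Num.sqrt sig in de0 deE *.
set a := tnorm de x; set b := tnorm de y; set d := enorm (x - y) in xyp *.
have b0 : 0 <= b by rewrite tnorm_ge0// ltW.
have ba : b <= a by rewrite /a /b /tnorm le_min ge_min yx ge_min lexx orbT.
have abd : a - b <= d.
  have h := ler_enormB x y; rewrite /a /b /tnorm.
  by case: (leP (enorm x) de); case: (leP (enorm y) de); rewrite /d; lra.
have -> : cross x y * (1 - a ^+ 2 / de ^+ 2 - (1 - b ^+ 2 / de ^+ 2)) / d ^+ 2 =
    - cross x y * (a ^+ 2 - b ^+ 2) / d ^+ 2 / de ^+ 2 by ring.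
have dif0 : 0 <= a ^+ 2 - b ^+ 2.
  by rewrite subr_ge0 lerXn2r// nnegrE// (le_trans b0).
rewrite (normf_div (_ / d ^+ 2)) (normf_div _ (d ^+ 2)) (normrM _ (a ^+ 2 - _)).
rewrite normrN (ger0_norm dif0) (ger0_norm (sqr_ge0 d)) (ger0_norm (sqr_ge0 de)).
rewrite ler_pM2r ?invr_gt0 ?exprn_gt0// ler_pdivrMr ?exprn_gt0//.
have cr : `|cross x y| * (a ^+ 2 - b ^+ 2) <= enorm y * d * (a ^+ 2 - b ^+ 2).
  by rewrite ler_wpM2r// norm_crossB.
apply: le_trans cr _.
have [h|h] := leP (enorm y) de; last first.
  have -> : b = a.
    have h2 : de < enorm x by exact: lt_le_trans yx.
    by rewrite /a /b /tnorm !min_r ?ltW.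
  by rewrite subrr mulr0 mulr_ge0 ?sqr_ge0// addr_ge0 ?sqr_ge0.
have -> : enorm y = b by rewrite /b /tnorm min_l.
have t : (a - b) * (b * d * (a + b)) <= d * (b * d * (a + b)).
  by rewrite ler_wpM2r// !mulr_ge0 ?addr_ge0 ?(ltW xyp)// (le_trans b0).
have t2 : b * (a + b) * d ^+ 2 <= (a ^+ 2 + b ^+ 2) * d ^+ 2.
  rewrite ler_wpM2r ?sqr_ge0//.
  have : 0 <= a * (a - b) by rewrite mulr_ge0 ?subr_ge0// (le_trans b0).
  by rewrite !expr2; lra.
rewrite !expr2 in t2 *; lra.
Qed.

Lemma two_pi_ge1 : 1 <= 2 * pi :> R.
Proof. by have := pi_ge2 R; lra. Qed.

Lemma bs_kernelE x : bs_kernel x =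
  ((2 * pi)^-1 * ((normsq x)^-1 * - x.2), (2 * pi)^-1 * ((normsq x)^-1 * x.1)).
Proof. by []. Qed.

Lemma bs_kernelN x : bs_kernel (- x) = - bs_kernel x.
Proof.
by rewrite !bs_kernelE normsqN /= !mulrN opprK; congr pair => /=; rewrite ?mulrN ?opprK.
Qed.

(** Since [x] is orthogonal to [perp x], only [y] contributes to the product with [perp (x - y)];
    this is how the cross product enters. *)
Lemma dot_kernel x y :
  x.1 * (bs_kernel (x - y)).1 + x.2 * (bs_kernel (x - y)).2 =
  (2 * pi)^-1 * (cross x y / normsq (x - y)).
Proof. by rewrite bs_kernelE /cross /=; ring. Qed.

Lemma norm_two_piV (u : R) : `|(2 * pi)^-1 * u| <= `|u|.
Proof.
rewrite normrM ger0_norm ?invr_ge0 ?(le_trans ler01 two_pi_ge1)//.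
by rewrite ler_piMl// invf_le1 ?two_pi_ge1// (lt_le_trans ltr01 two_pi_ge1).
Qed.

Lemma invn_le x (u : R) : `|u| <= enorm x -> `|(normsq x)^-1 * u| <= (enorm x)^-1.
Proof.
move=> ux; rewrite normrM ger0_norm ?invr_ge0 ?normsq_ge0//.
have [x0|x0] := eqVneq (enorm x) 0.
  by rewrite -sqr_enorm x0 expr0n /= invr0 mul0r.
have xp : 0 < enorm x by rewrite lt_neqAle enorm_ge0 andbT eq_sym.
rewrite -sqr_enorm expr2 invfM -mulrA ler_piMr ?invr_ge0 ?enorm_ge0//.
by rewrite mulrC ler_pdivrMr// mul1r.
Qed.

Lemma bs_kernel_fst_le x : `|(bs_kernel x).1| <= (enorm x)^-1.
Proof.
rewrite bs_kernelE /= (le_trans (norm_two_piV _))// invn_le// normrN.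
exact: norm_snd_enorm.
Qed.

Lemma bs_kernel_snd_le x : `|(bs_kernel x).2| <= (enorm x)^-1.
Proof.
by rewrite bs_kernelE /= (le_trans (norm_two_piV _))// invn_le// norm_fst_enorm.
Qed.

(** Inversion satisfies the exact identity [|x/|x|^2 - y/|y|^2| = |x - y| / (|x| |y|)]. The
    Biot-Savart kernel is inversion, rotated by a right angle and scaled by [1 / (2 pi)]. *)
Lemma inversion_le de x y (p := (normsq x)^-1 *: x - (normsq y)^-1 *: y) :
  0 < de -> de <= enorm x -> de <= enorm y ->
  enorm p <= enorm (x - y) / de ^+ 2.
Proof.
move=> d0 dx dy.
have x0 : 0 < enorm x by exact: lt_le_trans dx.
have y0 : 0 < enorm y by exact: lt_le_trans dy.
have -> : enorm p = enorm (x - y) / (enorm x * enorm y).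
  apply/eqP; rewrite -(@eqrXn2 _ 2)// ?divr_ge0 ?mulr_ge0 ?enorm_ge0//.
  rewrite expr_div_n exprMn !sqr_enorm.
  have nx : x.1 ^+ 2 + x.2 ^+ 2 != 0.
    by rewrite gt_eqF// -[ltRHS]/(normsq x) -sqr_enorm exprn_gt0.
  have ny : y.1 ^+ 2 + y.2 ^+ 2 != 0.
    by rewrite gt_eqF// -[ltRHS]/(normsq y) -sqr_enorm exprn_gt0.
  apply/eqP; rewrite /p /normsq /=.
  by rewrite -![_ *: _]/(_ * _); field; rewrite nx ny.
rewrite ler_wpM2l ?enorm_ge0// lef_pV2 ?posrE ?mulr_gt0 ?exprn_gt0//.
by rewrite expr2 ler_pM// ltW.
Qed.

Lemma bs_kernel_lip de x y : 0 < de -> de <= enorm x -> de <= enorm y ->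
  `|(bs_kernel x).1 - (bs_kernel y).1| <= enorm (x - y) / de ^+ 2 /\
  `|(bs_kernel x).2 - (bs_kernel y).2| <= enorm (x - y) / de ^+ 2.
Proof.
move=> d0 dx dy; have h := inversion_le d0 dx dy.
rewrite !bs_kernelE /= -!mulrBr; split; apply: le_trans (norm_two_piV _) _;
  apply: le_trans h.
  rewrite -normrN; apply: le_trans (norm_snd_enorm _).
  by rewrite /= -![_ *: _]/(_ * _) !mulrN opprB opprK addrC.
by apply: le_trans (norm_fst_enorm _).
Qed.

(** If both displacements are shorter than [de], the two arguments stay at distance at least [de]
    from 0 and the kernel is Lipschitz there. Otherwise each kernel value is bounded separately: one
    truncated norm equals [de], so [1 / |q| <= 1 / de] fits into the first term, and the singular
    value goes into the term carrying [far]. *)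
Lemma kernel_split de (q v v' : R * R) : 0 < de -> 3 * de <= enorm q ->
  let e := (tnorm de v + tnorm de v') / de ^+ 2 +
           (far de v + far de v') * (enorm (q + v - v'))^-1 in
  `|(bs_kernel (q + v - v')).1 - (bs_kernel q).1| <= e /\
  `|(bs_kernel (q + v - v')).2 - (bs_kernel q).2| <= e.
Proof.
move=> d0 dq /=.
have q0 : 0 < enorm q by apply: lt_le_trans dq; rewrite mulr_gt0.
have dd : 0 < de ^+ 2 by rewrite exprn_gt0.
have i0 : 0 <= (enorm (q + v - v'))^-1 by rewrite invr_ge0 enorm_ge0.
have [hv|hv] := ltP (enorm v) de; last first.
  have e0 : (enorm (q + v - v'))^-1 + (enorm q)^-1 <=
     (tnorm de v + tnorm de v') / de ^+ 2 +
           (far de v + far de v') * (enorm (q + v - v'))^-1.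
    rewrite addrC lerD//.
      have -> : tnorm de v = de by rewrite /tnorm min_r.
      have t0 : 0 <= tnorm de v' by rewrite tnorm_ge0// ltW.
      rewrite ler_pdivlMr// expr2 mulrA.
      have : (enorm q)^-1 * de <= 1.
        by rewrite mulrC ler_pdivrMr// mul1r; lra.
      by move=> /(ler_wpM2r (ltW d0)); lra.
    by rewrite {1}/far hv mulrDl mul1r lerDl mulr_ge0// far_ge0.
  split; apply: le_trans e0; apply: le_trans (ler_normB _ _) _; apply: lerD;
  by rewrite ?bs_kernel_fst_le ?bs_kernel_snd_le.
have [hv'|hv'] := ltP (enorm v') de; last first.
  have e0 : (enorm (q + v - v'))^-1 + (enorm q)^-1 <=
     (tnorm de v + tnorm de v') / de ^+ 2 +
           (far de v + far de v') * (enorm (q + v - v'))^-1.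
    rewrite addrC lerD//.
      have -> : tnorm de v' = de by rewrite /tnorm min_r.
      have t0 : 0 <= tnorm de v by rewrite tnorm_ge0// ltW.
      rewrite ler_pdivlMr// expr2 mulrA.
      have : (enorm q)^-1 * de <= 1.
        by rewrite mulrC ler_pdivrMr// mul1r; lra.
      by move=> /(ler_wpM2r (ltW d0)); lra.
    by rewrite {2}/far hv' mulrDl mul1r lerDr mulr_ge0// far_ge0.
  split; apply: le_trans e0; apply: le_trans (ler_normB _ _) _; apply: lerD;
  by rewrite ?bs_kernel_fst_le ?bs_kernel_snd_le.
have h1 : enorm (v - v') <= enorm v + enorm v'.
  by rewrite -(enormN v') ler_enormD.
have h2 : de <= enorm (q + v - v').
  have := ler_enormB q (v' - v).
  by rewrite (enormBC v' v) opprB addrA; lra.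
have dq' : de <= enorm q by lra.
have {h2 dq'} := bs_kernel_lip d0 h2 dq'.
have -> : q + v - v' - q = v - v' by rewrite addrAC [q + v]addrC addrK.
have h3 : enorm (v - v') / de ^+ 2 <=
     (tnorm de v + tnorm de v') / de ^+ 2 +
           (far de v + far de v') * (enorm (q + v - v'))^-1.
  rewrite !ltr_tnorm// -[leLHS]addr0 lerD//.
    by rewrite ler_wpM2r// invr_ge0 ltW.
  by rewrite mulr_ge0// addr_ge0 ?far_ge0.
by move=> [k1 k2]; split; apply: le_trans h3.
Qed.

End KernelBounds.

(** * Expectations of real functions and exchange of double integrals *)

Section Expectation.
Context {R : realType} d (T : measurableType d) (P : probability T R).
Implicit Types (f g : T -> R).

Definition L1 f := P.-integrable setT (EFin \o f).
Definition Ex f : R := \int[P]_z f z.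
Definition mf f := measurable_fun [set: T] f.

Lemma L1_mf f : L1 f -> mf f.
Proof. by move=> /integrableP[/measurable_EFinP]. Qed.

Lemma L1_le f g : mf f -> L1 g -> (forall z, `|f z| <= g z) -> L1 f.
Proof.
move=> mff L1g fg; apply: le_integrable L1g => //.
  exact/measurable_EFinP.
move=> z _ /=; rewrite lee_fin (le_trans (fg z))//.
exact: ler_norm.
Qed.

Lemma L1_cst (r : R) : L1 (fun=> r).
Proof. exact: finite_measure_integrable_cst. Qed.

Lemma L1_bounded (M : R) f : mf f -> (forall z, `|f z| <= M) -> L1 f.
Proof. by move=> mff fM; apply: (L1_le mff (L1_cst M)). Qed.

Lemma L1D f g : L1 f -> L1 g -> L1 (fun z => f z + g z).
Proof.
move=> Lf Lg; have := integrableD measurableT Lf Lg.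
by apply: eq_integrable.
Qed.

Lemma L1Zl (r : R) f : L1 f -> L1 (fun z => r * f z).
Proof.
move=> Lf; have := integrableZl measurableT r Lf.
by apply: eq_integrable.
Qed.

Lemma L1Zr (r : R) f : L1 f -> L1 (fun z => f z * r).
Proof. by move=> /(L1Zl r); under eq_fun do rewrite mulrC. Qed.

Lemma L1N f : L1 f -> L1 (fun z => - f z).
Proof. by move=> /(L1Zl (-1)); under eq_fun do rewrite mulN1r. Qed.

Lemma L1B f g : L1 f -> L1 g -> L1 (fun z => f z - g z).
Proof. by move=> Lf /L1N; exact: L1D. Qed.

Lemma L1_norm f : L1 f -> L1 (fun z => `|f z|).
Proof. by move=> /integrable_norm. Qed.

Lemma L1_sum (I : Type) (s : seq I) (Q : pred I) (F : I -> T -> R) :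
  (forall i, Q i -> L1 (F i)) -> L1 (fun z => \sum_(i <- s | Q i) F i z).
Proof.
move=> LF; elim: s => [|i s IH].
  by under eq_fun do rewrite big_nil; exact: L1_cst.
case Qi : (Q i); under eq_fun do rewrite big_cons Qi; last exact: IH.
by apply: L1D => //; exact: LF.
Qed.

Lemma L1_boundM (M : R) f g : mf f -> (forall z, `|f z| <= M) -> L1 g ->
  L1 (fun z => f z * g z).
Proof.
move=> mff fM Lg; apply: (@L1_le _ (fun z => M * `|g z|)).
- by apply: measurable_funM => //; exact: L1_mf.
- by apply: L1Zl; exact: L1_norm.
- by move=> z; rewrite normrM ler_wpM2r.
Qed.

Lemma ExD f g : L1 f -> L1 g -> Ex (fun z => f z + g z) = Ex f + Ex g.
Proof. by move=> Lf Lg; rewrite /Ex RintegralD. Qed.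

Lemma ExB f g : L1 f -> L1 g -> Ex (fun z => f z - g z) = Ex f - Ex g.
Proof. by move=> Lf Lg; rewrite /Ex RintegralB. Qed.

Lemma ExZl (r : R) f : L1 f -> Ex (fun z => r * f z) = r * Ex f.
Proof. by move=> Lf; rewrite /Ex RintegralZl. Qed.

Lemma ExZr (r : R) f : L1 f -> Ex (fun z => f z * r) = Ex f * r.
Proof. by move=> Lf; rewrite /Ex RintegralZr. Qed.

Lemma ExN f : L1 f -> Ex (fun z => - f z) = - Ex f.
Proof.
move=> Lf; rewrite -mulN1r -ExZl//; congr Ex.
by apply/funext => z; rewrite mulN1r.
Qed.

Lemma Ex_cst (r : R) : Ex (fun=> r) = r.
Proof. by rewrite /Ex /Rintegral integral_cst//= probability_setT mule1. Qed.

Lemma eq_Ex f g : f =1 g -> Ex f = Ex g.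
Proof. by move=> fg; congr Ex; apply/funext. Qed.

Lemma eq_L1 f g : f =1 g -> L1 f -> L1 g.
Proof. by move=> /funext ->. Qed.

Lemma Ex_sum (I : Type) (s : seq I) (Q : pred I) (F : I -> T -> R) :
  (forall i, Q i -> L1 (F i)) ->
  Ex (fun z => \sum_(i <- s | Q i) F i z) = \sum_(i <- s | Q i) Ex (F i).
Proof.
move=> LF; elim: s => [|i s IH].
  by under eq_fun do rewrite big_nil; rewrite Ex_cst big_nil.
case Qi : (Q i); under eq_fun do rewrite big_cons Qi;
  rewrite big_cons Qi; last exact: IH.
by rewrite ExD// ?IH//; [exact: LF|exact: L1_sum].
Qed.

Lemma Ex_le f g : L1 f -> L1 g -> (forall z, f z <= g z) -> Ex f <= Ex g.
Proof. by move=> Lf Lg fg; apply: le_Rintegral. Qed.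

Lemma Ex_ge0 f : (forall z, 0 <= f z) -> 0 <= Ex f.
Proof. by move=> f0; apply: Rintegral_ge0. Qed.

Lemma norm_Ex f : L1 f -> `|Ex f| <= Ex (fun z => `|f z|).
Proof. by move=> Lf; apply: le_normr_Rintegral. Qed.

Lemma norm_Ex_le f g : L1 f -> L1 g -> (forall z, `|f z| <= g z) ->
  `|Ex f| <= Ex g.
Proof.
move=> Lf Lg fg; apply: le_trans (norm_Ex Lf) _.
by apply: Ex_le => //; exact: L1_norm.
Qed.

Lemma Ex_sqr f : L1 f -> L1 (fun z => f z ^+ 2) -> Ex f ^+ 2 <= Ex (fun z => f z ^+ 2).
Proof.
move=> Lf Lf2; rewrite -subr_ge0.
have -> : Ex (fun z => f z ^+ 2) - Ex f ^+ 2 = Ex (fun z => (f z - Ex f) ^+ 2).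
  under [RHS]eq_Ex => z.
    rewrite (_ : _ ^+ 2 = f z ^+ 2 - 2 * Ex f * f z + Ex f ^+ 2); last by ring.
    over.
  have LZ := L1Zl (2 * Ex f) Lf.
  rewrite (ExD (L1B Lf2 LZ) (L1_cst (Ex f ^+ 2))) (ExB Lf2 LZ) (ExZl _ Lf) Ex_cst.
  by ring.
by apply: Ex_ge0 => z; rewrite sqr_ge0.
Qed.

Lemma EFin_Ex f : L1 f -> (Ex f)%:E = (\int[P]_z (f z)%:E)%E.
Proof. by move=> Lf; rewrite /Ex /Rintegral fineK// integrable_fin_num. Qed.

Lemma measurable_section (f : T * T -> R) z :
  measurable_fun setT f -> measurable_fun setT (fun z' => f (z, z')).
Proof. by move=> mff; apply: measurableT_comp => //; exact: measurable_fun_pair. Qed.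

Section Swap.
Variables (k : T * T -> R) (M B : R).
Hypothesis mk : measurable_fun setT k.
Hypothesis ksym : forall z z', k (z, z') = k (z', z).
Hypothesis M0 : 0 <= M.
Hypothesis Lk : forall z, L1 (fun z' => k (z, z')).
Hypothesis kB : forall z, Ex (fun z' => k (z, z')) <= B.
Implicit Type Q : T * T -> R.

(** The kernel [k] may be singular on the diagonal, but its inner expectation is bounded by [B]
    uniformly in [z]. Tonelli over a probability space then gives integrability on the product. *)
Lemma dominated_integrable Q : measurable_fun setT Q ->
  (forall p, `|Q p| <= M * k p) -> (P \x P)%E.-integrable setT (EFin \o Q).
Proof.
move=> mQ Qk.
apply/integrable12ltyP; first exact/measurable_EFinP.
apply: (@le_lt_trans _ _ (\int[P]_x (M * B)%:E)%E); last first.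
  by rewrite integral_cst//= probability_setT mule1 ltry.
apply: ge0_le_integral => //.
- by move=> z _; exact: integral_ge0.
- have := @measurable_fun_fubini_tonelli_F _ _ _ _ _ P (abse \o (EFin \o Q)).
  apply; last by move=> p; exact: abse_ge0.
  by apply: measurableT_comp => //; exact/measurable_EFinP.
- move=> z _; apply: le_trans (_ : (\int[P]_z' (M * k (z, z'))%:E <= _)%E).
    apply: ge0_le_integral => //.
    + apply: measurableT_comp => //; apply/measurable_EFinP.
      exact: measurable_section.
    + apply/measurable_EFinP; apply: measurable_funM => //.
      exact: measurable_section.
    + by move=> y _; rewrite lee_fin.
  by rewrite -EFin_Ex ?lee_fin ?ExZl ?ler_wpM2l//; exact: L1Zl.
Qed.

Lemma dominated_L1 Q z : measurable_fun setT Q ->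
  (forall p, `|Q p| <= M * k p) -> L1 (fun z' => Q (z, z')).
Proof.
move=> mQ Qk; apply: (@L1_le _ (fun z' => M * k (z, z'))) => //.
  exact: measurable_section.
exact: L1Zl.
Qed.

Lemma dominated_L1_Ex Q : measurable_fun setT Q ->
  (forall p, `|Q p| <= M * k p) -> L1 (fun z => Ex (fun z' => Q (z, z'))).
Proof.
move=> mQ Qk.
have := integrable_fubini_F (dominated_integrable mQ Qk).
apply: eq_integrable => // z _ /=.
by rewrite EFin_Ex//; exact: dominated_L1.
Qed.

(** Fubini on real-valued expectations. Symmetry of [k] makes the transposed integrand dominated as
    well, so its inner integrals are finite too. *)
Lemma Ex_swap Q : measurable_fun setT Q ->
  (forall p, `|Q p| <= M * k p) ->
  Ex (fun z => Ex (fun z' => Q (z, z'))) = Ex (fun z => Ex (fun z' => Q (z', z))).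
Proof.
move=> mQ Qk.
have h := Fubini (dominated_integrable mQ Qk).
rewrite /Ex /Rintegral.
have -> : (\int[P]_z (fine (\int[P]_z' (Q (z, z'))%:E)%E)%:E =
          \int[P]_z \int[P]_z' (Q (z, z'))%:E)%E.
  by apply: eq_integral => z _; rewrite -EFin_Ex//; exact: dominated_L1.
rewrite h; congr fine.
apply: eq_integral => z _; rewrite -EFin_Ex//.
apply: (@dominated_L1 (fun p => Q (p.2, p.1))) => //.
  by apply: measurableT_comp => //; exact: measurable_fun_pair.
by case=> a b /=; rewrite ksym.
Qed.

End Swap.
End Expectation.

(** * Measurability of norms and kernels *)

Section PlaneMeasurability.
Context {R : realType} d (S : measurableType d).
Variable F : S -> R * R.
Hypothesis mF1 : measurable_fun [set: S] (fun s => (F s).1).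
Hypothesis mF2 : measurable_fun [set: S] (fun s => (F s).2).

Lemma measurable_normsq : measurable_fun [set: S] (fun s => normsq (F s)).
Proof. by apply: measurable_funD; exact: measurable_funX. Qed.

Lemma measurable_enorm : measurable_fun [set: S] (fun s => enorm (F s)).
Proof.
under eq_fun do rewrite /enorm -powR12_sqrt ?normsq_ge0//.
by apply: (measurableT_comp (measurable_powR _)); exact: measurable_normsq.
Qed.

Lemma measurable_inv_enorm : measurable_fun [set: S] (fun s => (enorm (F s))^-1).
Proof.
under eq_fun do rewrite -powR_inv1 ?enorm_ge0//.
by apply: (measurableT_comp (measurable_powR _)); exact: measurable_enorm.
Qed.

Lemma measurable_inv_normsq :
  measurable_fun [set: S] (fun s => (normsq (F s))^-1).
Proof.
under eq_fun do rewrite -powR_inv1 ?normsq_ge0//.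
by apply: (measurableT_comp (measurable_powR _)); exact: measurable_normsq.
Qed.

Lemma measurable_kernel1 :
  measurable_fun [set: S] (fun s => (bs_kernel (F s)).1).
Proof.
apply: measurable_funM => //; apply: measurable_funM.
  exact: measurable_inv_normsq.
exact: measurable_funN.
Qed.

Lemma measurable_kernel2 :
  measurable_fun [set: S] (fun s => (bs_kernel (F s)).2).
Proof.
apply: measurable_funM => //; apply: measurable_funM => //.
exact: measurable_inv_normsq.
Qed.

End PlaneMeasurability.

Lemma measurable_lt_cst {R : realType} d (T : measurableType d) (f : T -> R) s :
  measurable_fun setT f -> measurable [set z | f z < s].
Proof.
move=> mff; rewrite (_ : [set _ | _] = setT `&` f @^-1` `]-oo, s[); first exact: mff.
by rewrite setTI; apply/seteqP; split => z /=; rewrite in_itv.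
Qed.

(** * Expectation of the inverse distance under a bounded density *)

Section InverseDistance.
Context {R : realType} d (T : measurableType d) (P : probability T R).
Variables (X : T -> R * R) (kap : R).
Hypothesis mX1 : mf (fun z => (X z).1).
Hypothesis mX2 : mf (fun z => (X z).2).

(** A bounded density, tested on squares because product measures are computed on them directly. The
    half-side is [s], so [kap] includes the area factor 4. *)
Definition box_density := forall (x : R * R) (s : R), 0 < s ->
  (P [set z | (`|(X z).1 - x.1| < s /\ `|(X z).2 - x.2| < s)%R]
     <= (kap * s ^+ 2)%:E)%E.

Hypothesis dens : box_density.

Lemma kap_ge0 : 0 <= kap.
Proof.
have := dens (0, 0) ltr01; rewrite expr1n mulr1 => h.
by rewrite -lee_fin; exact: le_trans h.
Qed.

(** For [0 < u < t] take the least [n] with [t / 2^(n+1) <= u]. By minimality [u < t / 2^n], so the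
    single term of index [n] already bounds [1 / u]. *)
Lemma inv_dyadic (t u : R) : 0 < t -> 0 <= u ->
  ((u^-1)%:E <= (t^-1)%:E +
    \sum_(n <oo) ((2 ^+ n.+1 / t) * (u < t / 2 ^+ n)%R%:R)%:E)%E.
Proof.
move=> t0 u0.
pose c n : R := (2 ^+ n.+1 / t) * (u < t / 2 ^+ n)%R%:R.
have c0 n : (0 <= (c n)%:E)%E.
  by rewrite lee_fin mulr_ge0// divr_ge0 ?exprn_ge0// ltW.
have s0 : (0 <= \sum_(n <oo) (c n)%:E)%E by apply: nneseries_ge0.
(* The inverse of 0 is 0, so this case follows from the positivity of the right side. *)
have [uE|un0] := eqVneq u 0.
  have -> : u^-1 = 0 by rewrite uE invr0.
  by apply: adde_ge0 => //; rewrite lee_fin invr_ge0 ltW.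
have {un0}up : 0 < u by rewrite lt_neqAle eq_sym un0.
have [tu|ut] := leP t u.
  apply: (@le_trans _ _ (t^-1)%:E); last exact: leeDl.
  by rewrite lee_fin lef_pV2 ?posrE.
have ex : exists n, t / 2 ^+ n.+1 <= u.
  exists (Num.truncn (t / u)).
  rewrite ler_pdivrMr ?exprn_gt0// mulrC -ler_pdivrMr//.
  have /truncn_itv/andP[_ /ltW h] : 0 <= t / u by rewrite divr_ge0 ?ltW.
  by rewrite (le_trans h)// -natrX ler_nat ltnW// ltn_expl.
have [n hn nmin] := ex_minnP ex.
have utn : u < t / 2 ^+ n.
  case: n hn nmin => [|n] hn nmin; first by rewrite expr0 divr1.
  by rewrite ltNge; apply/negP => /nmin; rewrite ltnn.
apply: (@le_trans _ _ (\sum_(n <oo) (c n)%:E)%E); last first.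
  by apply: leeDr => //; rewrite lee_fin invr_ge0 ltW.
apply: le_trans (nneseries_lim_ge n.+1 (fun k _ _ => c0 k)).
rewrite big_nat_recr//= -[leLHS]add0e leeD ?sume_ge0//.
rewrite lee_fin /c utn mulr1 -invf_div lef_pV2 ?posrE//.
by rewrite divr_gt0// exprn_gt0.
Qed.

(** At distance at least [t] the weight [phi] is kept, which gives [Ex phi / t]. Closer to [x] it is
    bounded by 1 and the density bound is summed over dyadic discs. The free radius [t] is tuned
    later to the mass of [phi]. *)
Lemma inv_moment (x : R * R) (phi : T -> R) (t : R) :
  mf phi -> (forall z, 0 <= phi z <= 1) -> 0 < t ->
  (\int[P]_z (phi z * (enorm (x - X z))^-1)%:E
    <= (Ex P phi / t + 4 * kap * t)%:E)%E.
Proof.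
move=> mphi phi01 t0.
have mu : mf (fun z => enorm (x - X z)).
  by apply: measurable_enorm; apply: measurable_funB.
have mlt s : measurable [set z | enorm (x - X z) < s].
  exact: measurable_lt_cst.
have mltf s : measurable_fun setT (fun z => (enorm (x - X z) < s)%R%:R : R).
  rewrite (_ : (fun _ => _) = \1_[set z | enorm (x - X z) < s]).
    exact: measurable_indic.
  by apply/funext => z; rewrite indicE mem_setE.
pose c n (z : T) : R := (2 ^+ n.+1 / t) * (enorm (x - X z) < t / 2 ^+ n)%R%:R.
have c0 n z : 0 <= c n z.
  by rewrite mulr_ge0// divr_ge0 ?exprn_ge0// ltW.
have mc n : measurable_fun setT (fun z => (c n z)%:E).
  by apply/measurable_EFinP; apply: measurable_funM.
have phi0 z : 0 <= phi z by have /andP[] := phi01 z.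
have Lphi : L1 P phi.
  apply: (@L1_bounded _ _ _ _ 1) => // z; have /andP[? ?] := phi01 z.
  by rewrite ger0_norm.
apply: (@le_trans _ _ (\int[P]_z ((phi z / t)%:E + \sum_(n <oo) (c n z)%:E))%E).
  apply: ge0_le_integral => //.
  - by move=> z _; rewrite lee_fin mulr_ge0 ?invr_ge0 ?enorm_ge0.
  - apply/measurable_EFinP; apply: measurable_funM => //.
    by apply: measurable_inv_enorm; apply: measurable_funB.
  - apply: emeasurable_funD; first by apply/measurable_EFinP; exact: measurable_funM.
    by apply: ge0_emeasurable_sum => // n z _ _; rewrite lee_fin.
  - move=> z _; have /andP[p0 p1] := phi01 z.
    have h := inv_dyadic t0 (enorm_ge0 (x - X z)).
    rewrite EFinM; apply: le_trans (lee_wpmul2l _ h) _; first by rewrite lee_fin.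
    rewrite ge0_muleDr; last 2 first.
    + by rewrite lee_fin invr_ge0 ltW.
    + by apply: nneseries_ge0 => n _ _; rewrite lee_fin; exact: c0.
    rewrite -EFinM leeD2l//.
    rewrite -[leRHS]mul1e lee_wpmul2r ?lee_fin//.
    by apply: nneseries_ge0 => n _ _; rewrite lee_fin; exact: c0.
rewrite ge0_integralD//; last 4 first.
- by move=> z _; rewrite lee_fin divr_ge0// ltW.
- by apply/measurable_EFinP; exact: measurable_funM.
- by move=> z _; apply: nneseries_ge0 => n _ _; rewrite lee_fin.
- by apply: ge0_emeasurable_sum => // n z _ _; rewrite lee_fin.
rewrite EFinD leeD//.
  by rewrite -EFin_Ex ?ExZr//; exact: L1Zr.
rewrite integral_nneseries//; last by move=> n z _; rewrite lee_fin.
(* The dyadic term of index [n] is at most [2^(n+1) / t * kap (t / 2^n)^2 = 4 kap t / 2^(n+1)], and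
   these bounds add up to [4 kap t]. *)
have := @cvg_geometric_eseries_half R (4 * kap * t) 0.
rewrite expr0 divr1 => /cvg_lim <-//.
apply: lee_nneseries => n _.
  by move=> _; apply: integral_ge0 => z _; rewrite lee_fin.
rewrite /c; under eq_integral do rewrite EFinM.
have -> : (\int[P]_z ((2 ^+ n.+1 / t)%:E * ((enorm (x - X z) < t / 2 ^+ n)%R%:R)%:E)
   = (2 ^+ n.+1 / t)%:E * P [set z | (enorm (x - X z) < t / 2 ^+ n)%R])%E.
  rewrite ge0_integralZl//; last 2 first.
  - by apply/measurable_EFinP.
  - by rewrite lee_fin divr_ge0 ?exprn_ge0// ltW.
  congr (_ * _)%E; rewrite -[X in _ = P X]setIT -integral_indic//.
  by apply: eq_integral => z _; rewrite indicE mem_setE.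
have tn0 : 0 < t / 2 ^+ n by rewrite divr_gt0// exprn_gt0.
have hP : (P [set z | (enorm (x - X z) < t / 2 ^+ n)%R] <=
    (kap * (t / 2 ^+ n) ^+ 2)%:E)%E.
  apply: le_trans (dens x tn0); apply: le_measure; rewrite ?inE//.
    apply: measurableI.
    - apply: measurable_lt_cst; apply: measurableT_comp => //.
      exact: measurable_funB.
    - apply: measurable_lt_cst; apply: measurableT_comp => //.
      exact: measurable_funB.
  move=> z /= h; split; apply: le_lt_trans h; rewrite distrC.
    exact: (norm_fst_enorm (x - X z)).
  exact: (norm_snd_enorm (x - X z)).
apply: le_trans (lee_wpmul2l _ hP) _.
  by rewrite lee_fin divr_ge0 ?exprn_ge0// ltW.
rewrite -EFinM lee_fin addn1 natrX; apply: eqW.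
rewrite !exprS; field.
by rewrite expf_neq0 ?pnatr_eq0// gt_eqF.
Qed.

Lemma inv_L1 (x : R * R) : L1 P (fun z => (enorm (x - X z))^-1).
Proof.
apply/integrableP; split.
  apply/measurable_EFinP.
  by apply: measurable_inv_enorm; apply: measurable_funB.
have h01 (z : T) : 0 <= (1 : R) <= 1 by rewrite ler01 lexx.
have h := @inv_moment x (fun=> 1) 1 (measurable_cst _) h01 ltr01.
apply: (le_lt_trans _ (le_lt_trans h (ltry _))).
apply: eqW; apply: eq_integral => z _ /=.
by rewrite mul1r ger0_norm// invr_ge0 enorm_ge0.
Qed.

Lemma inv_Ex (x : R * R) (phi : T -> R) (t : R) :
  mf phi -> (forall z, 0 <= phi z <= 1) -> 0 < t ->
  Ex P (fun z => phi z * (enorm (x - X z))^-1) <= Ex P phi / t + 4 * kap * t.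
Proof.
move=> mphi phi01 t0; rewrite -lee_fin EFin_Ex ?inv_moment//.
apply: (@L1_boundM _ _ _ _ 1) => //; last exact: inv_L1.
by move=> z; have /andP[? ?] := phi01 z; rewrite ger0_norm.
Qed.

Lemma inv_Ex1 (x : R * R) (t : R) : 0 < t ->
  Ex P (fun z => (enorm (x - X z))^-1) <= t^-1 + 4 * kap * t.
Proof.
move=> t0; have h01 (z : T) : 0 <= (1 : R) <= 1 by rewrite ler01 lexx.
have := @inv_Ex x (fun=> 1) t (measurable_cst _) h01 t0.
by rewrite Ex_cst div1r; under eq_Ex do rewrite mul1r.
Qed.

End InverseDistance.

Lemma eq_opp0 {R : realType} (x : R) : x = - x -> x = 0.
Proof. by lra. Qed.

Lemma two_piV_ge0 {R : realType} : 0 <= (2 * pi)^-1 :> R.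
Proof. by rewrite invr_ge0 (le_trans ler01 two_pi_ge1). Qed.

Lemma half_estimate {R : realType} (u c e1 e2 v w : R) :
  u + u <= c * (- (0 * e2) + 0 * e1 + (v * w + v * w)) -> u <= c * (v * w).
Proof. by lra. Qed.

Lemma bs_kernelC {R : realType} (x y : R * R) :
  bs_kernel (x - y) = - bs_kernel (y - x).
Proof. by rewrite -bs_kernelN opprB. Qed.

(** * Symmetrization of the self-interaction at a fixed time *)

Section SelfStatic.
Context {R : realType} d (T : measurableType d) (P : probability T R).
Variables (V : T -> R * R) (B : R).
Hypothesis mV1 : mf (fun z => (V z).1).
Hypothesis mV2 : mf (fun z => (V z).2).
Hypothesis invL1 : forall x, L1 P (fun z => (enorm (x - V z))^-1).
Hypothesis invB : forall x, Ex P (fun z => (enorm (x - V z))^-1) <= B.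

Let k (p : T * T) : R := (enorm (V p.1 - V p.2))^-1.

Let mW1 : measurable_fun setT (fun p : T * T => (V p.1 - V p.2).1).
Proof.
by apply: measurable_funB;
  [apply: (measurableT_comp mV1)|apply: (measurableT_comp mV1)].
Qed.

Let mW2 : measurable_fun setT (fun p : T * T => (V p.1 - V p.2).2).
Proof.
by apply: measurable_funB;
  [apply: (measurableT_comp mV2)|apply: (measurableT_comp mV2)].
Qed.

Let mk : measurable_fun setT k.
Proof. exact: measurable_inv_enorm. Qed.

Let ksym z z' : k (z, z') = k (z', z).
Proof. by rewrite /k enormBC. Qed.

Definition selfvel1 z := Ex P (fun z' => (bs_kernel (V z - V z')).1).
Definition selfvel2 z := Ex P (fun z' => (bs_kernel (V z - V z')).2).

Let mK1 : measurable_fun setT (fun p : T * T => (bs_kernel (V p.1 - V p.2)).1).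
Proof. exact: measurable_kernel1. Qed.

Let mK2 : measurable_fun setT (fun p : T * T => (bs_kernel (V p.1 - V p.2)).2).
Proof. exact: measurable_kernel2. Qed.

Let K1k p : `|(bs_kernel (V p.1 - V p.2)).1| <= 1 * k p.
Proof. by rewrite mul1r bs_kernel_fst_le. Qed.

Let K2k p : `|(bs_kernel (V p.1 - V p.2)).2| <= 1 * k p.
Proof. by rewrite mul1r bs_kernel_snd_le. Qed.

Lemma selfK1_L1 z : L1 P (fun z' => (bs_kernel (V z - V z')).1).
Proof. exact: (dominated_L1 (fun z => invL1 (V z)) z mK1 K1k). Qed.

Lemma selfK2_L1 z : L1 P (fun z' => (bs_kernel (V z - V z')).2).
Proof. exact: (dominated_L1 (fun z => invL1 (V z)) z mK2 K2k). Qed.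

Lemma selfvel1_L1 : L1 P selfvel1.
Proof. exact: (dominated_L1_Ex mk (@ler01 R) (fun z => invL1 (V z)) (fun z => invB (V z)) mK1 K1k). Qed.

Lemma selfvel2_L1 : L1 P selfvel2.
Proof. exact: (dominated_L1_Ex mk (@ler01 R) (fun z => invL1 (V z)) (fun z => invB (V z)) mK2 K2k). Qed.

(** The kernel is odd, so exchanging the two variables changes the sign: a blob does not move its
    own center of mass. *)
Lemma Ex_selfvel1 : Ex P selfvel1 = 0.
Proof.
have h := Ex_swap mk ksym (@ler01 R) (fun z => invL1 (V z)) (fun z => invB (V z)) mK1 K1k.
apply: eq_opp0; rewrite -ExN; last exact: selfvel1_L1.
apply: etrans h _; apply: eq_Ex => z; rewrite /selfvel1 -ExN; last exact: selfK1_L1.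
by apply: eq_Ex => z'; rewrite (bs_kernelC (V z')).
Qed.

Lemma Ex_selfvel2 : Ex P selfvel2 = 0.
Proof.
have h := Ex_swap mk ksym (@ler01 R) (fun z => invL1 (V z)) (fun z => invB (V z)) mK2 K2k.
apply: eq_opp0; rewrite -ExN; last exact: selfvel2_L1.
apply: etrans h _; apply: eq_Ex => z; rewrite /selfvel2 -ExN; last exact: selfK2_L1.
by apply: eq_Ex => z'; rewrite (bs_kernelC (V z')).
Qed.

Hypothesis LV1 : L1 P (fun z => (V z).1).
Hypothesis LV2 : L1 P (fun z => (V z).2).
Hypothesis EV1 : Ex P (fun z => (V z).1) = 0.
Hypothesis EV2 : Ex P (fun z => (V z).2) = 0.
Variables (G h f g : R * R -> R) (M : R).
Hypothesis mG : mf (G \o V).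
Hypothesis mh : mf (h \o V).
Hypothesis Lf : L1 P (f \o V).
Hypothesis Lg : L1 P (g \o V).
Hypothesis GM : forall x, `|G x| * enorm x <= M.
Hypothesis hM : forall x, `|h x| <= M.
Hypothesis pw : forall x y, cross x y * (G x - G y) / normsq (x - y) <=
  cross x y * (h x - h y) + (f x * g y + f y * g x).

(* After symmetrization the integrand is bounded by [pw]; its part linear in
   the centered variable integrates to zero. *)
Lemma self_estimate_le :
  Ex P (fun z => G (V z) * ((V z).1 * selfvel1 z + (V z).2 * selfvel2 z)) <=
  (2 * pi)^-1 * (Ex P (f \o V) * Ex P (g \o V)).
Proof.
pose Q (p : T * T) := G (V p.1) * ((V p.1).1 * (bs_kernel (V p.1 - V p.2)).1 +
   (V p.1).2 * (bs_kernel (V p.1 - V p.2)).2).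
have M0 : 0 <= M by apply: le_trans (GM (0, 0)); rewrite mulr_ge0// enorm_ge0.
have mQ : measurable_fun setT Q.
  apply: measurable_funM; first exact: (measurableT_comp mG).
  apply: measurable_funD; apply: measurable_funM => //.
    exact: (measurableT_comp mV1).
  exact: (measurableT_comp mV2).
have Qk p : `|Q p| <= (2 * M) * k p.
  rewrite /Q normrM.
  have h1 : `|(V p.1).1 * (bs_kernel (V p.1 - V p.2)).1 +
   (V p.1).2 * (bs_kernel (V p.1 - V p.2)).2| <= enorm (V p.1) * (2 * k p).
    apply: le_trans (ler_normD _ _) _.
    rewrite (normrM (V p.1).1) (normrM (V p.1).2).
    rewrite (_ : _ * (2 * k p) = enorm (V p.1) * k p + enorm (V p.1) * k p); last by ring.
    rewrite lerD// ler_pM//.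
    - exact: norm_fst_enorm.
    - by have := K1k p; rewrite mul1r.
    - exact: norm_snd_enorm.
    - by have := K2k p; rewrite mul1r.
  apply: le_trans (ler_wpM2l (normr_ge0 _) h1) _.
  have -> : 2 * M * k p = M * (2 * k p) by ring.
  rewrite [leLHS]mulrA; apply: ler_wpM2r; last exact: GM.
  by rewrite mulr_ge0// invr_ge0 enorm_ge0.
have M20 : 0 <= 2 * M by rewrite mulr_ge0.
have invL z := invL1 (V z).
have invE z := invB (V z).
have LQ z : L1 P (fun z' => Q (z, z')) := dominated_L1 invL z mQ Qk.
pose Q' (p : T * T) := Q (p.2, p.1).
have mQ' : measurable_fun setT Q'.
  by apply: measurableT_comp => //; exact: measurable_fun_pair.
have Q'k p : `|Q' p| <= (2 * M) * k p.
  by case: p => z z'; rewrite ksym; exact: Qk.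
have LQ' z : L1 P (fun z' => Q (z', z)) := dominated_L1 invL z mQ' Q'k.
have sw := Ex_swap mk ksym M20 invL invE mQ Qk.
have LEQ : L1 P (fun z => Ex P (fun z' => Q (z, z'))).
  exact: (dominated_L1_Ex mk M20 invL invE mQ Qk).
have LEQ' : L1 P (fun z => Ex P (fun z' => Q (z', z))).
  exact: (dominated_L1_Ex mk M20 invL invE mQ' Q'k).
have EQ : Ex P (fun z => G (V z) * ((V z).1 * selfvel1 z + (V z).2 * selfvel2 z))
    = Ex P (fun z => Ex P (fun z' => Q (z, z'))).
  apply: eq_Ex => z; rewrite /Q.
  have L1a := L1Zl (V z).1 (selfK1_L1 z).
  have L1b := L1Zl (V z).2 (selfK2_L1 z).
  transitivity (Ex P (fun z' => G (V z) * ((V z).1 * (bs_kernel (V z - V z')).1 +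
    (V z).2 * (bs_kernel (V z - V z')).2))); last by [].
  by rewrite (ExZl _ (L1D L1a L1b)) (ExD L1a L1b) (ExZl _ (selfK1_L1 z))
    (ExZl _ (selfK2_L1 z)).
have [c [c0 cE]] : exists c : R, 0 <= c /\ c = (2 * pi)^-1.
  by exists (2 * pi)^-1; exact: (conj two_piV_ge0 erefl).
rewrite -cE.
have pwQ z z' : Q (z, z') + Q (z', z) <= c * (cross (V z) (V z') * (h (V z) - h (V z'))
     + (f (V z) * g (V z') + f (V z') * g (V z))).
  have -> : Q (z, z') + Q (z', z) =
     c * (cross (V z) (V z') * (G (V z) - G (V z')) / normsq (V z - V z')).
    rewrite /Q /fst /snd (dot_kernel (V z)) (dot_kernel (V z')).
    by rewrite -(normsqN (V z' - V z)) opprB (crossC (V z) (V z')) -cE; ring.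
  by rewrite ler_wpM2l.
have Lhv1 : L1 P (fun z => h (V z) * (V z).1) by apply: (@L1_boundM _ _ _ _ M).
have Lhv2 : L1 P (fun z => h (V z) * (V z).2) by apply: (@L1_boundM _ _ _ _ M).
pose e1 := Ex P (fun z => h (V z) * (V z).1).
pose e2 := Ex P (fun z => h (V z) * (V z).2).
pose ef := Ex P (f \o V). pose eg := Ex P (g \o V).
(* The cross product is bilinear, so [cross x y * (h x - h y)] splits into four products. Two of
   them vanish in this integration because [V] has mean zero; the other two leave [e1] and [e2]
   multiplied by components of [V z] and vanish in the outer integration. *)
have inner z : Ex P (fun z' => Q (z, z')) + Ex P (fun z' => Q (z', z)) <=
   c * (- ((V z).1 * e2) + (V z).2 * e1 + (f (V z) * eg + ef * g (V z))).
  rewrite -(ExD (LQ z) (LQ' z)).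
  pose U z' := c * (((h (V z) * (V z).1) * (V z').2 - (h (V z) * (V z).2) * (V z').1
    - ((V z).1 * (h (V z') * (V z').2) - (V z).2 * (h (V z') * (V z').1)))
     + (f (V z) * g (V z') + f (V z') * g (V z))).
  have La := L1B (L1Zl (h (V z) * (V z).1) LV2) (L1Zl (h (V z) * (V z).2) LV1).
  have Lb := L1B (L1Zl ((V z).1) Lhv2) (L1Zl ((V z).2) Lhv1).
  have Lc := L1D (L1Zl (f (V z)) Lg) (L1Zr (g (V z)) Lf).
  have Ld := L1D (L1B La Lb) Lc.
  apply: (@le_trans _ _ (Ex P U)).
    apply: Ex_le; [exact: (L1D (LQ z) (LQ' z))|exact: (L1Zl c Ld)|move=> z'].
    apply: le_trans (pwQ z z') _; rewrite /U; apply: (ler_wpM2l c0).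
    by rewrite lerD2r /cross; apply: eqW; ring.
  rewrite /U (ExZl c Ld) (ExD (L1B La Lb) Lc) (ExB La Lb).
  rewrite (ExB (L1Zl (h (V z) * (V z).1) LV2) (L1Zl (h (V z) * (V z).2) LV1)).
  rewrite (ExB (L1Zl ((V z).1) Lhv2) (L1Zl ((V z).2) Lhv1)).
  rewrite (ExD (L1Zl (f (V z)) Lg) (L1Zr (g (V z)) Lf)).
  rewrite (ExZl _ LV2) (ExZl _ LV1) (ExZl _ Lhv2) (ExZl _ Lhv1) (ExZl _ Lg).
  rewrite (ExZr _ Lf) EV1 EV2 -/e1 -/e2 -/ef -/eg.
  by apply: eqW; ring.
have La := L1D (L1N (L1Zr e2 LV1)) (L1Zr e1 LV2).
have Lb := L1D (L1Zr eg Lf) (L1Zl ef Lg).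
have outer : Ex P (fun z => Ex P (fun z' => Q (z, z')) + Ex P (fun z' => Q (z', z)))
   <= Ex P (fun z => c * (- ((V z).1 * e2) + (V z).2 * e1 +
        (f (V z) * eg + ef * g (V z)))).
  by apply: Ex_le; [exact: (L1D LEQ LEQ')|exact: (L1Zl c (L1D La Lb))|exact: inner].
move: outer.
rewrite (ExZl c (L1D La Lb)) (ExD La Lb) (ExD LEQ LEQ').
rewrite (ExD (L1N (L1Zr e2 LV1)) (L1Zr e1 LV2)) (ExD (L1Zr eg Lf) (L1Zl ef Lg)).
rewrite (ExN (L1Zr e2 LV1)) (ExZr _ LV1) (ExZr _ LV2) (ExZr _ Lf) (ExZl _ Lg).
rewrite EV1 EV2 -sw -EQ -/ef -/eg.
exact: half_estimate.
Qed.

End SelfStatic.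

Lemma slope_integrand_L1 {R : realType} d (T : measurableType d)
    (P : probability T R) (V : T -> R * R) (G : R * R -> R) (M : R) (a b : T -> R) :
  mf (fun z => (V z).1) -> mf (fun z => (V z).2) -> mf (G \o V) ->
  (forall x, `|G x| * enorm x <= M) -> L1 P a -> L1 P b ->
  L1 P (fun z => G (V z) * ((V z).1 * a z + (V z).2 * b z)).
Proof.
move=> mV1 mV2 mG GM La Lb.
have M0 : 0 <= M by apply: le_trans (GM (0, 0)); rewrite mulr_ge0// enorm_ge0.
have LL := L1Zl M (L1D (L1_norm La) (L1_norm Lb)).
have ma := L1_mf La; have mb := L1_mf Lb.
apply: (L1_le _ LL) => [|z].
  by apply: measurable_funM => //; apply: measurable_funD; apply: measurable_funM.
rewrite normrM; apply: le_trans (_ : `|G (V z)| * (enorm (V z) * (`|a z| + `|b z|)) <= _).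
  apply: (ler_wpM2l (normr_ge0 _)); apply: le_trans (ler_normD _ _) _.
  rewrite mulrDr (normrM (V z).1) (normrM (V z).2); apply: lerD.
    exact: (ler_wpM2r (normr_ge0 _) (norm_fst_enorm _)).
  exact: (ler_wpM2r (normr_ge0 _) (norm_snd_enorm _)).
by rewrite mulrA; apply: (fun h => ler_wpM2r h (GM _)); rewrite addr_ge0.
Qed.

(** The one-sided estimate is applied to [G, h] and to [- G, - h], which is why the pointwise
    hypothesis is now two-sided. The factor [1 / (2 pi) <= 1] is dropped. *)
Lemma self_estimate {R : realType} d (T : measurableType d) (P : probability T R)
  (V : T -> R * R) (B : R) :
  mf (fun z => (V z).1) -> mf (fun z => (V z).2) ->
  (forall x, L1 P (fun z => (enorm (x - V z))^-1)) ->
  (forall x, Ex P (fun z => (enorm (x - V z))^-1) <= B) ->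
  L1 P (fun z => (V z).1) -> L1 P (fun z => (V z).2) ->
  Ex P (fun z => (V z).1) = 0 -> Ex P (fun z => (V z).2) = 0 ->
  forall (G h f g : R * R -> R) (M : R),
  mf (G \o V) -> mf (h \o V) -> L1 P (f \o V) -> L1 P (g \o V) ->
  (forall x, `|G x| * enorm x <= M) -> (forall x, `|h x| <= M) ->
  (forall x y, `|cross x y * (G x - G y) / normsq (x - y)
    - cross x y * (h x - h y)| <= f x * g y + f y * g x) ->
  (forall x, 0 <= f x) -> (forall x, 0 <= g x) ->
  `|Ex P (fun z => G (V z) * ((V z).1 * selfvel1 P V z + (V z).2 * selfvel2 P V z))|
   <= Ex P (f \o V) * Ex P (g \o V).
Proof.
move=> mV1 mV2 iL iB LV1 LV2 E1 E2 G h f g M mG mh Lf Lg GM hM pw f0 g0.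
have fg0 : 0 <= Ex P (f \o V) * Ex P (g \o V) by apply: mulr_ge0; apply: Ex_ge0 => z /=.
have c1 : (2 * pi)^-1 * (Ex P (f \o V) * Ex P (g \o V)) <=
    Ex P (f \o V) * Ex P (g \o V).
  apply: (ler_piMl fg0); rewrite invf_le1 ?two_pi_ge1//.
  exact: lt_le_trans ltr01 two_pi_ge1.
have h1 : Ex P (fun z => G (V z) * ((V z).1 * selfvel1 P V z + (V z).2 * selfvel2 P V z)) <=
    (2 * pi)^-1 * (Ex P (f \o V) * Ex P (g \o V)).
  apply: (self_estimate_le mV1 mV2 iL iB LV1 LV2 E1 E2 mG mh Lf Lg GM hM).
  move=> x y; have := pw x y; rewrite ler_norml => /andP[_].
  by rewrite lerBlDl.
have h2 : Ex P (fun z => (- G (V z)) * ((V z).1 * selfvel1 P V z + (V z).2 * selfvel2 P V z)) <=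
    (2 * pi)^-1 * (Ex P (f \o V) * Ex P (g \o V)).
  apply: (@self_estimate_le _ _ _ _ _ _ mV1 mV2 iL iB LV1 LV2 E1 E2
    (fun x => - G x) (fun x => - h x) f g M) => //.
  - exact: measurable_funN.
  - exact: measurable_funN.
  - by move=> x; rewrite normrN.
  - by move=> x; rewrite normrN.
  move=> x y; have := pw x y; rewrite ler_norml => /andP[+ _].
  set u := f x * g y + _; set e := cross x y * (G x - _) / _.
  have -> : cross x y * (- G x - - G y) / normsq (x - y) = - e by rewrite /e; ring.
  move: (e) (u) => {}e {}u.
  by lra.
rewrite ler_norml; apply/andP; split; last exact: le_trans h1 c1.
rewrite lerNl; apply: le_trans (le_trans h2 c1).
apply: eqW.
rewrite -mulN1r -ExZl; last first.
  apply: (slope_integrand_L1 mV1 mV2 mG GM).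
    exact: (selfvel1_L1 mV1 mV2 iL iB).
  exact: (selfvel2_L1 mV1 mV2 iL iB).
by apply: eq_Ex => z; rewrite mulN1r mulNr.
Qed.

(** A coordinate selected by a boolean, [false] for the first, so that each componentwise statement
    is made once for both. *)
Definition pr {R : realType} (b : bool) (x : R * R) : R := if b then x.2 else x.1.

Lemma pr_norm {R : realType} b (x : R * R) : `|pr b x| <= enorm x.
Proof. by case: b; [exact: norm_snd_enorm|exact: norm_fst_enorm]. Qed.

Lemma kernel_le {R : realType} b (x : R * R) : `|pr b (bs_kernel x)| <= (enorm x)^-1.
Proof. by case: b; [exact: bs_kernel_snd_le|exact: bs_kernel_fst_le]. Qed.

Lemma kernel_split_pr {R : realType} b (de : R) (q v v' : R * R) :
  0 < de -> 3 * de <= enorm q ->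
  `|pr b (bs_kernel (q + v - v')) - pr b (bs_kernel q)| <=
  (tnorm de v + tnorm de v') / de ^+ 2 +
           (far de v + far de v') * (enorm (q + v - v'))^-1.
Proof.
by move=> d0 dq; have [? ?] := kernel_split v v' d0 dq; case: b.
Qed.

(** * The field of one blob on another, at a fixed time *)

Section ExternalField.
Context {R : realType} d (T : measurableType d) (P : probability T R).
Variables (M : nat) (X : 'I_M -> T -> R * R).
Variables (D eps de : R).
Hypotheses (eps0 : 0 < eps) (eps1 : eps <= 1) (de0 : 0 < de).
Hypothesis mX : forall m b, mf (fun z => pr b (X m z)).
Hypothesis LX : forall m b, L1 P (fun z => pr b (X m z)).
Hypothesis dens : forall m, box_density P (X m) (D / eps ^+ 2).

Definition ctr m : R * R :=
  (Ex P (fun z => (X m z).1), Ex P (fun z => (X m z).2)).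
Definition dev m z : R * R := X m z - ctr m.
Definition ext b m l z : R := Ex P (fun z' => pr b (bs_kernel (X m z - X l z'))).
Definition spread m : R := Ex P (fun z => tnorm de (dev m z)).

Let mX1 m : mf (fun z => (X m z).1) := mX m false.
Let mX2 m : mf (fun z => (X m z).2) := mX m true.

Lemma dens_ge0 (m : 'I_M) : 0 <= D.
Proof.
by have := kap_ge0 (dens m); rewrite pmulr_lge0// invr_gt0 exprn_gt0.
Qed.

Lemma mdev1 m : mf (fun z => (dev m z).1).
Proof. by apply: measurable_funB; [exact: mX1|exact: measurable_cst]. Qed.

Lemma mdev2 m : mf (fun z => (dev m z).2).
Proof. by apply: measurable_funB; [exact: mX2|exact: measurable_cst]. Qed.

Lemma measurable_tnorm m : mf (fun z => tnorm de (dev m z)).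
Proof.
apply: measurable_minr => //; apply: measurable_enorm; [exact: mdev1|exact: mdev2].
Qed.

Lemma measurable_far m : mf (fun z => far de (dev m z)).
Proof.
have h : measurable [set z | enorm (dev m z) < de].
  by apply: measurable_lt_cst; apply: measurable_enorm; [exact: mdev1|exact: mdev2].
rewrite /mf (_ : (fun _ => _) = \1_(~` [set z | enorm (dev m z) < de])).
  by apply: measurable_indic; exact: measurableC.
apply/funext => z; rewrite indicE /far; congr (_%:R); apply: congr1.
by apply/idP/idP; rewrite in_setC notin_setE /= leNgt => /negP.
Qed.

Lemma far_le1 (x : R * R) : far de x <= 1.
Proof. by rewrite /far; case: (de <= enorm x). Qed.

Lemma L1_tnorm m : L1 P (fun z => tnorm de (dev m z)).
Proof.
apply: (@L1_bounded _ _ _ _ de); first exact: measurable_tnorm.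
by move=> z; rewrite ger0_norm ?tnorm_le ?tnorm_ge0// ltW.
Qed.

Lemma L1_far m : L1 P (fun z => far de (dev m z)).
Proof.
apply: (@L1_bounded _ _ _ _ 1); first exact: measurable_far.
by move=> z; rewrite ger0_norm ?far_le1 ?far_ge0.
Qed.

Lemma spread_ge0 m : 0 <= spread m.
Proof. by apply: Ex_ge0 => z; rewrite tnorm_ge0// ltW. Qed.

Let C1 := 1 + 4 * D.

(** The radius [t = eps] balances [1 / t] against [4 D t / eps^2]. *)
Lemma inv_near l x : Ex P (fun z => (enorm (x - X l z))^-1) <= C1 / eps.
Proof.
apply: le_trans (inv_Ex1 (mX1 l) (mX2 l) (dens l) x eps0) _.
apply: eqW; rewrite /C1; field.
by rewrite gt_eqF.
Qed.

Let mdiff b m l : measurable_fun setT (fun p : T * T => pr b (X m p.1 - X l p.2)).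
Proof.
have -> : (fun p : T * T => pr b (X m p.1 - X l p.2)) =
   (fun p => pr b (X m p.1) - pr b (X l p.2)) by apply/funext => p; case: b.
by apply: measurable_funB;
  [apply: (measurableT_comp (mX m b))|apply: (measurableT_comp (mX l b))].
Qed.

Let mk m l : measurable_fun setT (fun p : T * T => (enorm (X m p.1 - X l p.2))^-1).
Proof. by apply: measurable_inv_enorm; [exact: (mdiff false)|exact: (mdiff true)]. Qed.

Let mK b m l :
  measurable_fun setT (fun p : T * T => pr b (bs_kernel (X m p.1 - X l p.2))).
Proof.
case: b; [apply: measurable_kernel2|apply: measurable_kernel1];
  by [exact: (mdiff false)|exact: (mdiff true)].
Qed.

Let Lk m l z : L1 P (fun z' => (enorm (X m z - X l z'))^-1).
Proof. exact: (inv_L1 (mX1 l) (mX2 l) (dens l)). Qed.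

Let kB m l z : Ex P (fun z' => (enorm (X m z - X l z'))^-1) <= C1 / eps.
Proof. exact: inv_near. Qed.

Let Kk b m l (p : T * T) : `|pr b (bs_kernel (X m p.1 - X l p.2))| <=
  1 * (enorm (X m p.1 - X l p.2))^-1.
Proof. by rewrite mul1r; exact: kernel_le. Qed.

Lemma kernel_L1 b m l z : L1 P (fun z' => pr b (bs_kernel (X m z - X l z'))).
Proof. exact: (dominated_L1 (Lk m l) z (mK b m l) (Kk b m l)). Qed.

Lemma ext_L1 b m l : L1 P (ext b m l).
Proof.
exact: (dominated_L1_Ex (mk m l) (@ler01 R) (Lk m l) (kB m l) (mK b m l) (Kk b m l)).
Qed.

Lemma ext_le b m l z : `|ext b m l z| <= C1 / eps.
Proof.
apply: le_trans (kB m l z).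
by apply: norm_Ex_le => [||z']; [exact: kernel_L1|exact: Lk|exact: kernel_le].
Qed.

Lemma ext_self b m : Ex P (ext b m m) = 0.
Proof.
case: b.
  exact: (Ex_selfvel2 (mX1 m) (mX2 m) (inv_L1 (mX1 m) (mX2 m) (dens m))
           (inv_near m)).
exact: (Ex_selfvel1 (mX1 m) (mX2 m) (inv_L1 (mX1 m) (mX2 m) (dens m))
           (inv_near m)).
Qed.

Hypothesis sep : forall m l, m != l -> 3 * de <= enorm (ctr m - ctr l).
Hypothesis tail : forall m, Ex P (fun z => far de (dev m z)) <= eps ^+ 4.

(** Here the radius is [eps^3]: the tail of mass [eps^4] gives [eps^4 / eps^3 = eps], and the
    density term is [4 D eps^3 / eps^2]. This choice dictates the exponent 4 in the hypothesis
    [tail]. *)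
Lemma inv_far l x :
  Ex P (fun z => far de (dev l z) * (enorm (x - X l z))^-1) <= C1 * eps.
Proof.
have e3 : 0 < eps ^+ 3 by rewrite exprn_gt0.
have f01 z : 0 <= far de (dev l z) <= 1 by rewrite far_ge0 far_le1.
apply: le_trans (inv_Ex (mX1 l) (mX2 l) (dens l) x (measurable_far l) f01 e3) _.
have h : Ex P (fun z => far de (dev l z)) / eps ^+ 3 <= eps.
  by rewrite ler_pdivrMr// -exprS.
rewrite [leRHS](_ : _ = eps + 4 * D * eps); last by rewrite /C1; ring.
apply: lerD; first exact: h.
apply: eqW; field.
by rewrite gt_eqF.
Qed.

(** [kernel_split] is averaged over the source point. If the source is far, [inv_far] gains a factor
    [eps]; if the target [z] is far, only [inv_near] applies, hence the large term [far / eps]. *)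
Lemma ext_near b m l z : m != l ->
  `|ext b m l z - pr b (bs_kernel (ctr m - ctr l))| <=
  (tnorm de (dev m z) + spread l) / de ^+ 2
   + C1 * (far de (dev m z) / eps + eps).
Proof.
move=> ml; rewrite /ext.
set K := pr b _.
have LK : L1 P (fun z' : T => K) by exact: L1_cst.
rewrite -[X in _ - X](Ex_cst P K) -(ExB (kernel_L1 b m l z) LK).
have La := L1Zr (de ^+ 2)^-1 (L1D (L1_cst P (tnorm de (dev m z))) (L1_tnorm l)).
have Lb := L1Zl (far de (dev m z)) (Lk m l z).
have Lc : L1 P (fun z' => far de (dev l z') * (enorm (X m z - X l z'))^-1).
  apply: (@L1_boundM _ _ _ _ 1 _ _ (measurable_far l) _ (Lk m l z)).
  by move=> z'; rewrite ger0_norm ?far_le1 ?far_ge0.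
have Ld := L1D La (L1D Lb Lc).
apply: le_trans (norm_Ex_le (L1B (kernel_L1 b m l z) LK) Ld _) _.
  move=> z'; rewrite -mulrDl.
  have -> : X m z - X l z' = (ctr m - ctr l) + dev m z - dev l z'.
    by rewrite /dev [_ + (X m z - _)]addrC addrA subrK opprB addrA subrK.
  by apply: kernel_split_pr => //; exact: sep.
rewrite (ExD La (L1D Lb Lc)) (ExD Lb Lc).
rewrite (ExZr _ (L1D (L1_cst P (tnorm de (dev m z))) (L1_tnorm l))).
rewrite (ExD (L1_cst P (tnorm de (dev m z))) (L1_tnorm l)) Ex_cst (ExZl _ (Lk m l z)).
apply: lerD; first by [].
rewrite mulrDr; apply: lerD; last exact: inv_far.
rewrite [leRHS](_ : _ = far de (dev m z) * (C1 / eps)); last by ring.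
apply: ler_wpM2l; first exact: far_ge0.
exact: kB.
Qed.

(** After averaging over the target as well, the large term becomes harmless: its mean is at most
    [eps^4 / eps <= eps]. *)
Lemma ext_mean b m l : m != l ->
  `|Ex P (ext b m l) - pr b (bs_kernel (ctr m - ctr l))| <=
  (spread m + spread l) / de ^+ 2 + 2 * C1 * eps.
Proof.
move=> ml; set K := pr b _.
have C0 : 0 <= C1 by rewrite /C1 addr_ge0// mulr_ge0// (dens_ge0 m).
have LK : L1 P (fun z' : T => K) by exact: L1_cst.
rewrite -[X in _ - X](Ex_cst P K) -(ExB (ext_L1 b m l) LK).
have La := L1Zr (de ^+ 2)^-1 (L1D (L1_tnorm m) (L1_cst P (spread l))).
have Lb := L1Zl C1 (L1D (L1Zr eps^-1 (L1_far m)) (L1_cst P eps)).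
apply: le_trans (norm_Ex_le (L1B (ext_L1 b m l) LK) (L1D La Lb) _) _.
  by move=> z; exact: ext_near.
rewrite (ExD La Lb) (ExZr _ (L1D (L1_tnorm m) (L1_cst P (spread l)))).
rewrite (ExD (L1_tnorm m) (L1_cst P (spread l))) Ex_cst.
rewrite (ExZl _ (L1D (L1Zr eps^-1 (L1_far m)) (L1_cst P eps))).
rewrite (ExD (L1Zr eps^-1 (L1_far m)) (L1_cst P eps)) Ex_cst (ExZr _ (L1_far m)).
apply: lerD; first by [].
rewrite [leRHS](_ : _ = C1 * (eps + eps)); last by ring.
apply: (ler_wpM2l C0); rewrite lerD2r.
rewrite ler_pdivrMr//; apply: le_trans (tail m) _.
by rewrite -expr2; apply: ler_wiXn2l => //; rewrite ltW.
Qed.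

End ExternalField.

(** * Truncated moments and the self-interaction part of their growth *)

Section Drift.
Context {R : realType} d (T : measurableType d) (P : probability T R).
Variables (M : nat) (gam : 'I_M -> R) (X : 'I_M -> T -> R * R).
Variables (D eps de K1 : R).
Hypotheses (eps0 : 0 < eps) (eps1 : eps <= 1) (de0 : 0 < de).
Hypothesis mX : forall m b, mf (fun z => pr b (X m z)).
Hypothesis LX : forall m b, L1 P (fun z => pr b (X m z)).
Hypothesis dens : forall m, box_density P (X m) (D / eps ^+ 2).

Definition vel b m z : R := \sum_(l < M) gam l * ext P X b m l z.
Definition cvel b m : R := Ex P (vel b m).
(** Half the time derivative of the expected weight of order [k]; the factor 2 from differentiating
    [|V|^2] is put back in [is_derive_Wt]. *)
Definition drift k m : R := Ex P (fun z =>
  slope k (de ^+ 2) (normsq (dev P X m z)) *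
   ((dev P X m z).1 * (vel false m z - cvel false m) +
    (dev P X m z).2 * (vel true m z - cvel true m))).
Definition moment k m : R := Ex P (fun z => tnorm de (dev P X m z) ^+ (2 * k)).
Definition moments k : R := \sum_(m < M) moment k m.
Definition gnorm : R := \sum_(l < M) `|gam l|.

Local Notation V := (dev P X).
Local Notation Q := (spread P X de).
Let C1 := 1 + 4 * D.
Let tn0 m z : 0 <= tnorm de (V m z) := tnorm_ge0 (V m z) (ltW de0).

Lemma gnorm_ge0 : 0 <= gnorm.
Proof. exact: sumr_ge0. Qed.

Lemma vel_L1 b m : L1 P (vel b m).
Proof. by apply: L1_sum => l _; apply: L1Zl; exact: (ext_L1 eps0 mX dens). Qed.

Lemma measurable_slope k m : mf (fun z => slope k (de ^+ 2) (normsq (V m z))).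
Proof.
have h : mf (fun z => Num.min (normsq (V m z)) (de ^+ 2)).
  apply: measurable_minr => //; apply: measurable_normsq.
    exact: (mdev1 P mX).
  exact: (mdev2 P mX).
apply: measurable_funM; first by apply: measurable_funM => //; exact: measurable_funX.
by apply: measurable_funB => //; exact: measurable_funM.
Qed.

Lemma L1_tnormX k m : L1 P (fun z => tnorm de (V m z) ^+ k).
Proof.
apply: (@L1_bounded _ _ _ _ (de ^+ k)).
  by apply: measurable_funX; exact: (measurable_tnorm P de mX).
move=> z; rewrite ger0_norm ?exprn_ge0//.
by apply: lerXn2r; rewrite ?nnegrE ?tnorm_le// ltW.
Qed.

Lemma moment_ge0 k m : 0 <= moment k m.
Proof. by apply: Ex_ge0 => z; rewrite exprn_ge0. Qed.

Lemma moments_ge0 k : 0 <= moments k.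
Proof. by apply: sumr_ge0 => m _; exact: moment_ge0. Qed.

Lemma moment_le k m : moment k m <= moments k.
Proof.
rewrite /moments (bigD1 m)//= lerDl; apply: sumr_ge0 => l _; exact: moment_ge0.
Qed.

Lemma spread_sqr m : Q m ^+ 2 <= moments 1.
Proof.
apply: le_trans (moment_le 1 m).
apply: Ex_sqr; [exact: (L1_tnorm P de0 mX)|exact: (L1_tnormX 2)].
Qed.

Lemma spread_exp k m : Q m ^+ (2 * k) <= moments 1 ^+ k.
Proof.
by rewrite exprM; apply: lerXn2r (spread_sqr m);
  rewrite nnegrE ?exprn_ge0 ?moments_ge0// spread_ge0.
Qed.

(** A form of Young's inequality without constants: the product is at most the power of the larger
    of the two numbers. *)
Lemma young_exp n (a y : R) : 0 <= a -> 0 <= y ->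
  a ^+ (2 * n + 1) * y <= a ^+ (2 * n.+1) + y ^+ (2 * n.+1).
Proof.
move=> a0 y0; have -> : (2 * n.+1 = (2 * n + 1).+1)%N by rewrite mulnS addSn add1n addn1.
have [ya|ay] := leP y a.
  apply: (@le_trans _ _ (a ^+ (2 * n + 1).+1)).
    by rewrite exprSr; apply: ler_wpM2l => //; rewrite exprn_ge0.
  by rewrite lerDl exprn_ge0.
apply: (@le_trans _ _ (y ^+ (2 * n + 1).+1)); last by rewrite lerDr exprn_ge0.
rewrite exprSr; apply: ler_wpM2r => //.
by apply: lerXn2r; rewrite ?nnegrE// ltW.
Qed.

Lemma slope_norm_le n x : `|slope n.+1 (de ^+ 2) (normsq x)| * enorm x <=
  n.+1%:R * de ^+ (2 * n + 1).
Proof.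
rewrite ger0_norm; last by rewrite slope_ge0 ?normsq_ge0 ?exprn_gt0.
apply: le_trans (slope_vec_le n x de0) _; apply: ler_wpM2l => //.
by apply: lerXn2r; rewrite ?nnegrE ?tnorm_le ?tnorm_ge0// ltW.
Qed.

Let Vmeas m : mf (fun z => (V m z).1) /\ mf (fun z => (V m z).2).
Proof. by split; [exact: (mdev1 P mX)|exact: (mdev2 P mX)]. Qed.

Lemma selfvel_ext m z :
  selfvel1 P (V m) z = ext P X false m m z /\ selfvel2 P (V m) z = ext P X true m m z.
Proof.
have e z' : V m z - V m z' = X m z - X m z'.
  by rewrite /dev opprB addrA subrK.
by split; apply: eq_Ex => z'; rewrite e.
Qed.

Lemma dev_L1 m : L1 P (fun z => (V m z).1) /\ L1 P (fun z => (V m z).2).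
Proof.
by split; apply: L1B; [exact: (LX m false)|exact: L1_cst|exact: (LX m true)|exact: L1_cst].
Qed.

Lemma Ex_dev m : Ex P (fun z => (V m z).1) = 0 /\ Ex P (fun z => (V m z).2) = 0.
Proof.
split.
  by rewrite (ExB (LX m false) (L1_cst P _)) Ex_cst /= subrr.
by rewrite (ExB (LX m true) (L1_cst P _)) Ex_cst /= subrr.
Qed.

Definition selfpart k m : R := Ex P (fun z =>
  slope k (de ^+ 2) (normsq (V m z)) *
   ((V m z).1 * ext P X false m m z + (V m z).2 * ext P X true m m z)).

Lemma selfpart_le (h f g : R * R -> R) n M0 m :
  mf (h \o V m) -> L1 P (f \o V m) -> L1 P (g \o V m) ->
  (forall x, `|h x| <= M0) ->
  (forall x y, `|cross x y * (slope n.+1 (de ^+ 2) (normsq x) - slope n.+1 (de ^+ 2) (normsq y))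
      / normsq (x - y)
    - cross x y * (h x - h y)| <= f x * g y + f y * g x) ->
  (forall x, 0 <= f x) -> (forall x, 0 <= g x) ->
  `|selfpart n.+1 m| <= Ex P (f \o V m) * Ex P (g \o V m).
Proof.
move=> mh Lf Lg hM pw f0 g0.
have [LV1 LV2] := dev_L1 m; have [E1 E2] := Ex_dev m; have [mV1 mV2] := Vmeas m.
have M00 : 0 <= M0 by apply: le_trans (hM (0, 0)).
have shift x z : x - V m z = (x + ctr P X m) - X m z.
  by rewrite /dev opprB addrA.
have iL x : L1 P (fun z => (enorm (x - V m z))^-1).
  under eq_fun do rewrite shift.
  exact: (inv_L1 (mX m false) (mX m true) (dens m)).
have iB x : Ex P (fun z => (enorm (x - V m z))^-1) <= C1 / eps.
  under eq_Ex do rewrite shift.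
  exact: (inv_near eps0 mX dens).
have := @self_estimate _ _ _ _ _ _ mV1 mV2 iL iB LV1 LV2 E1 E2
  (fun x => slope n.+1 (de ^+ 2) (normsq x)) h f g
  (n.+1%:R * de ^+ (2 * n + 1) + M0) (measurable_slope n.+1 m) mh Lf Lg _ _ pw f0 g0.
rewrite /selfpart; under [in X in _ -> X]eq_Ex => z.
  have [<- <-] := selfvel_ext m z; over.
apply => x.
  by apply: le_trans (slope_norm_le n x) _; rewrite lerDl.
by apply: le_trans (hM x) _; rewrite lerDr mulr_ge0// exprn_ge0// ltW.
Qed.

(** The choice [h = 0], [f = min(|x|^2, de^2) / de^2], [g = 1] brings [self_pointwise1] into the
    form of a sum of products. *)
Lemma selfpart1_le m : `|selfpart 1 m| <= moment 1 m / de ^+ 2.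
Proof.
have dd : 0 < de ^+ 2 by rewrite exprn_gt0.
pose f x := Num.min (normsq x) (de ^+ 2) / de ^+ 2.
have ff : f \o V m = (fun z => tnorm de (V m z) ^+ (2 * 1) / de ^+ 2).
  by apply/funext => z; rewrite /f /= muln1 sqr_tnorm// ltW.
have LT := L1_tnormX (2 * 1) m.
have := @selfpart_le (fun=> 0) f (fun=> 1) 0 0 m _ _ _ _ _ _ _.
rewrite ff (ExZr _ LT).
have -> : (fun=> 1) \o V m = (fun=> 1) by [].
rewrite Ex_cst mulr1; apply.
- exact: measurable_cst.
- exact: (L1Zr _ LT).
- exact: L1_cst.
- by move=> x; rewrite normr0.
- move=> x y; rewrite subrr mulr0 subr0 !mulr1 /f -mulrDl.
  exact: self_pointwise1.
- by move=> x; rewrite divr_ge0 ?min_ge0 ?normsq_ge0// ltW.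
- by move=> x.
Qed.

Hypothesis tail1 : forall m, Ex P (fun z => far de (V m z) * enorm (V m z)) <= K1 * eps ^+ 2.

Lemma qweight_le (x : R * R) :
  qweight (de ^+ 2) x <= tnorm de x ^+ 2 + de * (far de x * enorm x).
Proof.
rewrite /qweight sqrtr_sqr ger0_norm; last exact: ltW.
rewrite sqr_tnorm; last exact: ltW.
rewrite /far; have [dx|dx] := leP de (enorm x).
  rewrite mul1r ge_min; apply/orP; right; rewrite lerDr min_ge0 ?normsq_ge0//.
  by rewrite exprn_ge0// ltW.
rewrite mul0r mulr0 addr0 [leRHS]min_l ?ge_min ?lexx//.
by rewrite -sqr_enorm; apply: lerXn2r; rewrite ?nnegrE ?enorm_ge0// ltW.
Qed.

Lemma enorm_dev_L1 m : L1 P (fun z => enorm (V m z)).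
Proof.
have [LV1 LV2] := dev_L1 m; have [mV1 mV2] := Vmeas m.
apply: (L1_le (measurable_enorm mV1 mV2) (L1D (L1_norm LV1) (L1_norm LV2))) => z.
by rewrite ger0_norm ?enorm_ge0// enorm_le_sum.
Qed.

(** Beyond [de] the function [qweight] is linear and escapes the truncated moments. This is the one
    place where the first-moment tail [tail1] is consumed. *)
Lemma qweight_Ex m : L1 P (fun z => qweight (de ^+ 2) (V m z)) /\
  Ex P (fun z => qweight (de ^+ 2) (V m z)) <= moment 1 m + de * (K1 * eps ^+ 2).
Proof.
have [mV1 mV2] := Vmeas m.
have La := L1_tnormX 2 m.
have Lb : L1 P (fun z => far de (V m z) * enorm (V m z)).
  apply: (@L1_boundM _ _ _ _ 1 _ _ (measurable_far P de mX m) _ (enorm_dev_L1 m)).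
  by move=> z; rewrite ger0_norm ?far_le1 ?far_ge0.
have Lc := L1D La (L1Zl de Lb).
have LQ : L1 P (fun z => qweight (de ^+ 2) (V m z)).
  apply: (L1_le _ Lc) => [|z].
    apply: measurable_minr; first exact: measurable_normsq.
    by apply: measurable_funM => //; exact: measurable_enorm.
  by rewrite ger0_norm ?qweight_ge0 ?qweight_le.
split => //; apply: le_trans (Ex_le LQ Lc (fun z => qweight_le _)) _.
rewrite (ExD La (L1Zl de Lb)) (ExZl _ Lb); apply: lerD; first by [].
by apply: (ler_wpM2l (ltW de0)).
Qed.

(** With [h = slope1], [f] a multiple of [qweight] and [g] the truncated power of order [n + 1], the
    bound is a product in which the order-1 factor will be [O(eps^2)]. The moment of order [n + 3]
    is thus driven by the one two orders below. *)
Lemma selfpart_n_le n m : `|selfpart n.+3 m| <=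
  selfC n * (moment 1 m + de * (K1 * eps ^+ 2)) * moment n.+1 m.
Proof.
have dd : 0 < de ^+ 2 by rewrite exprn_gt0.
have [LQ EQ] := qweight_Ex m.
have C0 : 0 <= selfC n :> R by rewrite ler0n.
pose g x := Num.min (normsq x) (de ^+ 2) ^+ n.+1.
have gg : g \o V m = (fun z => tnorm de (V m z) ^+ (2 * n.+1)).
  by apply/funext => z; rewrite /g /= exprM sqr_tnorm// ltW.
have LT := L1_tnormX (2 * n.+1) m.
have h0 : `|selfpart n.+3 m| <= Ex P ((fun x => selfC n * qweight (de ^+ 2) x) \o V m) *
    Ex P (g \o V m).
  apply: (@selfpart_le (fun x => slope1 n.+3 (de ^+ 2) (normsq x)) _ _ n.+2
      (n.+3%:R * (de ^+ 2) ^+ n.+1)).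
  - have hm : mf (fun z => Num.min (normsq (V m z)) (de ^+ 2)).
      have [mV1 mV2] := Vmeas m.
      by apply: measurable_minr => //; apply: measurable_normsq.
    apply: measurable_funM; first by apply: measurable_funM => //; exact: measurable_funX.
    by apply: measurable_funB => //; exact: measurable_funM.
  - exact: (L1Zl (selfC n) LQ).
  - by rewrite gg.
  - move=> x; rewrite ger0_norm; last by rewrite slope1_ge0 ?normsq_ge0.
    have m0 : 0 <= Num.min (normsq x) (de ^+ 2) by rewrite min_ge0 ?normsq_ge0 ?(ltW dd).
    have m1 : Num.min (normsq x) (de ^+ 2) <= de ^+ 2 by rewrite ge_min lexx orbT.
    have u0 : 0 <= Num.min (normsq x) (de ^+ 2) / de ^+ 2 by rewrite divr_ge0 ?(ltW dd).
    rewrite /slope1; apply: (@le_trans _ _ (n.+3%:R * Num.min (normsq x) (de ^+ 2) ^+ n.+1)).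
      by apply: ler_piMr; [rewrite mulr_ge0// exprn_ge0|rewrite gerBl].
    by apply: ler_wpM2l => //; apply: lerXn2r => //; rewrite nnegrE ltW.
  - move=> x y; apply: le_trans (self_pointwise n x y dd) _.
    apply: eqW.
    by rewrite /g; ring.
  - by move=> x; rewrite mulr_ge0 ?qweight_ge0.
  - by move=> x; rewrite exprn_ge0 ?min_ge0 ?normsq_ge0 ?(ltW dd).
apply: le_trans h0 _; rewrite gg.
apply: ler_wpM2r; first exact: moment_ge0.
rewrite [X in X <= _](ExZl _ LQ); exact: (ler_wpM2l C0).
Qed.

End Drift.

Lemma dbl_succ n : ((2 * n + 1).+1 = 2 * n.+1)%N.
Proof. by lia. Qed.

Lemma ext_dev_arith {R : realType} (t qm ql i c f e : R) :
  (t + ql) * i + c * (f + e) + ((qm + ql) * i + 2 * c * e) =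
  (t + qm + 2 * ql) * i + c * f + 3 * c * e.
Proof. by ring. Qed.

Lemma ext_sum_arith {R : realType} (s a b g x y : R) :
  s * (a * (g * x) + b * (g * y)) = g * (s * (a * x + b * y)).
Proof. by ring. Qed.

(** * The full drift bound, external fields included *)

Section DriftBound.
Context {R : realType} d (T : measurableType d) (P : probability T R).
Variables (M : nat) (gam : 'I_M -> R) (X : 'I_M -> T -> R * R).
Variables (D eps de : R).
Hypotheses (eps0 : 0 < eps) (eps1 : eps <= 1) (de0 : 0 < de).
Hypothesis mX : forall m b, mf (fun z => pr b (X m z)).
Hypothesis LX : forall m b, L1 P (fun z => pr b (X m z)).
Hypothesis dens : forall m, box_density P (X m) (D / eps ^+ 2).
Hypothesis sep : forall m l, m != l -> 3 * de <= enorm (ctr P X m - ctr P X l).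
Hypothesis tail : forall m, Ex P (fun z => far de (dev P X m z)) <= eps ^+ 4.

Local Notation V := (dev P X).
Local Notation Q := (spread P X de).
Local Notation ext := (ext P X).
Let C1 := 1 + 4 * D.
(** In [14 k = 2 * k * 7] the 2 counts the coordinates, [k] comes from the slope, and 7 is a common
    bound for the coefficients left by [young_exp]. *)
Definition driftC k : R := (14 * k)%:R * ((de ^+ 2)^-1 + C1).

Let extL b m l : L1 P (ext b m l) := ext_L1 eps0 mX dens b m l.

(** Both the field at [z] and its mean are compared with the kernel at the difference of the
    centers, which drops out. *)
Lemma ext_dev b m l z : m != l ->
  `|ext b m l z - Ex P (ext b m l)| <=
  (tnorm de (V m z) + Q m + 2 * Q l) / de ^+ 2 + C1 * (far de (V m z) / eps)
   + 3 * C1 * eps.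
Proof.
move=> ml.
have h1 := ext_near eps0 de0 mX dens sep tail b z ml.
have h2 := ext_mean eps0 eps1 de0 mX dens sep tail b ml.
rewrite -/C1 in h1 h2.
set K := pr b _ in h1 h2.
have -> : ext b m l z - Ex P (ext b m l) = (ext b m l z - K) - (Ex P (ext b m l) - K) by ring.
apply: le_trans (ler_normB _ _) _; apply: le_trans (lerD h1 h2) _.
by rewrite ext_dev_arith.
Qed.

(** The hypothesis [S * fr = 0] encodes that the slope vanishes on far points, which kills the
    dangerous term of size [1 / eps]. All remaining terms are a power of the truncated norm times
    something small, and [young_exp] separates them. *)
Lemma ext_pointwise (n : nat) (S v t Qm Ql a b e : R) (fr : R) :
  0 <= S -> 0 <= t -> 0 <= Qm -> 0 <= Ql -> 0 <= C1 ->
  S * v <= n.+1%:R * t ^+ (2 * n + 1) -> 0 <= v -> S * fr = 0 ->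
  `|a| <= v -> `|b| <= v -> forall (x y : R),
  `|x| <= (t + Qm + 2 * Ql) / de ^+ 2 + C1 * (fr / eps) + 3 * C1 * eps ->
  `|y| <= (t + Qm + 2 * Ql) / de ^+ 2 + C1 * (fr / eps) + 3 * C1 * eps ->
  Qm ^+ (2 * n.+1) <= e -> Ql ^+ (2 * n.+1) <= e ->
  `|S * (a * x + b * y)| <=
     driftC n.+1 * (t ^+ (2 * n.+1) + (e + eps ^+ (2 * n.+1))).
Proof.
move=> S0 t0 Qm0 Ql0 C10 Sv v0 Sfr av bv x y.
set A := (t + Qm + 2 * Ql) / de ^+ 2 + _ + _ => xA yA Qme Qle.
have d2 : 0 <= (de ^+ 2)^-1 by rewrite invr_ge0 sqr_ge0.
have h1 : `|a * x + b * y| <= v * (2 * A).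
  apply: le_trans (ler_normD _ _) _; rewrite !normrM.
  rewrite [leRHS](_ : _ = v * A + v * A); last by ring.
  by apply: lerD; apply: ler_pM.
rewrite normrM (ger0_norm S0).
apply: le_trans (ler_wpM2l S0 h1) _.
set A' := (t + Qm + 2 * Ql) / de ^+ 2 + 3 * C1 * eps.
have -> : S * (v * (2 * A)) = 2 * (S * v * A') + 2 * v * C1 / eps * (S * fr).
  by rewrite /A /A'; ring.
rewrite Sfr mulr0 addr0.
have A0 : 0 <= A'.
  rewrite /A' addr_ge0//; first by rewrite mulr_ge0// !addr_ge0// mulr_ge0.
  by rewrite !mulr_ge0// ltW.
have h2 : S * v * A' <= n.+1%:R * t ^+ (2 * n + 1) * A' by apply: ler_wpM2r.
apply: le_trans (ler_wpM2l (ler0n _ 2) h2) _.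
set k : R := n.+1%:R; have k0 : 0 <= k by rewrite ler0n.
have y1 := young_exp n t0 t0; have y2 := young_exp n t0 Qm0.
have y3 := young_exp n t0 Ql0; have y4 := young_exp n t0 (ltW eps0).
have -> : driftC n.+1 = 14 * k * ((de ^+ 2)^-1 + C1) by rewrite /driftC natrM.
move: y1 y2 y3 y4 Qme Qle.
have tt : 0 <= t ^+ (2 * n.+1) by rewrite exprn_ge0.
have ee : 0 <= eps ^+ (2 * n.+1) by rewrite exprn_ge0// ltW.
have tn : t ^+ (2 * n + 1) * t = t ^+ (2 * n.+1).
  by rewrite -exprSr dbl_succ.
have eq0 : 0 <= Ql ^+ (2 * n.+1) by rewrite exprn_ge0.
have -> : 2 * (k * t ^+ (2 * n + 1) * A') = 2 * k * ((de ^+ 2)^-1 *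
   (t ^+ (2 * n + 1) * t + t ^+ (2 * n + 1) * Qm + 2 * (t ^+ (2 * n + 1) * Ql))
   + 3 * C1 * (t ^+ (2 * n + 1) * eps)).
  by rewrite /A'; ring.
rewrite tn.
move: (t ^+ (2 * n + 1) * Qm) (t ^+ (2 * n + 1) * Ql) (t ^+ (2 * n + 1) * eps) eq0.
move: (t ^+ (2 * n.+1)) (eps ^+ (2 * n.+1)) (Qm ^+ (2 * n.+1)) (Ql ^+ (2 * n.+1)) tt ee.
move: (de ^+ 2)^-1 d2 => i i0 t2 e2 qm ql t20 e20 u1 u2 u3 ql0 _ y2 y3 y4 q1 q2.
have -> : 14 * k * (i + C1) * (t2 + (e + e2)) = 2 * k * (i * (7 * (t2 + (e + e2)))
   + C1 * (7 * (t2 + (e + e2)))) by ring.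
apply: ler_wpM2l; first by rewrite mulr_ge0.
rewrite -(mulrA 3) (mulrCA 3); apply: lerD; apply: ler_wpM2l => //; lra.
Qed.

Definition extpart k m l : R := Ex P (fun z =>
  slope k (de ^+ 2) (normsq (V m z)) *
   ((V m z).1 * (ext false m l z - Ex P (ext false m l)) +
    (V m z).2 * (ext true m l z - Ex P (ext true m l)))).

Let mV1 m : mf (fun z => (V m z).1) := mdev1 P mX m.
Let mV2 m : mf (fun z => (V m z).2) := mdev2 P mX m.

Lemma part_L1 n m (a b : T -> R) : L1 P a -> L1 P b ->
  L1 P (fun z => slope n.+1 (de ^+ 2) (normsq (V m z)) *
     ((V m z).1 * a z + (V m z).2 * b z)).
Proof.
move=> La Lb; apply: (@slope_integrand_L1 _ _ _ P (V m)
  (fun x => slope n.+1 (de ^+ 2) (normsq x)) _ a b (mV1 m) (mV2 m)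
  (measurable_slope P de mX n.+1 m) (slope_norm_le de0 n)) => //.
Qed.

Lemma extpart_le n m l : m != l -> `|extpart n.+1 m l| <=
  driftC n.+1 * (moment P X de n.+1 m + (moments P X de 1 ^+ n.+1 + eps ^+ (2 * n.+1))).
Proof.
move=> ml.
have C10 : 0 <= C1 by rewrite /C1 addr_ge0// mulr_ge0// (dens_ge0 eps0 dens m).
have LT := L1_tnormX P de0 mX (2 * n.+1) m.
pose e := moments P X de 1 ^+ n.+1.
have LR := L1Zl (driftC n.+1) (L1D LT (L1_cst P (e + eps ^+ (2 * n.+1)))).
have LE := part_L1 n m (L1B (extL false m l) (L1_cst P (Ex P (ext false m l))))
   (L1B (extL true m l) (L1_cst P (Ex P (ext true m l)))).
apply: le_trans (norm_Ex_le LE LR _) _; last first.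
  rewrite (ExZl _ (L1D LT (L1_cst P (e + eps ^+ (2 * n.+1))))).
  by rewrite (ExD LT (L1_cst P (e + eps ^+ (2 * n.+1)))) Ex_cst.
move=> z; apply: (@ext_pointwise n _ (enorm (V m z)) _ (Q m) (Q l) _ _ _
   (far de (V m z))).
- by rewrite slope_ge0 ?normsq_ge0 ?exprn_gt0.
- by rewrite tnorm_ge0// ltW.
- exact: spread_ge0.
- exact: spread_ge0.
- exact: C10.
- exact: slope_vec_le.
- exact: enorm_ge0.
- rewrite /far; have [h|h] := leP de (enorm (V m z)); last by rewrite mulr0.
  by rewrite slope_far// mul0r.
- exact: norm_fst_enorm.
- exact: norm_snd_enorm.
- exact: ext_dev.
- exact: ext_dev.
- exact: spread_exp.
- exact: spread_exp.
Qed.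

Lemma cvelE b m : cvel P gam X b m = \sum_(l < M | l != m) gam l * Ex P (ext b m l).
Proof.
rewrite /cvel /vel Ex_sum; last by move=> l _; apply: L1Zl.
rewrite (bigD1 m)//= (ExZl _ (extL b m m)) (ext_self eps0 mX dens) mulr0 add0r.
by apply: eq_bigr => l _; rewrite (ExZl _ (extL b m l)).
Qed.

Lemma drift_le n m : `|drift P gam X de n.+1 m| <= gnorm gam *
  (`|selfpart P X de n.+1 m| +
   driftC n.+1 * (moment P X de n.+1 m + (moments P X de 1 ^+ n.+1 + eps ^+ (2 * n.+1)))).
Proof.
set B := driftC _ * _.
have Ls := part_L1 n m (extL false m m) (extL true m m).
have Le l := part_L1 n m (L1B (extL false m l) (L1_cst P (Ex P (ext false m l))))
   (L1B (extL true m l) (L1_cst P (Ex P (ext true m l)))).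
have -> : drift P gam X de n.+1 m = gam m * selfpart P X de n.+1 m +
    \sum_(l < M | l != m) gam l * extpart n.+1 m l.
  pose F l z := gam l * (slope n.+1 (de ^+ 2) (normsq (V m z)) *
   ((V m z).1 * (ext false m l z - Ex P (ext false m l)) +
    (V m z).2 * (ext true m l z - Ex P (ext true m l)))).
  have LF l : L1 P (F l) by exact: (L1Zl (gam l) (Le l)).
  have -> : \sum_(l < M | l != m) gam l * extpart n.+1 m l =
      Ex P (fun z => \sum_(l < M | l != m) F l z).
    rewrite (Ex_sum _ (fun l _ => LF l)); apply: eq_bigr => l _.
    by rewrite (ExZl _ (Le l)).
  rewrite /drift /selfpart -(ExZl _ Ls).
  rewrite -(ExD (L1Zl _ Ls) (L1_sum _ (fun l _ => LF l))).
  apply: eq_Ex => z.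
  (* The own field needs no centering, because its mean is zero by [ext_self]; the other fields are
     centered one by one. *)
  have velE b : vel P gam X b m z - cvel P gam X b m = gam m * ext b m m z +
      \sum_(l < M | l != m) gam l * (ext b m l z - Ex P (ext b m l)).
    rewrite cvelE /vel (bigD1 m)//= -addrA -sumrB; congr (_ + _).
    by apply: eq_bigr => l _; rewrite mulrBr.
  rewrite !velE (mulrDr (V m z).1) (mulrDr (V m z).2) addrACA mulrDr; congr (_ + _).
    exact: ext_sum_arith.
  rewrite !mulr_sumr -big_split mulr_sumr.
  by apply: eq_bigr => l _; exact: ext_sum_arith.
apply: le_trans (ler_normD _ _) _; rewrite mulrDr; apply: lerD.
  rewrite normrM; apply: ler_wpM2r => //.
  by rewrite /gnorm (bigD1 m)//= lerDl sumr_ge0.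
apply: le_trans (ler_norm_sum _ _ _) _.
have B0 : 0 <= B.
  have C10 : 0 <= C1 by rewrite /C1 addr_ge0// mulr_ge0// (dens_ge0 eps0 dens m).
  rewrite /B /driftC; apply: mulr_ge0.
    by rewrite mulr_ge0// addr_ge0// invr_ge0 sqr_ge0.
  by rewrite !addr_ge0 ?moment_ge0 ?exprn_ge0 ?moments_ge0// ltW.
apply: le_trans (_ : \sum_(l < M | l != m) `|gam l| * B <= _).
  apply: ler_sum => l lm; rewrite normrM; apply: ler_wpM2l => //.
  by apply: extpart_le; rewrite eq_sym.
rewrite -mulr_suml; apply: ler_wpM2r => //.
by rewrite /gnorm [leRHS](bigD1 m)//= lerDr.
Qed.

Lemma cvel_near b m (q : R) : (forall l, Q l <= q) ->
  `|cvel P gam X b m -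
    \sum_(l < M | l != m) gam l * pr b (bs_kernel (ctr P X m - ctr P X l))| <=
  gnorm gam * (2 * q / de ^+ 2 + 2 * C1 * eps).
Proof.
move=> Qq; rewrite cvelE -sumrB; apply: le_trans (ler_norm_sum _ _ _) _.
have A0 : 0 <= 2 * q / de ^+ 2 + 2 * C1 * eps.
  have q0 : 0 <= q by apply: le_trans (Qq m); exact: spread_ge0.
  have C10 : 0 <= C1 by rewrite /C1 addr_ge0// mulr_ge0// (dens_ge0 eps0 dens m).
  by rewrite addr_ge0// !mulr_ge0 ?invr_ge0 ?sqr_ge0// ltW.
apply: le_trans (_ : \sum_(l < M | l != m) `|gam l| * (2 * q / de ^+ 2 + 2 * C1 * eps) <= _).
  apply: ler_sum => l lm; rewrite -mulrBr normrM; apply: ler_wpM2l => //.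
  have ml : m != l by rewrite eq_sym.
  apply: le_trans (ext_mean eps0 eps1 de0 mX dens sep tail b ml) _.
  rewrite -/C1 lerD2r; apply: ler_wpM2r; first by rewrite invr_ge0 sqr_ge0.
  by rewrite mulr_natl mulr2n; apply: lerD; exact: Qq.
rewrite -mulr_suml; apply: ler_wpM2r => //.
by rewrite /gnorm [leRHS](bigD1 m)//= lerDr.
Qed.

End DriftBound.

(** * Differentiation rules and the derivative of the weight *)

Section Calculus.
Context {R : realType}.

Lemma is_deriveI (f : R -> R) (x l : R) :
  (h^-1 * (f (h + x) - f x)) @[h --> 0^'] --> l -> is_derive x 1 f l.
Proof.
move=> fl.
have e : (fun h : R => h^-1 *: (f (h *: 1 + x) - f x)) =
         (fun h => h^-1 * (f (h + x) - f x)).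
  by apply/funext => h; rewrite -![_ *: _]/(_ * _) mulr1.
apply: DeriveDef; first by apply/cvg_ex; exists l; rewrite e.
by apply/cvg_lim => //; rewrite e.
Qed.

Lemma is_deriveE (f : R -> R) (x l : R) : is_derive x 1 f l ->
  (h^-1 * (f (h + x) - f x)) @[h --> 0^'] --> l.
Proof.
move=> [df <-].
have e : (fun h : R => h^-1 *: (f (h *: 1 + x) - f x)) =
         (fun h => h^-1 * (f (h + x) - f x)).
  by apply/funext => h; rewrite -![_ *: _]/(_ * _) mulr1.
by move: df => /cvg_ex[l'] df; rewrite /derive e; rewrite e in df; move/cvgP : df.
Qed.

Lemma is_deriveDf (f g : R -> R) (x a b : R) : is_derive x 1 f a ->
  is_derive x 1 g b -> is_derive x 1 (fun y => f y + g y) (a + b).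
Proof. by move=> df dg; exact: is_deriveD. Qed.

Lemma is_deriveBf (f g : R -> R) (x a b : R) : is_derive x 1 f a ->
  is_derive x 1 g b -> is_derive x 1 (fun y => f y - g y) (a - b).
Proof. by move=> df dg; exact: is_deriveB. Qed.

Lemma is_deriveMf (f g : R -> R) (x a b : R) : is_derive x 1 f a ->
  is_derive x 1 g b -> is_derive x 1 (fun y => f y * g y) (f x * b + g x * a).
Proof. by move=> df dg; exact: is_deriveM. Qed.

Lemma is_deriveZf (f : R -> R) (c x a : R) : is_derive x 1 f a ->
  is_derive x 1 (fun y => c * f y) (c * a).
Proof. by move=> df; exact: is_deriveZ. Qed.

Lemma is_deriveXf (f : R -> R) n (x a : R) : is_derive x 1 f a ->
  is_derive x 1 (fun y => f y ^+ n.+1) (n.+1%:R * f x ^+ n * a).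
Proof.
move=> df; have := is_deriveX n.+1 df.
by rewrite exprfctE.
Qed.

Lemma is_derive_dominated0 (f g : R -> R) (x : R) :
  (forall y, `|g y - g x| <= `|f y - f x|) -> is_derive x 1 f 0 ->
  is_derive x 1 g 0.
Proof.
move=> gf /is_deriveE fl; apply: is_deriveI.
apply/cvgr0Pnorm_le => e e0.
move/cvgr0Pnorm_le : fl => /(_ e e0); apply: filterS => h.
apply: le_trans; rewrite !normrM; apply: ler_wpM2l => //.
Qed.

Let poly n (sig x : R) : R :=
  x ^+ n.+1 - n.+1%:R / n.+2%:R * (x ^+ n.+2 / sig).

Let is_derive_poly n (sig x : R) : 0 < sig ->
  is_derive x 1 (poly n sig) (n.+1%:R * x ^+ n * (1 - x / sig)).
Proof.
move=> s0; rewrite /poly.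
have n2 : n.+2%:R != 0 :> R by rewrite pnatr_eq0.
have d1 := is_deriveXf n (is_derive_id x 1).
have d2 := is_deriveXf n.+1 (is_derive_id x 1).
have := is_deriveBf d1 (is_deriveZf (n.+1%:R / n.+2%:R / sig) d2).
rewrite (_ : (fun _ => _) = (fun y => y ^+ n.+1 - n.+1%:R / n.+2%:R * (y ^+ n.+2 / sig))); last first.
  by apply/funext => y /=; rewrite mulrAC -!mulrA.
rewrite (_ : _ - _ = n.+1%:R * x ^+ n * (1 - x / sig))// !mulr1 /= exprS.
move: (n.+2%:R) n2 => c c0; field.
by rewrite c0 gt_eqF.
Qed.

(** Away from [sig] the weight is locally a polynomial or a constant. At [r = sig] the factor
    [1 - r / sig] makes the polynomial's derivative vanish, and the truncated weight varies no more
    than the polynomial, so the corner of [min] leaves no trace. *)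
Lemma is_derive_weight n (sig r : R) : 0 < sig ->
  is_derive r 1 (weight n.+1 sig) (slope n.+1 sig r).
Proof.
move=> s0; rewrite /slope /=.
have pw : weight n.+1 sig = poly n sig \o Num.min^~ sig by [].
have [rs|sr|rs] := ltgtP r sig.
- apply: (@near_eq_is_derive _ _ _ (poly n sig)); last exact: is_derive_poly.
  near=> y; rewrite pw /= min_l// ltW//; near: y.
  exact: lt_nbhsl.
- rewrite divff ?gt_eqF// subrr mulr0.
  apply: (@near_eq_is_derive _ _ _ (cst (poly n sig sig))).
  near=> y; rewrite pw /= min_r// ltW//; near: y.
  exact: lt_nbhsr.
- rewrite rs divff ?gt_eqF// subrr mulr0.
  apply: (@is_derive_dominated0 (poly n sig)).
    move=> y; rewrite pw /= minxx; have [ys|sy] := leP y sig; first by [].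
    by rewrite subrr normr0.
  by have := is_derive_poly n sig s0; rewrite divff ?gt_eqF// subrr mulr0.
Unshelve. all: by end_near. Qed.

End Calculus.

(** * Differentiation under the expectation *)

Section DeriveExpectation.
Context {R : realType} d (T : measurableType d) (P : probability T R).

Lemma is_derive_Ex (f f' : R -> T -> R) (K t : R) : 0 < t ->
  (forall s : R, 0 < s -> L1 P (f s)) ->
  (forall (s : R) z, 0 < s -> is_derive s 1 (f^~ z) (f' s z)) ->
  (forall (s : R) z, 0 < s -> `|f' s z| <= K) ->
  is_derive t 1 (fun s => Ex P (f s)) (Ex P (f' t)).
Proof.
move=> t0 Lf df fK.
have Ia : (`]0, t + 1[%classic : set R) t by rewrite /= in_itv/= t0 ltrDl ltr01.
have Is s : (`]0, t + 1[%classic : set R) s -> 0 < s by rewrite /= in_itv/= => /andP[].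
have K0 (y : T) : 0 <= K by apply: le_trans (fK t y t0).
have int s : (`]0, t + 1[%classic : set R) s -> P.-integrable setT (EFin \o f s).
  by move/Is => s0; exact: Lf.
have der s y : (`]0, t + 1[%classic : set R) s -> setT y -> derivable (f^~ y) s 1.
  by move=> /Is s0 _; have [] := df s y s0.
have d1 s y : 0 < s -> partial1of2 f s y = f' s y.
  by move=> s0; rewrite partial1of2E; have [_ ->] := df s y s0.
have ub s y : (`]0, t + 1[%classic : set R) s -> setT y -> `|partial1of2 f s y| <= `|K|.
  by move=> /Is s0 _; rewrite d1// (le_trans (fK s y s0))// ler_norm.
have h := @cvg_differentiation_under_integral R _ T P f setT measurableT t 0 (t + 1) Ia int der
  (fun=> `|K|) (fun=> normr_ge0 K) (L1_cst P `|K|) ub.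
have -> : Ex P (f' t) = \int[P]_(y in setT) partial1of2 f t y.
  by apply: eq_Ex => y; rewrite d1.
by apply: is_deriveI.
Qed.

End DeriveExpectation.

(** * Gronwall's inequality *)

Section Gronwall.
Context {R : realType}.

(** The function [f(s) exp(- C s) - b s] is nonincreasing, the factor [exp(- C s) <= 1] in front of
    [b] being bounded by 1. Derivatives are asked for in the open interval only, since at time 0
    they are one-sided; continuity covers the endpoints. *)
Lemma gronwall (f f' : R -> R) (C b tau : R) : 0 <= C -> 0 <= b ->
  {within `[0, tau], continuous f} ->
  (forall t : R, 0 < t < tau -> is_derive t 1 f (f' t)) ->
  (forall t : R, 0 < t < tau -> f' t <= C * f t + b) ->
  forall t, 0 <= t <= tau -> f t <= (f 0 + b * t) * expR (C * t).
Proof.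
move=> C0 b0 cf df fle t /andP[t0 tt].
pose e (s : R) : R := expR (- C * s).
have de (s : R) : is_derive s 1 e (- C * e s).
  rewrite mulrC; apply: is_derive1_comp.
  by rewrite -[X in is_derive _ _ _ X]mulr1; apply: is_deriveZf; exact: is_derive_id.
pose g (s : R) : R := f s * e s - b * s.
have dg (s : R) : 0 < s < tau -> is_derive s 1 g (f s * (- C * e s) + e s * f' s - b).
  move=> st; apply: is_deriveBf; first by apply: is_deriveMf => //; exact: df.
  by rewrite -[X in is_derive _ _ _ X]mulr1; apply: is_deriveZf; exact: is_derive_id.
have ce : continuous e.
  by move=> s; apply/differentiable_continuous; rewrite -derivable1_diffP; have [] := de s.
have cg : {within `[0, tau], continuous g}.
  have -> : g = (f \* e) - (fun s => b * s) by [].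
  have c1 : {within `[0, tau], continuous e} by exact: continuous_subspaceT.
  have c2 : {within `[0, tau], continuous (fun s : R => b * s)}.
    by apply: continuous_subspaceT => s; apply: cvgM; [exact: cvg_cst|exact: cvg_id].
  move=> s; apply: cvgB; last exact: c2.
  by apply: cvgM; [exact: cf|exact: c1].
have gle : g t <= g 0.
  have tau0 : 0 <= tau by exact: le_trans tt.
  apply: (@ler0_derive1_le_cc _ g 0 tau _ _ cg t 0); rewrite ?in_itv/= ?lexx ?t0//.
  - by move=> s; rewrite in_itv/= => st; have [] := dg s st.
  - move=> s; rewrite in_itv/= => st; have [_ ds] := dg s st.
    rewrite derive1E ds.
    have es0 : 0 <= e s by exact: expR_ge0.
    have es1 : e s <= 1.
      by rewrite /e -expR0 ler_expR mulNr oppr_le0 mulr_ge0// ltW//; case/andP: st.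
    have h := ler_wpM2l es0 (fle s st).
    have h2 : 0 <= b * (1 - e s) by rewrite mulr_ge0// subr_ge0.
    by lra.
move: gle; rewrite /g /e !mulr0 expR0 mulr1 subr0 mulNr expRN.
rewrite lerBlDr ler_pdivrMr ?expR_gt0//.
Qed.

End Gronwall.

Lemma is_derive_normsq {R : realType} (f g : R -> R) (t a b : R) :
  is_derive t 1 f a -> is_derive t 1 g b ->
  is_derive t 1 (fun s => normsq (f s, g s)) (2 * (f t * a + g t * b)).
Proof.
move=> df dg; have h := is_deriveDf (is_deriveXf 1 df) (is_deriveXf 1 dg).
rewrite (_ : 2 * _ = 2 * f t ^+ 1 * a + 2 * g t ^+ 1 * b)//.
by rewrite !expr1; ring.
Qed.

Lemma speed_bound {R : realType} (S a b u v e l : R) :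
  `|a| <= e -> `|b| <= e -> `|u| <= 2 * l -> `|v| <= 2 * l ->
  `|S * (2 * (a * u + b * v))| <= `|S| * e * (8 * l).
Proof.
move=> ae be ul vl; rewrite normrM -mulrA; apply: ler_wpM2l => //.
rewrite normrM (ger0_norm (ler0n _ 2)).
rewrite [leRHS](_ : _ = 2 * (e * (2 * l) + e * (2 * l))); last by ring.
apply: ler_wpM2l => //; apply: le_trans (ler_normD _ _) _.
by rewrite !normrM; apply: lerD; apply: ler_pM.
Qed.

(** * Time derivatives of centers, deviations and expected weights *)

Section Evolution.
Context {R : realType} d (T : measurableType d) (P : probability T R).
Variables (M : nat) (gam : 'I_M -> R) (p : R -> 'I_M -> R * R).
Variables (D de A0 : R) (A : nat -> R).
Let C1 := 1 + 4 * D.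

(** The interface between the fluid and the moment argument. The constants [D], [A0] and [A] are
    parameters fixed before [eps] and [X], so every bound derived from this record is uniform in
    [eps]. Velocities are recorded at positive times; [ev_lip] supplies continuity down to time
    0. *)
Record evolution (eps : R) (X : R -> 'I_M -> T -> R * R) : Prop := Evolution {
  ev_eps0 : 0 < eps;
  ev_eps1 : eps <= 1;
  ev_meas : forall t, 0 <= t -> forall m b, mf (fun z => pr b (X t m z));
  ev_L1 : forall t, 0 <= t -> forall m b, L1 P (fun z => pr b (X t m z));
  ev_dens : forall t, 0 <= t -> forall m, box_density P (X t m) (D / eps ^+ 2);
  ev_vel : forall t : R, 0 < t -> forall m b z,
    is_derive t 1 (fun s => pr b (X s m z)) (vel P gam (X t) b m z);
  ev_lip : forall s t, 0 <= s -> 0 <= t -> forall m b z,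
    `|pr b (X s m z) - pr b (X t m z)| <= gnorm gam * (C1 / eps) * `|s - t|;
  ev_init : forall k m, L1 P (fun z => enorm (dev P (X 0) m z) ^+ (2 * k)) /\
    Ex P (fun z => enorm (dev P (X 0) m z) ^+ (2 * k)) <= A k * eps ^+ (2 * k);
  ev_ctr : forall m, normsq (ctr P (X 0) m - p 0 m) <= A0 * eps ^+ 2
}.

Hypothesis de0 : 0 < de.
Variables (eps : R) (X : R -> 'I_M -> T -> R * R).
Hypothesis ev : evolution eps X.

Let L := gnorm gam * (C1 / eps).
Let eps0 := ev_eps0 ev.

Lemma pr_ctr b t m : pr b (ctr P (X t) m) = Ex P (fun z => pr b (X t m z)).
Proof. by case: b. Qed.

Lemma prB b (x y : R * R) : pr b (x - y) = pr b x - pr b y.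
Proof. by case: b. Qed.

(** A crude speed bound of order [1 / eps]. It is used to dominate derivatives, for continuity in
    time, and in [controlled_of], where the factor [eps^4] beats it. *)
Lemma vel_le t b m z : 0 <= t -> `|vel P gam (X t) b m z| <= L.
Proof.
move=> t0; apply: le_trans (ler_norm_sum _ _ _) _.
rewrite /L /gnorm mulr_suml; apply: ler_sum => l _; rewrite normrM.
by apply: ler_wpM2l => //; exact: (ext_le eps0 (ev_meas ev t0) (ev_dens ev t0)).
Qed.

Lemma velocity_L1 t b m : 0 <= t -> L1 P (vel P gam (X t) b m).
Proof. by move=> t0; exact: (vel_L1 gam eps0 (ev_meas ev t0) (ev_dens ev t0)). Qed.

Lemma cvel_le t b m : 0 <= t -> `|cvel P gam (X t) b m| <= L.
Proof.
move=> t0; rewrite -[leRHS](Ex_cst P); apply: norm_Ex_le.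
- exact: velocity_L1.
- exact: L1_cst.
- by move=> z; exact: vel_le.
Qed.

Lemma is_derive_ctr (t : R) b m : 0 < t ->
  is_derive t 1 (fun s => pr b (ctr P (X s) m)) (cvel P gam (X t) b m).
Proof.
move=> t0; have -> : (fun s => pr b (ctr P (X s) m)) = (fun s => Ex P (fun z => pr b (X s m z))).
  by apply/funext => s; rewrite pr_ctr.
apply: (@is_derive_Ex _ _ _ P _ (fun s z => vel P gam (X s) b m z) L) => //.
- by move=> s s0; exact: (ev_L1 ev (ltW s0)).
- by move=> s z s0; exact: (ev_vel ev s0).
- by move=> s z s0; exact: vel_le (ltW s0).
Qed.

Lemma ctr_lip s t b m : 0 <= s -> 0 <= t ->
  `|pr b (ctr P (X s) m) - pr b (ctr P (X t) m)| <= L * `|s - t|.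
Proof.
move=> s0 t0; rewrite !pr_ctr -(ExB (ev_L1 ev s0 m b) (ev_L1 ev t0 m b)).
rewrite -[leRHS](Ex_cst P); apply: norm_Ex_le.
- exact: (L1B (ev_L1 ev s0 m b) (ev_L1 ev t0 m b)).
- exact: L1_cst.
- by move=> z; exact: (ev_lip ev).
Qed.

Lemma dev_lip s t m z : 0 <= s -> 0 <= t ->
  enorm (dev P (X s) m z - dev P (X t) m z) <= 4 * L * `|s - t|.
Proof.
move=> s0 t0; apply: le_trans (enorm_le_sum _) _.
have h b : `|pr b (dev P (X s) m z - dev P (X t) m z)| <= 2 * L * `|s - t|.
  have -> : pr b (dev P (X s) m z - dev P (X t) m z) =
      (pr b (X s m z) - pr b (X t m z)) -
      (pr b (ctr P (X s) m) - pr b (ctr P (X t) m)).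
    by rewrite /dev !prB; ring.
  apply: le_trans (ler_normB _ _) _.
  rewrite [leRHS](_ : _ = L * `|s - t| + L * `|s - t|); last by ring.
  by apply: lerD; [exact: (ev_lip ev)|exact: ctr_lip].
apply: le_trans (lerD (h false) (h true)) _.
by apply: eqW; ring.
Qed.

Lemma is_derive_dev (t : R) b m z : 0 < t ->
  is_derive t 1 (fun s => pr b (dev P (X s) m z))
    (vel P gam (X t) b m z - cvel P gam (X t) b m).
Proof.
move=> t0; have -> : (fun s => pr b (dev P (X s) m z)) =
    (fun s => pr b (X s m z) - pr b (ctr P (X s) m)).
  by apply/funext => s; rewrite /dev prB.
by apply: is_deriveBf; [exact: (ev_vel ev)|exact: is_derive_ctr].
Qed.

Definition Wt k m (t : R) : R :=
  Ex P (fun z => weight k (de ^+ 2) (normsq (dev P (X t) m z))).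

Let dw (t : R) n m z := slope n.+1 (de ^+ 2) (normsq (dev P (X t) m z)) *
  (2 * (pr false (dev P (X t) m z) * (vel P gam (X t) false m z - cvel P gam (X t) false m)
    + pr true (dev P (X t) m z) * (vel P gam (X t) true m z - cvel P gam (X t) true m))).

Lemma is_derive_weight_dev n (t : R) m z : 0 < t ->
  is_derive t 1 (fun s => weight n.+1 (de ^+ 2) (normsq (dev P (X s) m z)))
   (dw t n m z).
Proof.
move=> t0; have d2 : 0 < de ^+ 2 by rewrite exprn_gt0.
apply: (is_derive1_comp (f := weight n.+1 (de ^+ 2))
  (g := fun s => normsq (dev P (X s) m z))).
  exact: is_derive_weight.
exact: (is_derive_normsq (is_derive_dev false m z t0) (is_derive_dev true m z t0)).
Qed.

Lemma weight_L1 n t m : 0 <= t ->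
  L1 P (fun z => weight n.+1 (de ^+ 2) (normsq (dev P (X t) m z))).
Proof.
move=> t0; have d2 : 0 < de ^+ 2 by rewrite exprn_gt0.
apply: (@L1_bounded _ _ _ _ ((de ^+ 2) ^+ n.+1)).
  have h : mf (fun z => Num.min (normsq (dev P (X t) m z)) (de ^+ 2)).
    apply: measurable_minr => //; apply: measurable_normsq.
      exact: (mdev1 P (ev_meas ev t0)).
    exact: (mdev2 P (ev_meas ev t0)).
  apply: measurable_funB; first exact: measurable_funX.
  by apply: measurable_funM => //; apply: measurable_funM => //; exact: measurable_funX.
move=> z; set r := normsq _; have r0 : 0 <= r by exact: normsq_ge0.
have m0 : 0 <= Num.min r (de ^+ 2) by rewrite min_ge0// ltW.
rewrite ger0_norm; last first.
  apply: le_trans (weight_ge _ d2 r0); rewrite mulr_ge0 ?invr_ge0//.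
  by rewrite exprn_ge0.
apply: le_trans (weight_le _ d2 r0) _; apply: lerXn2r; rewrite ?nnegrE ?(ltW d2)//.
by rewrite ge_min lexx orbT.
Qed.

Lemma is_derive_Wt n (t : R) m : 0 < t ->
  is_derive t 1 (Wt n.+1 m) (2 * drift P gam (X t) de n.+1 m).
Proof.
move=> t0; have d2 : 0 < de ^+ 2 by rewrite exprn_gt0.
have L0 : 0 <= L by apply: le_trans (cvel_le false m (ltW t0)).
have LI b s : 0 <= s -> L1 P (fun z => vel P gam (X s) b m z - cvel P gam (X s) b m).
  by move=> s0; apply: L1B; [exact: velocity_L1|exact: L1_cst].
have -> : 2 * drift P gam (X t) de n.+1 m = Ex P (dw t n m).
  rewrite /drift -ExZl.
    by apply: eq_Ex => z; exact: mulrCA.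
  exact: (part_L1 de0 (ev_meas ev (ltW t0)) n m
    (LI false t (ltW t0)) (LI true t (ltW t0))).
have dwle s z : 0 < s -> `|dw s n m z| <= n.+1%:R * de ^+ (2 * n + 1) * (8 * L).
  move=> s0; rewrite /dw.
  set S := slope _ _ _; set x := dev _ _ _ _.
  have vb b : `|vel P gam (X s) b m z - cvel P gam (X s) b m| <= 2 * L.
    apply: le_trans (ler_normB _ _) _; rewrite mulr_natl mulr2n.
    by apply: lerD; [exact: vel_le (ltW s0)|exact: cvel_le (ltW s0)].
  apply: le_trans (speed_bound S (pr_norm false x) (pr_norm true x) (vb false) (vb true)) _.
  by apply: ler_wpM2r; [rewrite mulr_ge0|exact: slope_norm_le].
apply: (@is_derive_Ex _ _ _ P _ (fun s z => dw s n m z) _ _ t0 _ _ dwle).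
- by move=> s s0; exact: weight_L1 (ltW s0).
- by move=> s z s0; exact: is_derive_weight_dev.
Qed.

Lemma weight_lip n (r s : R) (sig : R) : 0 < sig -> 0 <= r -> 0 <= s ->
  `|weight n.+1 sig r - weight n.+1 sig s| <=
  2 * n.+1%:R * sig ^+ n * `|Num.min r sig - Num.min s sig|.
Proof.
move=> s0 r0 t0; wlog sr : r s r0 t0 / Num.min s sig <= Num.min r sig.
  move=> W; have [|h] := leP (Num.min s sig) (Num.min r sig); first exact: W.
  by rewrite distrC (distrC (Num.min r sig)); apply: W => //; exact: ltW.
rewrite /weight; set a := Num.min r sig in sr *; set b := Num.min s sig in sr *.
have b0 : 0 <= b by rewrite min_ge0// ltW.
have a0 : 0 <= a by exact: le_trans sr.
have as_ : a <= sig by rewrite ge_min lexx orbT.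
have ab0 : 0 <= a - b by rewrite subr_ge0.
rewrite (ger0_norm ab0).
have p1 m : `|a ^+ m.+1 - b ^+ m.+1| <= m.+1%:R * sig ^+ m * (a - b).
  rewrite ger0_norm; last by rewrite subr_ge0; apply: lerXn2r; rewrite ?nnegrE.
  apply: le_trans (subrXS_le m b0 sr) _; apply: ler_wpM2r => //.
  by apply: ler_wpM2l => //; apply: lerXn2r => //; rewrite nnegrE ltW.
have -> : a ^+ n.+1 - n.+1%:R / n.+2%:R * (a ^+ n.+2 / sig) -
   (b ^+ n.+1 - n.+1%:R / n.+2%:R * (b ^+ n.+2 / sig)) =
   (a ^+ n.+1 - b ^+ n.+1) - n.+1%:R / n.+2%:R / sig * (a ^+ n.+2 - b ^+ n.+2).
  by ring.
apply: le_trans (ler_normB _ _) _.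
rewrite [leRHS](_ : _ = n.+1%:R * sig ^+ n * (a - b) + n.+1%:R * sig ^+ n * (a - b)); last by ring.
apply: lerD; first exact: p1.
have c0 : 0 <= n.+1%:R / n.+2%:R / sig by rewrite !divr_ge0// ltW.
rewrite normrM (ger0_norm c0); apply: le_trans (ler_wpM2l c0 (p1 n.+1)) _.
apply: eqW; rewrite exprS.
have n2 : n.+2%:R != 0 :> R by rewrite pnatr_eq0.
move: (n.+2%:R) n2 => c cn0; field.
by rewrite cn0 gt_eqF.
Qed.

(** Serves continuity of the expected weights on the closed interval, including time 0, where no
    two-sided derivative is available. *)
Lemma Wt_lip n m s t : 0 <= s -> 0 <= t ->
  `|Wt n.+1 m s - Wt n.+1 m t| <=
  2 * n.+1%:R * (de ^+ 2) ^+ n * (2 * de * (4 * L)) * `|s - t|.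
Proof.
move=> s0 t0; have d2 : 0 < de ^+ 2 by rewrite exprn_gt0.
rewrite /Wt -(ExB (weight_L1 n m s0) (weight_L1 n m t0)) -[leRHS](Ex_cst P).
apply: norm_Ex_le.
- exact: (L1B (weight_L1 n m s0) (weight_L1 n m t0)).
- exact: L1_cst.
move=> z; apply: le_trans (weight_lip _ d2 (normsq_ge0 _) (normsq_ge0 _)) _.
rewrite -!(sqr_tnorm _ (ltW de0)).
rewrite -[leRHS]mulrA; apply: ler_wpM2l.
  by rewrite !mulr_ge0// exprn_ge0// ltW.
set x := dev P (X s) m z; set y := dev P (X t) m z.
have h := dev_lip m z s0 t0.
rewrite -/x -/y in h.
have -> : tnorm de x ^+ 2 - tnorm de y ^+ 2 =
   (tnorm de x + tnorm de y) * (tnorm de x - tnorm de y) by ring.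
rewrite normrM -mulrA; apply: ler_pM => //.
  rewrite ger0_norm ?addr_ge0 ?tnorm_ge0 ?(ltW de0)//.
  by rewrite mulr_natl mulr2n; apply: lerD; exact: tnorm_le.
apply: le_trans h.
have h1 := ler_enormB x y; have := ler_enormB y x; rewrite (enormBC y) => h2.
rewrite ler_norml /tnorm.
by case: (leP (enorm x) de); case: (leP (enorm y) de); lra.
Qed.

End Evolution.

Lemma exponent_le n : (n.+4 <= 2 * n.+3)%N.
Proof. by lia. Qed.

(** * Growth of the truncated moments under the bootstrap hypotheses *)

Section Growth.
Context {R : realType} d (T : measurableType d) (P : probability T R).
Variables (M : nat) (gam : 'I_M -> R) (p : R -> 'I_M -> R * R).
Variables (D de A0 K1 T0 : R) (A : nat -> R).
Hypotheses (de0 : 0 < de) (D0 : 0 <= D) (K10 : 0 <= K1) (T00 : 0 <= T0).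
Let C1 := 1 + 4 * D.
Local Notation evo := (evolution P gam p D A0 A).
Local Notation mom k Xt := (moments P Xt de k).

(** The state at one time under which the drift bounds hold: separated centers, a small tail, and a
    small first-moment tail. The last cannot follow from truncated moments and is stated apart. *)
Definition controlled (eps : R) (Xt : 'I_M -> T -> R * R) : Prop :=
  [/\ forall m l, m != l -> 3 * de <= enorm (ctr P Xt m - ctr P Xt l),
      forall m, Ex P (fun z => far de (dev P Xt m z)) <= eps ^+ 4 &
      forall m, Ex P (fun z => far de (dev P Xt m z) * enorm (dev P Xt m z))
        <= K1 * eps ^+ 2].

Let gn0 : 0 <= gnorm gam := gnorm_ge0 gam.
Let d2 : 0 < de ^+ 2. Proof. by rewrite exprn_gt0. Qed.
Let C10 : 0 <= C1. Proof. by rewrite addr_ge0// mulr_ge0. Qed.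

Lemma driftC_ge0 k : 0 <= driftC D de k.
Proof. by rewrite /driftC mulr_ge0// addr_ge0// invr_ge0 ltW. Qed.

Section OneEvolution.
Variables (eps : R) (X : R -> 'I_M -> T -> R * R).
Hypothesis ev : evo eps X.
Let eps0 := ev_eps0 ev.
Let eps1 := ev_eps1 ev.

Definition Sum k (t : R) : R := \sum_(m < M) Wt P de X k m t.

Lemma moment_weight n m t : 0 <= t ->
  moment P (X t) de n.+1 m <= n.+2%:R * Wt P de X n.+1 m t /\
  Wt P de X n.+1 m t <= moment P (X t) de n.+1 m.
Proof.
move=> t0; have Lw := weight_L1 de0 ev n m t0.
have LT := L1_tnormX P de0 (ev_meas ev t0) (2 * n.+1) m.
have tE z : tnorm de (dev P (X t) m z) ^+ (2 * n.+1) =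
    Num.min (normsq (dev P (X t) m z)) (de ^+ 2) ^+ n.+1.
  by rewrite exprM sqr_tnorm// ltW.
split.
  rewrite -(ExZl _ Lw); apply: Ex_le => //; first exact: L1Zl.
  move=> z; rewrite tE -ler_pdivrMl//.
  exact: (weight_ge _ d2 (normsq_ge0 _)).
apply: Ex_le => // z; rewrite tE.
exact: (weight_le _ d2 (normsq_ge0 _)).
Qed.

Lemma moments_Sum n t : 0 <= t -> mom n.+1 (X t) <= n.+2%:R * Sum n.+1 t /\
  Sum n.+1 t <= mom n.+1 (X t).
Proof.
move=> t0; split; rewrite /moments /Sum ?mulr_sumr; apply: ler_sum => m _;
  by have [] := moment_weight n m t0.
Qed.

Lemma moments0 k : mom k (X 0) <= M%:R * `|A k| * eps ^+ (2 * k).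
Proof.
rewrite /moments; apply: le_trans (_ : \sum_(m < M) `|A k| * eps ^+ (2 * k) <= _).
  apply: ler_sum => m _; have [LE EE] := ev_init ev k m.
  apply: le_trans (_ : A k * eps ^+ (2 * k) <= _).
    apply: le_trans EE; apply: Ex_le => //.
      exact: (L1_tnormX P de0 (ev_meas ev (lexx 0)) (2 * k) m).
    move=> z; apply: lerXn2r; rewrite ?nnegrE ?enorm_ge0 ?tnorm_ge0 ?(ltW de0)//.
    by rewrite /tnorm ge_min lexx.
  by apply: ler_wpM2r; rewrite ?ler_norm// exprn_ge0// ltW.
by rewrite sumr_const card_ord -[leLHS]mulr_natl mulrA.
Qed.

Lemma is_derive_Sum n (t : R) : 0 < t ->
  is_derive t 1 (Sum n.+1) (\sum_(m < M) 2 * drift P gam (X t) de n.+1 m).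
Proof.
move=> t0; rewrite (_ : Sum n.+1 = \sum_(m < M) Wt P de X n.+1 m); last first.
  by apply/funext => s; rewrite /Sum fct_sumE.
by apply: is_derive_sum => m; exact: (is_derive_Wt de0 ev).
Qed.

Lemma lipschitz_within (f : R -> R) (K tau : R) :
  (forall s t, 0 <= s -> 0 <= t -> `|f s - f t| <= K * `|s - t|) ->
  {within `[0, tau], continuous f}.
Proof.
move=> lf; have K0 : 0 <= K by have := lf 1 0 ler01 (lexx 0); rewrite subr0 normr1 mulr1; apply: le_trans.
apply/subspace_continuousP => x /=; rewrite in_itv/= => /andP[x0 _].
apply/cvgrPdist_le => e e0.
have K1p : 0 < K + 1 by rewrite ltr_wpDl.
have nx : \forall s \near x, `|x - s| <= e / (K + 1).
  by have /cvgrPdist_le := (@cvg_id _ (nbhs x)); apply; rewrite divr_gt0.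
apply: filterS nx => s xs; rewrite /= in_itv/= => /andP[s0 _].
apply: le_trans (lf x s x0 s0) _.
apply: le_trans (ler_wpM2l K0 xs) _.
rewrite mulrA ler_pdivrMr// mulrC; apply: ler_wpM2l; first exact: ltW.
by rewrite lerDl.
Qed.

Lemma continuous_Sum n tau : {within `[0, tau], continuous (Sum n.+1)}.
Proof.
apply: (@lipschitz_within _ (M%:R * (2 * n.+1%:R * (de ^+ 2) ^+ n * (2 * de * (4 * (gnorm gam * (C1 / eps))))))).
move=> s t s0 t0; rewrite /Sum -sumrB; apply: le_trans (ler_norm_sum _ _ _) _.
rewrite -mulrA -[X in X%:R * _](card_ord M) mulr_natl -sumr_const.
by apply: ler_sum => m _; exact: (Wt_lip de0 ev).
Qed.

(** Gronwall for the sum of the weights. In [c'] the 2 restores the factor left out of [drift], [M]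
    counts the blobs, and [n + 2] converts weights back into moments. *)
Lemma growth_step n (c b tau : R) : 0 <= c -> 0 <= b -> tau <= T0 ->
  (forall (t : R) m, 0 < t < tau ->
     `|drift P gam (X t) de n.+1 m| <= c * (mom n.+1 (X t) + b)) ->
  let c' := 2 * M%:R * c * n.+2%:R in
  forall t, 0 <= t <= tau ->
    mom n.+1 (X t) <= n.+2%:R * ((mom n.+1 (X 0) + c' * b * T0) * expR (c' * T0)).
Proof.
move=> c0 b0 tauT dle c' t /andP[t0 tt].
have c'0 : 0 <= c' by rewrite /c' !mulr_ge0.
have S0 (s : R) : 0 <= s -> 0 <= Sum n.+1 s.
  move=> s0; have [h _] := moments_Sum n s0.
  by rewrite -(pmulr_rge0 _ (ltr0Sn R n.+1)); apply: le_trans h; exact: moments_ge0.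
have [h _] := moments_Sum n t0.
apply: le_trans h _; apply: ler_wpM2l => //.
have cb0 : 0 <= c' * b by rewrite mulr_ge0.
have dS (s : R) : 0 < s < tau -> is_derive s 1 (Sum n.+1)
    (\sum_(m < M) 2 * drift P gam (X s) de n.+1 m).
  by move=> /andP[s0 _]; exact: is_derive_Sum.
have := @gronwall R (Sum n.+1) _ c' (c' * b) tau c'0 cb0 (@continuous_Sum n tau) dS _ t.
rewrite t0 tt => /(_ _ isT) g.
apply: le_trans (g _) _.
  move=> s /[dup] st /andP[s0 _]; have [h1 _] := moments_Sum n (ltW s0).
  apply: le_trans (_ : \sum_(m < M) 2 * (c * (mom n.+1 (X s) + b)) <= _).
    apply: ler_sum => m _; apply: ler_wpM2l => //.
    by apply: le_trans (ler_norm _) _; exact: dle.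
  rewrite sumr_const card_ord -[leLHS]mulr_natl.
  apply: le_trans (_ : M%:R * (2 * (c * (n.+2%:R * Sum n.+1 s + n.+2%:R * b))) <= _).
    apply: ler_wpM2l => //; apply: ler_wpM2l => //; apply: ler_wpM2l => //.
    by apply: lerD => //; rewrite ler_peMl// ler1n.
  by rewrite /c'; apply: eqW; ring.
have [_ h0] := moments_Sum n (lexx 0).
apply: ler_pM.
- by rewrite addr_ge0 ?S0// mulr_ge0.
- exact: expR_ge0.
- by apply: lerD => //; apply: ler_wpM2l => //; exact: le_trans tauT.
- by rewrite ler_expR; apply: ler_wpM2l => //; exact: le_trans tauT.
Qed.

Lemma drift1_le t m : 0 <= t -> controlled eps (X t) ->
  `|drift P gam (X t) de 1 m| <=
   gnorm gam * ((de ^+ 2)^-1 + 2 * driftC D de 1) * (mom 1 (X t) + eps ^+ 2).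
Proof.
move=> t0 [sep tail _].
have := drift_le gam eps0 eps1 de0 (ev_meas ev t0) (ev_dens ev t0) sep tail 0 m.
have s1 := selfpart1_le eps0 de0 (ev_meas ev t0) (ev_L1 ev t0) (ev_dens ev t0) m.
move=> h; apply: le_trans h _; rewrite -mulrA; apply: ler_wpM2l => //.
rewrite muln1 expr1 mulrDl; apply: lerD.
  apply: le_trans s1 _; rewrite mulrC; apply: ler_wpM2l; first by rewrite invr_ge0 ltW.
  by apply: le_trans (moment_le P (X t) de0 1 m) _; rewrite lerDl exprn_ge0// ltW.
rewrite [leRHS](_ : _ = driftC D de 1 * (2 * (mom 1 (X t) + eps ^+ 2))); last by rewrite -[LHS]mulrA [LHS]mulrCA.
apply: ler_wpM2l; first exact: driftC_ge0.
have := moment_le P (X t) de0 1 m; have := moments_ge0 P (X t) de0 1.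
have : 0 <= eps ^+ 2 by rewrite exprn_ge0// ltW.
by move: (moment _ _ _ _ _) (moments _ _ _ _) (eps ^+ 2) => a b e; lra.
Qed.

(** Powers of [eps]: 2 from the order-1 factor and [n + 2] from the moment of order [n + 1] give the
    source [eps^(n+4)]. The external source, of size [eps^(2 (n+3))], is smaller. *)
Lemma driftn_le n t m (B Bn : R) : 0 <= t -> controlled eps (X t) -> 0 <= B -> 0 <= Bn ->
  mom 1 (X t) <= B * eps ^+ 2 -> mom n.+1 (X t) <= Bn * eps ^+ n.+2 ->
  `|drift P gam (X t) de n.+3 m| <=
   gnorm gam * (selfC n * (B + de * K1) * Bn + driftC D de n.+3 * (2 + B ^+ n.+3))
    * (mom n.+3 (X t) + eps ^+ n.+4).
Proof.
move=> t0 [sep tail tail1] B0 Bn0 hB hBn.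
have := drift_le gam eps0 eps1 de0 (ev_meas ev t0) (ev_dens ev t0) sep tail n.+2 m.
have sn := selfpart_n_le eps0 de0 (ev_meas ev t0) (ev_L1 ev t0) (ev_dens ev t0) tail1 n m.
have e0 k : 0 <= eps ^+ k by rewrite exprn_ge0// ltW.
have m1 := le_trans (moment_le P (X t) de0 1 m) hB.
have mn := le_trans (moment_le P (X t) de0 n.+1 m) hBn.
have mk := moment_le P (X t) de0 n.+3 m.
have mk0 := moments_ge0 P (X t) de0 n.+3.
have sC0 : 0 <= selfC n :> R by rewrite ler0n.
move=> h; apply: le_trans h _; rewrite -mulrA; apply: ler_wpM2l => //.
rewrite mulrDl; apply: lerD.
  apply: le_trans sn _.
  apply: le_trans (_ : selfC n * (B + de * K1) * Bn * eps ^+ n.+4 <= _); last first.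
    apply: ler_wpM2l; last by rewrite lerDr.
    by rewrite !mulr_ge0// addr_ge0// mulr_ge0// ltW.
  have -> : selfC n * (B + de * K1) * Bn * eps ^+ n.+4 =
     selfC n * ((B + de * K1) * eps ^+ 2) * (Bn * eps ^+ n.+2).
    by rewrite (_ : n.+4 = (2 + n.+2)%N)// exprD; ring.
  apply: ler_pM => //.
  - rewrite mulr_ge0// addr_ge0 ?moment_ge0// !mulr_ge0//; exact: ltW.
  - exact: moment_ge0.
  - apply: ler_wpM2l => //; rewrite mulrDl mulrA; exact: lerD.
rewrite -mulrA; apply: ler_wpM2l; first exact: driftC_ge0.
have e2k : eps ^+ (2 * n.+3) <= eps ^+ n.+4.
  by apply: ler_wiXn2l => //; [exact: ltW|exact: exponent_le].
have h1 : mom 1 (X t) ^+ n.+3 <= B ^+ n.+3 * eps ^+ n.+4.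
  apply: le_trans (_ : (B * eps ^+ 2) ^+ n.+3 <= _).
    by apply: lerXn2r => //; rewrite nnegrE; [exact: (moments_ge0 P (X t) de0)|exact: (mulr_ge0 B0 (e0 2))].
  rewrite exprMn -exprM; apply: ler_wpM2l; [exact: exprn_ge0|exact: e2k].
have bb : 0 <= B ^+ n.+3 by rewrite exprn_ge0.
have e4 := e0 n.+4.
have : 0 <= B ^+ n.+3 * mom n.+3 (X t) by rewrite mulr_ge0.
move: h1 e2k mk mk0 bb e4.
move: (mom 1 (X t) ^+ n.+3) (mom n.+3 (X t)) (moment _ _ _ _ _) (B ^+ n.+3).
by move: (eps ^+ n.+4) (eps ^+ (2 * n.+3)) => u1 u2 u3 u4 u5 u6; lra.
Qed.

End OneEvolution.

(** The constant is chosen before [eps], [X] and [tau]; uniformity in [tau] lets the bootstrap apply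
    the bound on every initial interval. *)
Lemma growth1 : exists2 B, 0 <= B & forall eps X tau, evo eps X -> tau <= T0 ->
  (forall t, 0 < t < tau -> controlled eps (X t)) ->
  forall t, 0 <= t <= tau -> mom 1 (X t) <= B * eps ^+ 2.
Proof.
pose c := gnorm gam * ((de ^+ 2)^-1 + 2 * driftC D de 1).
have c0 : 0 <= c.
  by rewrite mulr_ge0// addr_ge0 ?invr_ge0 ?(ltW d2)// mulr_ge0// driftC_ge0.
pose c' := 2 * M%:R * c * 2%:R.
have c'0 : 0 <= c' by apply: mulr_ge0 => //; apply: mulr_ge0 => //; apply: mulr_ge0.
exists (2%:R * ((M%:R * `|A 1| + c' * T0) * expR (c' * T0))).
  apply: mulr_ge0 => //; apply: mulr_ge0; last exact: expR_ge0.
  by apply: addr_ge0; apply: mulr_ge0.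
move=> eps X tau ev tauT ctrl t tt.
have e20 : 0 <= eps ^+ 2 by rewrite exprn_ge0// ltW// (ev_eps0 ev).
have := @growth_step eps X ev 0 c (eps ^+ 2) tau c0 e20 tauT _ t tt.
move=> g; apply: le_trans (g _) _.
  move=> s m st; case/andP: (st) => s0 _.
  by apply: (drift1_le ev m (ltW s0)); exact: ctrl.
rewrite -[leRHS]mulrA; apply: ler_wpM2l => //.
rewrite -/c' [leRHS]mulrAC; apply: ler_wpM2r; first exact: expR_ge0.
rewrite [leRHS]mulrDl; apply: lerD; first exact: (moments0 ev 1).
by rewrite [leLHS]mulrAC.
Qed.

(** Induction by steps of two: order [n + 3] uses order 1 and order [n + 1]. The initial moments are
    of size [eps^(2k)], which is at most [eps^(k+1)]. *)
Lemma growth j : exists2 B, 0 <= B & forall eps X tau, evo eps X -> tau <= T0 ->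
  (forall t, 0 < t < tau -> controlled eps (X t)) ->
  forall t, 0 <= t <= tau -> mom (2 * j).+1 (X t) <= B * eps ^+ (2 * j).+2.
Proof.
elim: j => [|j [Bn Bn0 IH]]; first exact: growth1.
have [B B0 hB] := growth1.
have -> : (2 * j.+1 = (2 * j).+2)%N by rewrite mulnS.
set n := (2 * j)%N in IH *.
pose c := gnorm gam * (selfC n * (B + de * K1) * Bn + driftC D de n.+3 * (2 + B ^+ n.+3)).
have c0 : 0 <= c.
  rewrite mulr_ge0// addr_ge0//.
    by rewrite !mulr_ge0// addr_ge0// mulr_ge0// ltW.
  by rewrite mulr_ge0 ?driftC_ge0// addr_ge0// exprn_ge0.
pose c' := 2 * M%:R * c * n.+4%:R.
have c'0 : 0 <= c' by apply: mulr_ge0 => //; apply: mulr_ge0 => //; apply: mulr_ge0.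
exists (n.+4%:R * ((M%:R * `|A n.+3| + c' * T0) * expR (c' * T0))).
  apply: mulr_ge0 => //; apply: mulr_ge0; last exact: expR_ge0.
  by apply: addr_ge0; apply: mulr_ge0.
move=> eps X tau ev tauT ctrl t tt.
have e0 k : 0 <= eps ^+ k by rewrite exprn_ge0// ltW// (ev_eps0 ev).
have := @growth_step eps X ev n.+2 c (eps ^+ n.+4) tau c0 (e0 n.+4) tauT _ t tt.
move=> g; apply: le_trans (g _) _.
  move=> s m st; case/andP: (st) => s0 /ltW st'.
  have ss : 0 <= s <= tau by rewrite (ltW s0).
  apply: (driftn_le ev m (ltW s0) (ctrl s st) B0 Bn0).
    exact: (hB eps X tau).
  exact: (IH eps X tau).
rewrite -[leRHS]mulrA; apply: ler_wpM2l => //.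
rewrite -/c' [leRHS]mulrAC; apply: ler_wpM2r; first exact: expR_ge0.
rewrite [leRHS]mulrDl; apply: lerD.
  apply: le_trans (moments0 ev n.+3) _; apply: ler_wpM2l; first by rewrite mulr_ge0.
  by apply: ler_wiXn2l; [exact: ltW (ev_eps0 ev)|exact: ev_eps1 ev|exact: exponent_le].
by rewrite [leLHS]mulrAC.
Qed.

End Growth.

Lemma sqr_far {R : realType} (de : R) x n : far de x ^+ n.+1 = far de x.
Proof. by rewrite /far; case: (de <= enorm x); rewrite ?expr1n// expr0n. Qed.

Lemma center_arith {R : realType} (a b c e G M : R) : 0 <= a -> 0 <= b ->
  0 <= M -> 0 <= G ->
  M * (4 * (c * (G * (a * c + b * e)))) <= 4 * M * G * (a + b) * (c ^+ 2 + e ^+ 2).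
Proof.
move=> a0 b0 M0 G0.
have h : c * (a * c + b * e) <= (a + b) * (c ^+ 2 + e ^+ 2).
  have h1 : 0 <= a * e ^+ 2 by rewrite mulr_ge0// sqr_ge0.
  have h2 : 0 <= b * (c ^+ 2 + e ^+ 2 - c * e).
    have -> : c ^+ 2 + e ^+ 2 - c * e = ((c - e) ^+ 2 + c ^+ 2 + e ^+ 2) / 2.
      by field.
    by rewrite mulr_ge0// divr_ge0// !addr_ge0 ?sqr_ge0.
  by lra.
have mg : 0 <= 4 * M * G by rewrite !mulr_ge0.
have -> : M * (4 * (c * (G * (a * c + b * e)))) =
  4 * M * G * (c * (a * c + b * e)) by ring.
by rewrite -[leRHS]mulrA; exact: ler_wpM2l.
Qed.

Lemma within_continuous_sum {R : realType} (I : Type) (r : seq I)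
    (f : I -> R -> R) (B : set R) :
  (forall i, {within B, continuous (f i)}) ->
  {within B, continuous (fun s => \sum_(i <- r) f i s)}.
Proof.
move=> cf; elim: r => [|i r IH].
  rewrite (_ : (fun s => _) = cst 0).
    by apply: continuous_subspaceT; exact: cst_continuous.
  by apply/funext => s; rewrite big_nil.
rewrite (_ : (fun s => _) = (fun s => f i s + \sum_(i <- r) f i s)).
  by move=> s; apply: cvgD; [exact: cf|exact: IH].
by apply/funext => s; rewrite big_cons.
Qed.

Lemma within_continuous_normsq {R : realType} (f g : R -> R) (B : set R) :
  {within B, continuous f} -> {within B, continuous g} ->
  {within B, continuous (fun s => normsq (f s, g s))}.
Proof.
move=> cf cg; rewrite (_ : (fun s => _) = (fun s => f s * f s + g s * g s)).
  by move=> s; apply: cvgD; apply: cvgM; [exact: cf|exact: cf|exact: cg|exact: cg].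
by apply/funext => s; rewrite /normsq !expr2.
Qed.

Lemma enorm_chain {R : realType} (a b c e : R * R) :
  enorm (a - e) <= enorm (b - a) + enorm (b - c) + enorm (c - e).
Proof.
have e1 : (b - c) + (c - e) = b - e by rewrite addrA subrK.
have e2 : (a - b) + (b - e) = a - e by rewrite addrA subrK.
rewrite -e2 -e1 (enormBC b a); apply: le_trans (ler_enormD _ _) _.
by rewrite -[leRHS]addrA; apply: lerD; [exact: lexx|exact: ler_enormD].
Qed.

(** * Motion of the centers, bootstrap and concentration *)

Section Concentration.
Context {R : realType} d (T : measurableType d) (P : probability T R).
Variables (M : nat) (gam : 'I_M -> R) (p : R -> 'I_M -> R * R).
Variables (D de A0 T0 : R) (A : nat -> R).
Hypotheses (de0 : 0 < de) (D0 : 0 <= D) (T00 : 0 <= T0).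
Let C1 := 1 + 4 * D.
Local Notation evo := (evolution P gam p D A0 A).
Local Notation mom k Xt := (moments P Xt de k).
Hypothesis p_der : forall (t : R) m b, 0 < t < T0 ->
  is_derive t 1 (fun s => pr b (p s m))
    (\sum_(l < M | l != m) gam l * pr b (bs_kernel (p t m - p t l))).
Hypothesis p_cont : forall m b, {within `[0, T0], continuous (fun s => pr b (p s m))}.
Hypothesis p_sep : forall t m l, 0 <= t <= T0 -> m != l ->
  5 * de <= enorm (p t m - p t l).

(** The terms come from [far_dev_le]: the initial second moment, the 1 from [b <= b^2 + 1], and the
    displacement over time [T0] at speed [O(1 / eps)] weighted by the tail mass. *)
Definition K1 : R := `|A 1| + 1 + 4 * gnorm gam * C1 * T0.
Local Notation ctrl := (controlled P de K1).

Let gn0 : 0 <= gnorm gam := gnorm_ge0 gam.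
Let d2 : 0 < de ^+ 2. Proof. by rewrite exprn_gt0. Qed.
Let C10 : 0 <= C1. Proof. by rewrite addr_ge0// mulr_ge0. Qed.
Let K10 : 0 <= K1.
Proof. by rewrite /K1 !addr_ge0// !mulr_ge0. Qed.

Definition offset (X : R -> 'I_M -> T -> R * R) (t : R) m := ctr P (X t) m - p t m.
Definition Zf (X : R -> 'I_M -> T -> R * R) (t : R) : R :=
  \sum_(m < M) normsq (offset X t m).

Lemma Zf_ge0 X t : 0 <= Zf X t.
Proof. by apply: sumr_ge0 => m _; exact: normsq_ge0. Qed.

Lemma offset_le X t m : enorm (offset X t m) <= Num.sqrt (Zf X t).
Proof.
rewrite /enorm ler_sqrt ?Zf_ge0// /Zf (bigD1 m)//= lerDl sumr_ge0// => l _.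
exact: normsq_ge0.
Qed.

Let pdot b t m := \sum_(l < M | l != m) gam l * pr b (bs_kernel (p t m - p t l)).

Lemma is_derive_Zf eps X (t : R) : evo eps X -> 0 < t < T0 ->
  is_derive t 1 (Zf X) (\sum_(m < M) 2 *
    (pr false (offset X t m) * (cvel P gam (X t) false m - pdot false t m) +
     pr true (offset X t m) * (cvel P gam (X t) true m - pdot true t m))).
Proof.
move=> ev tT; rewrite (_ : Zf X = \sum_(m < M) (fun s => normsq (offset X s m))); last first.
  by apply/funext => s; rewrite /Zf fct_sumE.
apply: is_derive_sum => m.
have t0 : 0 < t by case/andP: tT.
have h b : is_derive t 1 (fun s => pr b (offset X s m)) (cvel P gam (X t) b m - pdot b t m).
  rewrite (_ : (fun s => _) = (fun s => pr b (ctr P (X s) m) - pr b (p s m))); last first.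
    by apply/funext => s; exact: prB.
  by apply: is_deriveBf; [exact: (is_derive_ctr ev)|exact: p_der].
exact: (is_derive_normsq (h false) (h true)).
Qed.

Lemma continuous_Zf eps X tau : evo eps X -> tau <= T0 ->
  {within `[0, tau], continuous (Zf X)}.
Proof.
move=> ev tT.
have sub : (`[0, tau]%classic : set R) `<=` (`[0, T0]%classic : set R).
  by move=> s /=; rewrite !in_itv/= => /andP[-> /le_trans]; apply.
have cpr m b : {within `[0, tau], continuous (fun s => pr b (offset X s m))}.
  have h1 : {within `[0, tau], continuous (fun s => pr b (ctr P (X s) m))}.
    apply: (@lipschitz_within _ _ (gnorm gam * (C1 / eps))) => s t s0 t0.
    exact: (ctr_lip ev).
  have h2 := continuous_subspaceW sub (@p_cont m b).
  rewrite (_ : (fun s => _) = (fun s => pr b (ctr P (X s) m) - pr b (p s m))); last first.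
    by apply/funext => s; exact: prB.
  by move=> s; apply: cvgB; [exact: h1|exact: h2].
apply: within_continuous_sum => m.
exact: (within_continuous_normsq (@cpr m false) (@cpr m true)).
Qed.

Lemma kernel_offset eps X t b m l : 0 <= t <= T0 -> m != l -> ctrl eps (X t) ->
  `|pr b (bs_kernel (ctr P (X t) m - ctr P (X t) l)) - pr b (bs_kernel (p t m - p t l))|
  <= 2 * Num.sqrt (Zf X t) / de ^+ 2.
Proof.
move=> tT ml [sep _ _].
have h1 : de <= enorm (ctr P (X t) m - ctr P (X t) l).
  by apply: le_trans (sep m l ml); rewrite ler_peMl ?(ltW de0)// ler1n.
have h2 : de <= enorm (p t m - p t l).
  by apply: le_trans (p_sep tT ml); rewrite ler_peMl ?(ltW de0)// ler1n.
have h3 : enorm (ctr P (X t) m - ctr P (X t) l - (p t m - p t l)) <= 2 * Num.sqrt (Zf X t).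
  have -> : ctr P (X t) m - ctr P (X t) l - (p t m - p t l) =
      offset X t m + - offset X t l.
    by rewrite /offset !opprB addrACA [RHS]addrACA; congr (_ + _); rewrite addrC.
  apply: le_trans (ler_enormD _ _) _; rewrite enormN mulr_natl mulr2n.
  by apply: lerD; exact: offset_le.
have := bs_kernel_lip de0 h1 h2.
have h4 := ler_wpM2r (ltW (_ : 0 < (de ^+ 2)^-1)) h3.
rewrite invr_gt0 in h4; have {}h4 := h4 d2.
by case=> k1 k2; case: b; [apply: le_trans k2 _|apply: le_trans k1 _].
Qed.

(** The velocity of each center differs from that of its vortex by [O(sqrt Z + eps)]: the kernel is
    Lipschitz on separated points, and the spread of a blob is [O(eps)] by the moment of order 1.
    Working with the sum of squares avoids differentiating a norm at 0. *)
Lemma growthZ : exists2 B, 0 <= B & forall eps X tau, evo eps X -> tau <= T0 ->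
  (forall t, 0 < t < tau -> ctrl eps (X t)) ->
  forall t, 0 <= t <= tau -> Zf X t <= B * eps ^+ 2.
Proof.
have [B1 B10 hB1] := @growth1 R d T P M gam p D de A0 K1 T0 A de0 D0 T00.
pose a : R := 2 / de ^+ 2.
pose b : R := 2 * (B1 + 1) / de ^+ 2 + 2 * C1.
have a0 : 0 <= a by rewrite divr_ge0// ltW.
have b0 : 0 <= b.
  rewrite addr_ge0//; last by rewrite mulr_ge0.
  by rewrite divr_ge0 ?(ltW d2)// mulr_ge0// addr_ge0.
pose C := 4 * M%:R * gnorm gam * (a + b).
have C0 : 0 <= C.
  by apply: mulr_ge0; [rewrite !mulr_ge0|exact: addr_ge0].
exists ((M%:R * `|A0| + C * T0) * expR (C * T0)).
  by apply: mulr_ge0; [apply: addr_ge0; apply: mulr_ge0|exact: expR_ge0].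
move=> eps X tau ev tauT ct t tt.
have eps0 := ev_eps0 ev; have eps1 := ev_eps1 ev.
have e20 : 0 <= eps ^+ 2 by exact: sqr_ge0.
have dZ (s : R) : 0 < s < tau -> is_derive s 1 (Zf X) (\sum_(m < M) 2 *
    (pr false (offset X s m) * (cvel P gam (X s) false m - pdot false s m) +
     pr true (offset X s m) * (cvel P gam (X s) true m - pdot true s m))).
  move=> /andP[s0 st]; apply: (is_derive_Zf ev).
  by rewrite s0 (lt_le_trans st).
have g := @gronwall R (Zf X) _ C (C * eps ^+ 2) tau C0 (mulr_ge0 C0 e20)
  (continuous_Zf ev tauT) dZ _ t tt.
case/andP: (tt) => t0 tle.
apply: le_trans (g _) _; last first.
  rewrite [leRHS]mulrAC; apply: ler_pM.
  - by apply: addr_ge0; [exact: Zf_ge0|apply: mulr_ge0 => //; exact: mulr_ge0].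
  - exact: expR_ge0.
  - rewrite [leRHS]mulrDl; apply: lerD.
      rewrite /Zf; apply: le_trans (_ : \sum_(m < M) `|A0| * eps ^+ 2 <= _).
        apply: ler_sum => m _; apply: le_trans (ev_ctr ev m) _.
        by apply: ler_wpM2r => //; exact: ler_norm.
      by rewrite sumr_const card_ord -[leLHS]mulr_natl mulrA.
    rewrite [leRHS]mulrAC; apply: ler_wpM2l; first exact: mulr_ge0.
    exact: le_trans tauT.
  - by rewrite ler_expR; apply: ler_wpM2l => //; exact: le_trans tauT.
move=> s st; case/andP: (st) => s0 slt.
have sT : 0 <= s <= T0 by rewrite (ltW s0) (le_trans (ltW slt)).
have ss : 0 <= s <= tau by rewrite (ltW s0) ltW.
have cs := ct s st; have [sep tail _] := cs.
set c := Num.sqrt (Zf X s).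
have cE : Zf X s = c ^+ 2 by rewrite sqr_sqrtr// Zf_ge0.
have c0 : 0 <= c by exact: sqrtr_ge0.
rewrite cE -mulrDr.
(* The bound [B1 <= (B1 + 1)^2] replaces a square root of the constant. *)
have q l : spread P (X s) de l <= (B1 + 1) * eps.
  rewrite -ler_sqr ?nnegrE; last 2 first.
  - exact: spread_ge0.
  - by rewrite mulr_ge0 ?(ltW eps0)// addr_ge0.
  apply: le_trans (spread_sqr P de0 (ev_meas ev (ltW s0)) l) _.
  apply: le_trans (hB1 eps X tau ev tauT ct s ss) _.
  rewrite exprMn; apply: ler_wpM2r => //.
  by have := sqr_ge0 B1; rewrite sqrrD expr1n mulr1 mulr2n; lra.
have vb bb m : `|cvel P gam (X s) bb m - pdot bb s m| <= gnorm gam * (a * c + b * eps).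
  pose K := \sum_(l < M | l != m) gam l * pr bb (bs_kernel (ctr P (X s) m - ctr P (X s) l)).
  have -> : cvel P gam (X s) bb m - pdot bb s m =
     (cvel P gam (X s) bb m - K) + (K - pdot bb s m) by rewrite addrA subrK.
  apply: le_trans (ler_normD _ _) _.
  have h1 := cvel_near gam eps0 eps1 de0 (ev_meas ev (ltW s0)) (ev_dens ev (ltW s0)) sep tail bb m q.
  have h2 : `|K - pdot bb s m| <= gnorm gam * (2 * c / de ^+ 2).
    rewrite /K /pdot -sumrB; apply: le_trans (ler_norm_sum _ _ _) _.
    have cc0 : 0 <= 2 * c / de ^+ 2 by rewrite divr_ge0 ?(ltW d2)// mulr_ge0.
    apply: le_trans (_ : \sum_(l < M | l != m) `|gam l| * (2 * c / de ^+ 2) <= _).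
      apply: ler_sum => l lm; rewrite -mulrBr normrM; apply: ler_wpM2l => //.
      by apply: (kernel_offset bb sT _ cs); rewrite eq_sym.
    rewrite -mulr_suml; apply: ler_wpM2r => //.
    by rewrite /gnorm [leRHS](bigD1 m)//= lerDr.
  apply: le_trans (lerD h1 h2) _; rewrite -/C1.
  by apply: eqW; rewrite /a /b; ring.
apply: le_trans (_ : \sum_(m < M) 4 * (c * (gnorm gam * (a * c + b * eps))) <= _).
  apply: ler_sum => m _; apply: le_trans (ler_norm _) _.
  have := @speed_bound R 1 _ _ _ _ c (gnorm gam * (a * c + b * eps) / 2)
    (le_trans (pr_norm false _) (offset_le X s m)) (le_trans (pr_norm true _) (offset_le X s m)).
  move=> /(_ (cvel P gam (X s) false m - pdot false s m)
             (cvel P gam (X s) true m - pdot true s m)).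
  rewrite mul1r (mulrC 2 (_ / 2)) divfK// normr1 mul1r => /(_ (vb _ _) (vb _ _)) h.
  apply: le_trans h _; apply: eqW.
  by move: (gnorm gam * _) => u; field.
rewrite sumr_const card_ord -[leLHS]mulr_natl /C.
exact: center_arith.
Qed.

Local Notation Sum := (Sum P de).

Lemma offset_ctr_le X t m (r : R) : 0 <= r -> Zf X t <= r ^+ 2 ->
  enorm (ctr P (X t) m - p t m) <= r.
Proof.
move=> r0 h; apply: le_trans (offset_le X t m) _.
by rewrite -[leRHS](ger0_norm r0) -sqrtr_sqr ler_wsqrtr.
Qed.

(** A deviation changes by at most [4 L t], and the initial one satisfies [b <= b^2 + 1]. The square
    is kept without the indicator because its expectation is already [O(eps^2)]; the rest is
    multiplied by the small tail mass. *)
Lemma far_dev_le eps X t m z : evo eps X -> 0 <= t <= T0 ->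
  far de (dev P (X t) m z) * enorm (dev P (X t) m z) <=
  enorm (dev P (X 0) m z) ^+ (2 * 1) +
    (1 + 4 * (gnorm gam * (C1 / eps)) * T0) * far de (dev P (X t) m z).
Proof.
move=> ev /andP[t0 tT].
have h := dev_lip ev m z t0 (lexx 0).
rewrite subr0 (ger0_norm t0) in h.
have L0 : 0 <= gnorm gam * (C1 / eps).
  by rewrite mulr_ge0// divr_ge0// ltW// (ev_eps0 ev).
have h1 : 4 * (gnorm gam * (C1 / eps)) * t <= 4 * (gnorm gam * (C1 / eps)) * T0.
  by apply: ler_wpM2l => //; exact: mulr_ge0.
have h2 := ler_enormB (dev P (X t) m z) (dev P (X 0) m z).
move: (4 * _ * T0) (4 * _ * t) h h1 h2 => u v h h1 h2.
rewrite /far; case: (de <= enorm (dev P (X t) m z)); last first.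
  by rewrite mul0r mulr0 addr0 exprn_ge0// enorm_ge0.
rewrite mul1r mulr1 muln1.
move: h h1 h2; move: (enorm (dev P (X t) m z)) (enorm (dev P (X 0) m z)) (enorm _) => a b c.
by have := sqr_ge0 (b - 1); rewrite sqrrB expr1n mulr1 mulr2n; have := sqr_ge0 b; lra.
Qed.

Lemma controlled_of eps X t : evo eps X -> 0 <= t <= T0 -> 6 * eps <= de ^+ 10 ->
  Zf X t <= de ^+ 2 -> Sum X 5 t <= eps ^+ 5 -> ctrl eps (X t).
Proof.
move=> ev /[dup] tT /andP[t0 _] ed hZ hS.
have eps0 := ev_eps0 ev; have eps1 := ev_eps1 ev.
have d10 : 0 < de ^+ 10 by rewrite exprn_gt0.
have tail m : Ex P (fun z => far de (dev P (X t) m z)) <= eps ^+ 4.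
  have LT := L1_tnormX P de0 (ev_meas ev t0) (2 * 5) m.
  have LF := L1_far P de (ev_meas ev t0) m.
  (* Chebyshev at order 5. Passing from moments to weights costs a factor 6, so the tail is at most
     [6 eps^5 / de^10], and [6 eps <= de^10] turns this into [eps^4]. *)
  have h : de ^+ 10 * Ex P (fun z => far de (dev P (X t) m z)) <= moment P (X t) de 5 m.
    rewrite -(ExZl _ LF); apply: Ex_le => //; first exact: L1Zl.
    move=> z; rewrite -(sqr_far de _ 9) -exprMn; apply: lerXn2r.
    - by rewrite nnegrE mulr_ge0 ?(ltW de0)// far_ge0.
    - by rewrite nnegrE tnorm_ge0// ltW.
    - by apply: tnorm_far; exact: ltW.
  rewrite -(ler_pM2l d10); apply: le_trans h _.
  apply: le_trans (moment_le P (X t) de0 5 m) _.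
  have [h1 _] := moments_Sum de0 ev 4 t0.
  apply: le_trans h1 _.
  have h2 : 6%:R * Sum X 5 t <= 6%:R * eps ^+ 5 by exact: ler_wpM2l.
  apply: le_trans h2 _; rewrite exprS mulrA; apply: ler_wpM2r => //.
  by rewrite exprn_ge0// ltW.
split => //.
(* The vortices are [5 de] apart and each center is within [de] of its vortex, which leaves
   [3 de]. *)
- move=> m l ml; have h := p_sep tT ml.
  have e1 := offset_ctr_le m (ltW de0) hZ; have e2 := offset_ctr_le l (ltW de0) hZ.
  have h1 := enorm_chain (p t m) (ctr P (X t) m) (ctr P (X t) l) (p t l).
  by move: h h1 e1 e2; move: (enorm _) (enorm _) (enorm _) (enorm _) => a b c e; lra.
move=> m.
have [L0 E0] := ev_init ev 1 m.
have LF := L1_far P de (ev_meas ev t0) m.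
set c := 1 + 4 * (gnorm gam * (C1 / eps)) * T0.
have LR := L1D L0 (L1Zl c LF).
have LL : L1 P (fun z => far de (dev P (X t) m z) * enorm (dev P (X t) m z)).
  apply: (@L1_boundM _ _ _ _ 1 _ _ (measurable_far P de (ev_meas ev t0) m) _
    (enorm_dev_L1 (ev_meas ev t0) (ev_L1 ev t0) m)).
  by move=> z; rewrite ger0_norm ?far_le1 ?far_ge0.
apply: le_trans (Ex_le LL LR _) _; first by move=> z; exact: far_dev_le.
rewrite (ExD L0 (L1Zl c LF)) (ExZl _ LF).
have c0 : 0 <= c.
  by rewrite /c addr_ge0// !mulr_ge0// invr_ge0 ltW.
apply: le_trans (lerD E0 (ler_wpM2l c0 (tail m))) _.
have e20 : 0 <= eps ^+ 2 by exact: sqr_ge0.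
have hA : A 1 * eps ^+ (2 * 1) <= `|A 1| * eps ^+ 2.
  by rewrite muln1; apply: ler_wpM2r => //; exact: ler_norm.
have hc : c * eps ^+ 4 <= (1 + 4 * gnorm gam * C1 * T0) * eps ^+ 2.
  have -> : c * eps ^+ 4 = (eps ^+ 2 + 4 * gnorm gam * C1 * T0 * eps) * eps ^+ 2.
    by rewrite /c; field; rewrite gt_eqF.
  apply: ler_wpM2r => //; apply: lerD.
    by rewrite expr_le1// ltW.
  by apply: ler_piMr => //; rewrite !mulr_ge0.
apply: le_trans (lerD hA hc) _.
by rewrite /K1 -/C1; apply: eqW; ring.
Qed.

(* Continuity method: the first time at which the bootstrap quantity reaches 1
   would contradict the growth estimates. *)
Lemma continuity_method (W : R -> R) : {within `[0, T0], continuous W} ->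
  (forall t, 0 <= t <= T0 -> (forall s, 0 <= s < t -> W s < 1) -> W t < 1) ->
  forall t, 0 <= t <= T0 -> W t < 1.
Proof.
move=> cW step t0 t0T; rewrite ltNge; apply/negP => bad0.
pose E : set R := [set t | 0 <= t <= T0 /\ 1 <= W t].
have E0 : E t0 by [].
have lbE : lbound E 0 by move=> t [/andP[]].
have hE : has_inf E by split; [exists t0|exists 0].
pose tau := inf E.
have tau0 : 0 <= tau by apply: lb_le_inf => //; exists t0.
have tau_le t : E t -> tau <= t by move=> Et; apply: ge_inf => //; exists 0.
have tauT : tau <= T0 by apply: le_trans (tau_le _ E0) _; case/andP: t0T.
have tT : 0 <= tau <= T0 by rewrite tau0.
have Wtau : W tau < 1.
  apply: step => // s /andP[s0 st]; rewrite ltNge; apply/negP => bad.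
  have : tau <= s by apply: tau_le; split=> //; rewrite s0 (le_trans (ltW st)).
  by rewrite leNgt st.
have : \forall s \near within `[0, T0] (nbhs tau), W s < 1.
  move/subspace_continuousP : cW => /(_ tau); rewrite /= in_itv/= => /(_ tT).
  by move=> h; apply: (h [set y | y < 1]); exact: lt_nbhsl.
rewrite near_withinE => /nbhs_ballP[e /= e0 he].
have [s Es ste] := inf_adherent e0 hE.
have [sT Ws] := Es.
have : W s < 1.
  apply: he; last by rewrite /= in_itv.
  rewrite /ball /= distrC ger0_norm; last by rewrite subr_ge0; exact: tau_le.
  by rewrite ltrBlDl.
by rewrite ltNge Ws.
Qed.

(** The quantity [W = Z / de^2 + Sum_5 / eps^5] being below 1 implies [controlled]. Conversely,
    control up to time [t] yields [Z <= C eps^2] and [Sum_5 <= C eps^6], hence [W = O(eps) < 1] at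
    [t] itself. *)
Lemma bootstrap : exists2 eps1, 0 < eps1 & forall eps X, evo eps X -> eps <= eps1 ->
  forall t, 0 <= t <= T0 -> ctrl eps (X t).
Proof.
have [Bz Bz0 hBz] := growthZ.
(* The argument 2 selects order 5, with the bound [B5 * eps^6]. *)
have [B5 B50 hB5] := @growth R d T P M gam p D de A0 K1 T0 A de0 D0 K10 T00 2.
pose C := Bz / de ^+ 2 + B5 + 1.
have C0 : 0 < C.
  by rewrite /C ltr_wpDl// addr_ge0// divr_ge0// ltW.
have d10 : 0 < de ^+ 10 by rewrite exprn_gt0.
(* The first bound is the one [controlled_of] asks for; the second keeps [C * eps] at most 1/2. *)
exists (Num.min (de ^+ 10 / 6) (C^-1 / 2)).
  by rewrite lt_min !divr_gt0// invr_gt0.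
move=> eps X ev; rewrite le_min => /andP[ed eC].
have eps0 := ev_eps0 ev; have eps1 := ev_eps1 ev.
have e5 : 0 < eps ^+ 5 by rewrite exprn_gt0.
pose W (t : R) := (de ^+ 2)^-1 * Zf X t + (eps ^+ 5)^-1 * Sum X 5 t.
have ed' : 6 * eps <= de ^+ 10 by move: ed; rewrite ler_pdivlMr// mulrC.
have S0 s : 0 <= s -> 0 <= Sum X 5 s.
  move=> s0; have [h _] := moments_Sum de0 ev 4 s0.
  by rewrite -(pmulr_rge0 _ (ltr0Sn R 5)); apply: le_trans h; exact: moments_ge0.
have Wctrl s : 0 <= s <= T0 -> W s < 1 -> ctrl eps (X s).
  move=> /[dup] sT /andP[s0 _] Ws.
  have z0 : 0 <= (de ^+ 2)^-1 * Zf X s by rewrite mulr_ge0 ?Zf_ge0// invr_ge0 ltW.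
  have z1 : 0 <= (eps ^+ 5)^-1 * Sum X 5 s by rewrite mulr_ge0 ?S0// invr_ge0 ltW.
  apply: controlled_of => //.
    rewrite -[leRHS]mulr1 -ler_pdivrMl//; apply: le_trans (ltW Ws).
    by rewrite lerDl.
  rewrite -[leRHS]mulr1 -ler_pdivrMl//; apply: le_trans (ltW Ws).
  by rewrite lerDr.
move=> t tT; apply: (Wctrl t tT).
move: t tT; apply: continuity_method.
  have c1 : {within `[0, T0], continuous (Zf X)}.
    exact: (continuous_Zf ev (lexx T0)).
  have c2 : {within `[0, T0], continuous (Sum X 5)}.
    exact: (@continuous_Sum _ _ _ _ _ _ _ _ _ _ _ de0 _ _ ev 4 T0).
  move=> s; apply: cvgD; apply: cvgM; [exact: cvg_cst|exact: c1|exact: cvg_cst|exact: c2].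
move=> t /[dup] tT /andP[t0 tle] before.
have ct s : 0 < s < t -> ctrl eps (X s).
  move=> /andP[s0 st]; apply: Wctrl; first by rewrite (ltW s0) (le_trans (ltW st)).
  by apply: before; rewrite (ltW s0).
have tt : 0 <= t <= t by rewrite t0 lexx.
have hZ := hBz eps X t ev tle ct t tt.
have h5 := hB5 eps X t ev tle ct t tt.
have [_ hS] := moments_Sum de0 ev 4 t0.
have {h5}hS := le_trans hS h5.
have w1 : (de ^+ 2)^-1 * Zf X t <= Bz / de ^+ 2 * eps.
  rewrite mulrC ler_pdivrMr// mulrAC divfK ?gt_eqF//.
  apply: le_trans hZ _; apply: ler_wpM2l => //.
  by rewrite expr2; apply: ler_piMl => //; exact: ltW.
have w2 : (eps ^+ 5)^-1 * Sum X 5 t <= B5 * eps.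
  by rewrite mulrC ler_pdivrMr// -mulrA -exprS.
have w3 : C * eps <= 1 / 2.
  have Cn0 : C != 0 by rewrite gt_eqF.
  have -> : 1 / 2 = C * (C^-1 / 2) :> R by move: (C) Cn0 => c c0; field.
  by rewrite ler_pM2l.
have : W t <= (C - 1) * eps.
  by apply: le_trans (lerD w1 w2) _; rewrite /C addrK mulrDl.
move: w3 eps0; rewrite mulrBl mul1r; move: (C * eps) (W t) => u w; lra.
Qed.

Lemma confinement j : exists B eps1, [/\ 0 <= B, 0 < eps1 & forall eps X, evo eps X ->
  eps <= eps1 -> forall t, 0 <= t <= T0 ->
  mom (2 * j).+1 (X t) <= B * eps ^+ (2 * j).+2 /\ Zf X t <= B * eps ^+ 2].
Proof.
have [eps1 e10 he] := bootstrap.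
have [Bz Bz0 hBz] := growthZ.
have [Bj Bj0 hBj] := @growth R d T P M gam p D de A0 K1 T0 A de0 D0 K10 T00 j.
exists (Bz + Bj), eps1; split => //; first exact: addr_ge0.
move=> eps X ev le1 t tT.
have e0 k : 0 <= eps ^+ k by rewrite exprn_ge0// ltW// (ev_eps0 ev).
have ct s : 0 < s < T0 -> ctrl eps (X s).
  by move=> /andP[s0 sT]; apply: he => //; rewrite (ltW s0) ltW.
split.
  apply: le_trans (hBj eps X T0 ev (lexx T0) ct t tT) _.
  by apply: ler_wpM2r => //; rewrite lerDr.
apply: le_trans (hBz eps X T0 ev (lexx T0) ct t tT) _.
by apply: ler_wpM2r => //; rewrite lerDl.
Qed.

Lemma chebyshev_Ex (f : T -> R) (E : set T) (r c : R) n :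
  measurable E -> L1 P (fun z => f z ^+ n) -> 0 < r -> (forall z, 0 <= f z) ->
  (forall z, E z -> r <= f z) -> Ex P (fun z => f z ^+ n) <= c ->
  (P E <= (c / r ^+ n)%:E)%E.
Proof.
move=> mE Lf r0 f0 Ef Ec.
have L1E : L1 P (\1_E : T -> R).
  apply: (@L1_bounded _ _ _ _ 1); first exact: measurable_indic.
  by move=> z; rewrite indicE; case: (z \in E); rewrite ?normr1 ?normr0.
have PE : P E = (Ex P (\1_E))%:E.
  by rewrite (EFin_Ex L1E) integral_indic// setIT.
have rn : 0 < r ^+ n by rewrite exprn_gt0.
rewrite PE lee_fin ler_pdivlMr// mulrC -(ExZl _ L1E).
apply: le_trans Ec; apply: Ex_le => //; first exact: L1Zl.
move=> z; rewrite indicE; case: (boolP (z \in E)) => [/set_mem Ez|_].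
  by rewrite mulr1; apply: lerXn2r; rewrite ?nnegrE ?(ltW r0)//; exact: Ef.
by rewrite mulr0 exprn_ge0.
Qed.

(** The left side equals [(4^k B eps) * eps^(k (1 - 2 a))]: the spare power of [eps] absorbs the
    constants, and a large [k] makes the other exponent exceed [gamma]. *)
Lemma powR_conc (eps a B gamma : R) k : 0 < eps -> eps <= 1 ->
  4 ^+ k * B * eps <= 1 -> gamma <= k%:R * (1 - 2 * a) ->
  B * eps ^+ k.+1 / (eps `^ a / 2) ^+ (2 * k) <= eps `^ gamma.
Proof.
move=> e0 e1 hB hg.
have en0 : eps != 0 by rewrite gt_eqF.
have pa : 0 < eps `^ a by exact: powR_gt0.
have h : B * eps ^+ k.+1 / (eps `^ a / 2) ^+ (2 * k) =
    (4 ^+ k * B * eps) * (eps ^+ k / (eps `^ a) ^+ (2 * k)).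
  have p2 : (eps `^ a) ^+ (2 * k) != 0 by rewrite expf_neq0// gt_eqF.
  have t2 : (2 : R) ^+ (2 * k) != 0 by rewrite expf_neq0.
  rewrite expr_div_n invf_div exprS (_ : 4 ^+ k = 2 ^+ (2 * k)).
    by field.
  by rewrite exprM; congr (_ ^+ _); rewrite -natrX.
have hk : eps ^+ k / (eps `^ a) ^+ (2 * k) = eps `^ (k%:R * (1 - 2 * a)).
  rewrite -[eps ^+ k]powR_mulrn ?(ltW e0)//.
  rewrite -[(eps `^ a) ^+ _]powR_mulrn ?(ltW pa)// -powRrM -powRN -powRD.
    by congr (_ `^ _); rewrite natrM; ring.
  by rewrite en0 implybT.
rewrite h hk; apply: le_trans (_ : eps `^ (k%:R * (1 - 2 * a)) <= _).
  by apply: ler_piMl => //; exact: powR_ge0.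
by apply: ger_powR => //; rewrite e0.
Qed.

Theorem concentration (a gamma : R) : a < 1 / 2 -> 0 < gamma ->
  exists2 eps0, 0 < eps0 & forall eps X, evo eps X -> eps <= eps0 ->
  forall t m, 0 <= t <= T0 ->
    (P [set z | (eps `^ a <= enorm (X t m z - p t m))%R] <= (eps `^ gamma)%:E)%E.
Proof.
move=> a2 g0.
(* Raising [a] shrinks the discs, so this proves more. It ensures a positive exponent, also when [a]
   is negative, so that the radius falls below [de] for small [eps]. *)
pose a' : R := Num.max a (1 / 4).
have a'2 : a' < 1 / 2 by rewrite gt_max a2/=; lra.
have a'4 : 1 / 4 <= a' by rewrite le_max lexx orbT.
have aa' : a <= a' by rewrite le_max lexx.
have q0 : 0 < 1 - 2 * a' by lra.
pose j := Num.truncn (gamma / (1 - 2 * a')).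
have hg : gamma <= (2 * j).+1%:R * (1 - 2 * a').
  rewrite -ler_pdivrMr//.
  have /truncn_itv/andP[_ /ltW h] : 0 <= gamma / (1 - 2 * a') by rewrite divr_ge0// ltW.
  by apply: le_trans h _; rewrite ler_nat -/j ltnS leq_pmull.
have [B [eps1 [B0 e10 conf]]] := confinement j.
pose k := (2 * j).+1.
have Bp : 0 < B + 1 by rewrite ltr_wpDl.
have c4 : 0 < (4 : R) ^+ k by rewrite exprn_gt0.
(* In order: the bootstrap threshold, the offset of the center below half the radius, the radius
   below [de], and absorption of the constant in Chebyshev's inequality. *)
exists (Num.min eps1 (Num.min (4 * (B + 1) ^+ 2)^-1
   (Num.min (de ^+ 4) (4 ^+ k * (B + 1))^-1))).
  by rewrite !lt_min e10 !invr_gt0 !mulr_gt0 ?exprn_gt0.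
move=> eps X ev; rewrite !le_min => /and4P[le1 leB lede le4] t m tT.
have [hm hZ] := conf eps X ev le1 t tT.
have eps0 := ev_eps0 ev; have epsle := ev_eps1 ev.
case/andP: (tT) => t0 _.
have mX := ev_meas ev t0.
have mev : measurable [set z | (eps `^ a <= enorm (X t m z - p t m))%R].
  have ml : measurable [set z | enorm (X t m z - p t m) < eps `^ a].
    apply: measurable_lt_cst; apply: measurable_enorm.
      by apply: measurable_funB; [exact: (mX m false)|exact: measurable_cst].
    by apply: measurable_funB; [exact: (mX m true)|exact: measurable_cst].
  rewrite (_ : [set _ | _] = ~` [set z | enorm (X t m z - p t m) < eps `^ a]).
    exact: measurableC.
  by apply/seteqP; split => z /=; rewrite leNgt => /negP.
(* One half of the radius is left for the deviation from the center; the other half covers the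
   distance from the center to the vortex. *)
pose r := eps `^ a' / 2.
have r0 : 0 < r by rewrite divr_gt0// powR_gt0.
have hoff : enorm (ctr P (X t) m - p t m) <= (B + 1) * eps.
  apply: offset_ctr_le; first by rewrite mulr_ge0 ?(ltW Bp)// ltW.
  apply: le_trans hZ _; rewrite exprMn; apply: ler_wpM2r; first exact: sqr_ge0.
  by have := sqr_ge0 B; rewrite sqrrD expr1n mulr1 mulr2n; lra.
have e12 : 0 <= eps `^ (1 / 2) by exact: powR_ge0.
have sq : eps `^ (1 / 2) * eps `^ (1 / 2) = eps.
  rewrite -powRD; last by rewrite gt_eqF// implybT.
  by rewrite (_ : 1 / 2 + 1 / 2 = 1) ?powRr1 ?(ltW eps0)//; lra.
have hoff2 : (B + 1) * eps <= r.
  have h1 : eps `^ (1 / 2) <= eps `^ a' by apply: ger_powR; rewrite ?eps0// ltW.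
  have h2 : (B + 1) * eps `^ (1 / 2) <= 1 / 2.
    rewrite -ler_sqr ?nnegrE ?mulr_ge0 ?(ltW Bp)//.
    rewrite exprMn [eps `^ _ ^+ 2]expr2 sq.
    move: leB; rewrite -div1r ler_pdivlMr ?mulr_gt0 ?exprn_gt0//.
    by rewrite expr_div_n expr1n; lra.
  rewrite -[X in _ * X]sq mulrA /r mulrC.
  apply: le_trans (ler_pM e12 _ h1 h2) _; first by rewrite mulr_ge0// ltW.
  by rewrite mul1r.
have rde : r <= de.
  have h1 : eps `^ a' <= eps `^ (1 / 4) by apply: ger_powR; rewrite ?eps0.
  have h2 : eps `^ (1 / 4) <= de.
    have : eps `^ (1 / 4) <= (de ^+ 4) `^ (1 / 4).
      by apply: ge0_ler_powR => //; rewrite nnegrE ?exprn_ge0// ltW.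
    rewrite -(powR_mulrn _ (ltW de0)) -powRrM (_ : 4%:R * (1 / 4) = 1) ?powRr1 ?(ltW de0)//.
    by field.
  by rewrite /r; have := ltW de0; lra.
have hev z : eps `^ a <= enorm (X t m z - p t m) -> r <= tnorm de (dev P (X t) m z).
  move=> hz; rewrite /tnorm le_min rde andbT.
  have h1 : eps `^ a' <= eps `^ a by apply: ger_powR; rewrite ?eps0.
  have h2 := ler_enormD (dev P (X t) m z) (ctr P (X t) m - p t m).
  rewrite {1}/dev addrA subrK in h2.
  have : eps `^ a' = r + r by rewrite /r; field.
  by move: hz h1 h2 hoff hoff2; move: (eps `^ a') (eps `^ a) (enorm _) (enorm _) (enorm _) => u v x y w; lra.
apply: le_trans (_ : ((B * eps ^+ k.+1 / r ^+ (2 * k))%:E <= _)%E).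
  apply: (@chebyshev_Ex (fun z => tnorm de (dev P (X t) m z))) => //.
  - exact: (L1_tnormX P de0 mX).
  - by move=> z; rewrite tnorm_ge0// ltW.
  - by apply: le_trans hm; exact: (moment_le P (X t) de0).
rewrite lee_fin; apply: powR_conc => //.
have h1 : 4 ^+ k * (B + 1) * eps <= 1.
  by move: le4; rewrite -div1r ler_pdivlMr ?mulr_gt0// mulrC.
apply: le_trans h1; apply: ler_wpM2r; first exact: ltW.
by apply: ler_wpM2l; [exact: ltW|rewrite lerDl].
Qed.

End Concentration.

(** * The probability measure with a given density *)

Section Density.
Context {R : realType} d (T : measurableType d) (mu : {measure set T -> \bar R}).
Variable f : T -> R.
Hypothesis f0 : forall x, 0 <= f x.
Hypothesis mff : measurable_fun setT f.
Hypothesis f1 : (\int[mu]_x (f x)%:E = 1)%E.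
Import HBNNSimple.
Local Open Scope ereal_scope.

(** Both sides are limits along the same increasing simple functions, by monotone convergence, and
    on indicators the formula is the hypothesis [PE]. *)
Lemma density_integral (P : {measure set T -> \bar R}) :
  (forall A, measurable A -> P A = \int[mu]_(x in A) (f x)%:E) ->
  forall g : T -> \bar R, measurable_fun setT g -> (forall x, 0 <= g x) ->
  \int[P]_x g x = \int[mu]_x (g x * (f x)%:E).
Proof.
move=> PE g mg g0.
have mfe : measurable_fun setT (EFin \o f) by exact/measurable_EFinP.
have fe0 x : 0 <= (f x)%:E by rewrite lee_fin.
pose g_ := nnsfun_approx measurableT mg.
have g_0 n x : 0 <= (g_ n x)%:E by rewrite lee_fin.
have gcv y : (g_ n y)%:E @[n --> \oo] --> g y.
  exact: (cvg_nnsfun_approx measurableT mg (fun x _ => g0 x) (x := y) I).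
have mg_ n : measurable_fun setT (EFin \o g_ n) by exact/measurable_EFinP.
transitivity (limn (fun n => \int[P]_x (g_ n x)%:E)).
  rewrite -monotone_convergence//.
  - by apply: eq_integral => y _; apply/esym/cvg_lim => //; exact: gcv.
  - by move=> y _ m n mn; rewrite lee_fin; exact/lefP/nd_nnsfun_approx.
transitivity (limn (fun n => \int[mu]_x ((g_ n x)%:E * (f x)%:E))); last first.
  rewrite -(@monotone_convergence _ _ _ mu _ measurableT
    (fun n x => (g_ n x)%:E * (f x)%:E)); last 3 first.
  - by move=> n; exact: (emeasurable_funM (mg_ n) mfe).
  - by move=> n x _; exact: mule_ge0.
  - move=> x _ m n mn; apply: lee_wpmul2r => //.
    by rewrite lee_fin; exact/lefP/nd_nnsfun_approx.
  apply: eq_integral => y _; apply/cvg_lim => //.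
  by apply: cvgeZr => //; exact: gcv.
congr (limn _); apply/funext => n.
have mpre r : measurable (g_ n @^-1` [set r]).
  by rewrite -[X in measurable X]setTI; apply: measurable_funP.
transitivity (\sum_(r \in range (g_ n)) (r%:E * P (g_ n @^-1` [set r]))).
  under eq_integral do rewrite fimfunE -fsumEFin//.
  rewrite ge0_integral_fsum//; last 2 first.
  - by move=> y; exact/measurable_EFinP/measurable_funM.
  - by move=> y x _; rewrite nnfun_muleindic_ge0.
  by apply: eq_fsbigr => r _; rewrite integralZl_indic_nnsfun// integral_indic// setIT.
transitivity (\sum_(r \in range (g_ n))
   \int[mu]_x ((r * \1_(g_ n @^-1` [set r]) x)%:E * (f x)%:E)).
  apply: eq_fsbigr => r /set_mem[x _ rE]; rewrite PE//.
  have r0 : (0 <= r)%R by rewrite -rE.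
  under [RHS]eq_integral do rewrite EFinM -muleA.
  rewrite ge0_integralZl//; last 2 first.
  - by apply: emeasurable_funM => //; apply/measurable_EFinP; exact: measurable_indic.
  - by move=> y _; rewrite mule_ge0.
  congr (_ * _); rewrite integral_mkcond; apply: eq_integral => y _.
  by rewrite patchE indicE; case: ifPn; rewrite ?mul1e ?mul0e.
rewrite -ge0_integral_fsum//.
- apply: eq_integral => x _; rewrite -ge0_mule_fsuml.
    by congr (_ * _); rewrite fsumEFin// -fimfunE.
  by move=> r; rewrite nnfun_muleindic_ge0.
- move=> r; apply: emeasurable_funM => //.
  by apply/measurable_EFinP/measurable_funM.
- by move=> r x _; rewrite mule_ge0// nnfun_muleindic_ge0.
Qed.

Lemma density_probability : exists P : probability T R,
  forall g : T -> \bar R, measurable_fun setT g -> (forall x, 0 <= g x) ->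
  \int[P]_x g x = \int[mu]_x (g x * (f x)%:E).
Proof.
pose nu (A : set T) := \int[mu]_(x in A) (f x)%:E.
have mfe : measurable_fun setT (fun x => (f x)%:E) by exact/measurable_EFinP.
have fe0 x : 0 <= (f x)%:E by rewrite lee_fin.
have nu0 : nu set0 = 0 by exact: integral_set0.
have nuge0 A : 0 <= nu A by exact: integral_ge0.
have nusa : semi_sigma_additive nu by exact: semi_sigma_additive_nng_induced.
pose M : {measure set T -> \bar R} := HB.pack nu (isMeasure.Build _ _ _ nu nu0 nuge0 nusa).
have M1 : M setT = 1 by exact: f1.
pose P : probability T R := HB.pack nu (isMeasure.Build _ _ _ nu nu0 nuge0 nusa)
  (Measure_isProbability.Build _ _ _ M M1).
by exists P; apply: density_integral.
Qed.

End Density.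

(** * Lebesgue measure under dilations *)

Section Scaling.
Context {R : realType}.
Local Notation mu := (@lebesgue_measure R).
Variables (e : R) (e0 : 0 < e).

Let mline (c : R) : measurable_fun [set: measurableTypeR R]
  (fun x : measurableTypeR R => c + e * x : measurableTypeR R).
Proof. by apply: measurable_funD => //; apply: measurable_funM. Qed.

(** The right side is a measure in [A] with the same values on half-open intervals, so uniqueness of
    Lebesgue measure applies. *)
Lemma lebesgue_scale (c : R) (A : set (measurableTypeR R)) : measurable A ->
  mu A = (e%:E * mu [set x | A (c + e * x)%R])%E.
Proof.
move=> mA.
pose f (x : measurableTypeR R) : measurableTypeR R := c + e * x.
pose nu := mscale (NngNum (ltW e0)) (pushforward mu f).
have -> : (e%:E * mu [set x | A (c + e * x)%R])%E = nu (mline c) A by [].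
apply: lebesgue_measure_unique => // _ [[a b] _ <-]; rewrite [(a, b).1]/= [(a, b).2]/=.
have fE : f @^-1` `]a, b] = `](a - c) / e, (b - c) / e]%classic.
  apply/seteqP; split => x; rewrite /= /f !in_itv /= ltr_pdivrMr// ler_pdivlMr//;
  by rewrite ltrBlDr lerBrDr [x * e]mulrC [e * x + c]addrC.
have nuE : nu (mline c) `]a, b]%classic = (e%:E * mu [set` `](a - c) / e, (b - c) / e]%R])%E.
  by rewrite -fE.
apply: etrans (esym nuE); rewrite !lebesgue_measure_itv /= !lte_fin ltr_pM2r ?invr_gt0// ltrD2r.
case: ifP => _; last by rewrite mule0.
by rewrite !EFinN -!EFinB -EFinM; congr (_%:E); field; rewrite gt_eqF.
Qed.

Local Notation plane := (measurableTypeR R * measurableTypeR R)%type.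

Lemma measurable_affine (q : plane) : measurable_fun [set: plane]
  (fun x : plane => (q + e *: x)%R : plane).
Proof.
apply/measurable_fun_pairP; split.
  by apply: (measurableT_comp (mline q.1) measurable_fst).
by apply: (measurableT_comp (mline q.2) measurable_snd).
Qed.

(** The scaled pushforward agrees with the product measure on rectangles, by the one-dimensional
    case in each factor, and rectangles determine a product measure. *)
Lemma leb2_scale (q : plane) (A : set plane) : measurable A ->
  leb2 A = ((e ^+ 2)%:E * leb2 [set x | A (q + e *: x)%R])%E.
Proof.
move=> mA.
pose f (x : plane) : plane := (q + e *: x)%R.
pose nu := mscale (NngNum (exprn_ge0 2 (ltW e0))) (pushforward leb2 f).
have -> : ((e ^+ 2)%:E * leb2 [set x | A (q + e *: x)%R])%E = nu (measurable_affine q) A by [].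
apply: product_measure_unique => // B C mB mC.
have fE : f @^-1` (B `*` C) = [set x | B (q.1 + e * x)%R] `*`
  [set x | C (q.2 + e * x)%R] by [].
have nuE : nu (measurable_affine q) (B `*` C) = ((e ^+ 2)%:E *
    leb2 ([set x | B (q.1 + e * x)%R] `*` [set x | C (q.2 + e * x)%R]))%E.
  by rewrite -fE.
apply: etrans nuE _.
rewrite [leb2 _]product_measure1E; last 2 first.
- by rewrite -[X in measurable X]setTI; exact: mline.
- by rewrite -[X in measurable X]setTI; exact: mline.
apply: etrans (esym (congr2 mule (lebesgue_scale q.1 mB) (lebesgue_scale q.2 mC))).
by rewrite muleACA -EFinM.
Qed.
End Scaling.

(** * Change of variables for signed integrands *)

Section Transfer.
Local Open Scope ereal_scope.
Context {R : realType} d1 d2 (T1 : measurableType d1) (T2 : measurableType d2).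
Variables (m1 : {measure set T1 -> \bar R}) (m2 : {measure set T2 -> \bar R}).
Variables (j : T1 -> R) (phi : T2 -> T1) (k : T2 -> R).
Hypothesis j0 : forall x, (0 <= j x)%R.
Hypothesis k0 : forall x, (0 <= k x)%R.
Hypothesis transf : forall g : T1 -> \bar R, measurable_fun setT g ->
  (forall x, 0 <= g x) ->
  \int[m1]_x (g x * (j x)%:E) = \int[m2]_x (g (phi x) * (k x)%:E).

(** The nonnegative densities commute with positive and negative parts, so each part transfers
    separately. No integrability is involved: both sides subtract the same two extended reals. *)
Lemma integral_transfer (h : T1 -> R) : measurable_fun setT h ->
  \int[m1]_x (h x * j x)%:E = \int[m2]_x (h (phi x) * k x)%:E.
Proof.
move=> mh.
have posM (x y : R) : (0 <= y)%R -> maxe (x * y)%:E 0 = maxe x%:E 0 * y%:E.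
  move=> y0; rewrite -!EFin_max -EFinM; congr (_%:E).
  by rewrite maxr_pMl// mul0r.
have negM (x y : R) : (0 <= y)%R -> maxe (- (x * y)%:E) 0 = maxe (- x%:E) 0 * y%:E.
  by move=> y0; rewrite -!EFinN -mulNr; exact: posM.
rewrite integralE [RHS]integralE; congr (_ - _).
- transitivity (\int[m1]_x ((EFin \o h)^\+ x * (j x)%:E)).
    by apply: eq_integral => x _; rewrite !funeposE posM.
  rewrite transf//; last exact/measurable_funepos/measurable_EFinP.
  by apply: eq_integral => x _; rewrite !funeposE posM.
- transitivity (\int[m1]_x ((EFin \o h)^\- x * (j x)%:E)).
    by apply: eq_integral => x _; rewrite !funenegE negM.
  rewrite transf//; last exact/measurable_funeneg/measurable_EFinP.
  by apply: eq_integral => x _; rewrite !funenegE negM.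
Qed.

End Transfer.

(** * Borel sets of the plane and measure-preserving maps *)

Section PlaneMeasure.
Context {R : realType}.
Local Notation plane := (measurableTypeR R * measurableTypeR R)%type.

(** The sigma-algebra is the product one, so an open set is written as the countable union of the
    rational squares it contains. *)
Lemma measurable_open2 (U : set (R * R)) : open U -> measurable (U : set plane).
Proof.
move=> oU.
pose B (q : rat * rat * rat) : set plane := [set x | `|x.1 - ratr q.1.1| < ratr q.2 /\
   `|x.2 - ratr q.1.2| < ratr q.2].
have mB q : measurable (B q).
  have -> : B q = (ball (ratr q.1.1 : R) (ratr q.2)) `*` (ball (ratr q.1.2 : R) (ratr q.2)).
    by apply/seteqP; split => x /=; rewrite /B /ball /= distrC (distrC _ x.2).
  by apply: measurableX; exact: measurable_ball.
have -> : (U : set plane) = \bigcup_(q in [set q | B q `<=` U]) B q.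
  apply/seteqP; split => [x Ux|x [q /=]]; last exact.
  have [e /= e0 eU] := (@nbhs_ballP R _ x U).1 (open_nbhs_nbhs (conj oU Ux)).
  have [r] := rat_in_itvoo (divr_gt0 e0 (@ltr0n R 2)).
  rewrite in_itv /= => /andP[r0 re].
  have near (c : R) : exists s : rat, `|c - ratr s| < ratr r :> R.
    have /rat_in_itvoo[s] : c - ratr r < c + ratr r :> R.
      by rewrite ltrD2l gtrN.
    by rewrite in_itv /= => /andP[s1 s2]; exists s; rewrite ltr_norml; apply/andP; split; lra.
  have [[s1 s1E] [s2 s2E]] := (near x.1, near x.2).
  exists ((s1, s2), r) => //= y [/= y1 y2]; apply: eU.
  rewrite !ltr_norml in s1E s2E y1 y2.
  by split; rewrite /ball /= ltr_norml; apply/andP; split; lra.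
rewrite bigcup_mkcond; apply: countable_bigcupT_measurable => [|q]; first exact: countableP.
by case: ifPn.
Qed.

Lemma measurable_continuous2 (f : R * R -> R) : continuous f ->
  measurable_fun setT (f : plane -> R).
Proof.
move=> /continuousP cf; apply: (measurability _ (RGenOpens.measurableE R)).
move=> _ [_ [a [b ->] <-]]; rewrite setTI; apply: measurable_open2.
exact/cf/interval_open.
Qed.

Local Open Scope ereal_scope.

Lemma integral_measure_preserving (F : R * R -> R * R) : measure_preserving F ->
  forall g : plane -> \bar R, measurable_fun setT g -> (forall x, 0 <= g x) ->
  \int[leb2]_x g x = \int[leb2]_x g (F x).
Proof.
move=> Fp g mg g0.
have mF : measurable_fun [set: plane] (F : plane -> plane).
  by move=> _ A mA; rewrite setTI; exact: (Fp A mA).1.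
have := @ge0_integral_pushforward _ _ plane plane R F mF leb2 setT g
  measurableT mg (fun x _ => g0 x).
rewrite preimage_setT => E; apply: etrans E.
by apply: eq_measure_integral => A mA _; exact/esym/(Fp A mA).2.
Qed.

Lemma integral_leb2_scale (e : R) (q : plane) : (0 < e)%R ->
  forall g : plane -> \bar R, measurable_fun setT g -> (forall x, 0 <= g x) ->
  \int[leb2]_x g x = (e ^+ 2)%:E * \int[leb2]_x g (q + e *: x)%R.
Proof.
move=> e0 g mg g0.
have mF := measurable_affine e q.
have := @ge0_integral_pushforward _ _ plane plane R _ mF leb2 setT g
  measurableT mg (fun x _ => g0 x).
rewrite preimage_setT => E; apply: etrans (congr1 (mule _) E).
have E2 m := @ge0_integral_mscale _ plane R m setT measurableT (NngNum (exprn_ge0 2 (ltW e0)))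
  g mg (fun x _ => g0 x).
apply: etrans (E2 _).
by apply: eq_measure_integral => A mA _; exact: leb2_scale.
Qed.
End PlaneMeasure.

(** * Integrability of polynomials against the Schwartz profile *)

Section Profile.
Context {R : realType}.
Local Notation plane := (measurableTypeR R * measurableTypeR R)%type.
Variable eta : R * R -> R.
Hypothesis eta_schwartz : schwartz eta.
Hypothesis eta_ge0 : forall x, 0 <= eta x.

Lemma profile_measurable : measurable_fun [set: plane] (eta : plane -> R).
Proof.
apply: measurable_continuous2 => x; apply: differentiable_continuous.
exact: (eta_schwartz.1 [::]).
Qed.

Lemma profile_bounded : exists2 C : R, 0 <= C & forall x, eta x <= C.
Proof.
have [C CE] := eta_schwartz.2 [::] 0%N 0%N; exists C => [|x].
  exact: le_trans (normr_ge0 _) (CE 0).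
by apply: le_trans (CE x); rewrite !expr0 !mul1r ler_norm.
Qed.

Let oneDsqr_gt0 (x : R) : 0 < oneDsqr x.
Proof. exact: lt_le_trans ltr01 (oneDsqr_ge1 x). Qed.

(** The product [q * eta] stays bounded after multiplication by any monomial. The property passes to
    sums and to multiplication by coordinates, so it covers all moments. *)
Definition tame (q : R * R -> R) := forall j k : nat, exists C : R,
  forall x, `|x.1 ^+ j * x.2 ^+ k * (q x * eta x)| <= C.

Lemma tame1 : tame (fun=> 1).
Proof.
move=> j k; have [C CE] := eta_schwartz.2 [::] j k; exists C => x.
by rewrite mul1r; exact: CE.
Qed.

Lemma tameZ (c : R) q : tame q -> tame (fun x => c * q x).
Proof.
move=> tq j k; have [C CE] := tq j k; exists (`|c| * C) => x.
rewrite -[c * _ * _]mulrA mulrCA (normrM c).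
by apply: ler_wpM2l; [exact: normr_ge0|exact: CE].
Qed.

Lemma tameD q r : tame q -> tame r -> tame (fun x => q x + r x).
Proof.
move=> tq tr j k; have [C CE] := tq j k; have [D DE] := tr j k.
by exists (C + D) => x; rewrite mulrDl mulrDr (le_trans (ler_normD _ _))// lerD.
Qed.

Lemma tame_fst q : tame q -> tame (fun x => x.1 * q x).
Proof.
move=> tq j k; have [C CE] := tq j.+1 k; exists C => x.
apply: le_trans (CE x); rewrite exprS; apply: eqW.
by congr `|_|; ring.
Qed.

Lemma tame_snd q : tame q -> tame (fun x => x.2 * q x).
Proof.
move=> tq j k; have [C CE] := tq j k.+1; exists C => x.
apply: le_trans (CE x); rewrite exprS; apply: eqW.
by congr `|_|; ring.
Qed.

Lemma tame_ext q r : (forall x, q x = r x) -> tame q -> tame r.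
Proof. by move=> qr tq j k; have [C CE] := tq j k; exists C => x; rewrite -qr. Qed.

Lemma tame_normsq c q : tame q -> tame (fun x => normsq (x - c) * q x).
Proof.
move=> tq.
have t1 q' : tame q' -> tame (fun x => (x.1 - c.1) * q' x).
  move=> tq'; apply: tame_ext (tameD (tame_fst tq') (tameZ (- c.1) tq')) => x.
  by rewrite mulrDl.
have t2 q' : tame q' -> tame (fun x => (x.2 - c.2) * q' x).
  move=> tq'; apply: tame_ext (tameD (tame_snd tq') (tameZ (- c.2) tq')) => x.
  by rewrite mulrDl.
apply: tame_ext (tameD (t1 _ (t1 _ tq)) (t2 _ (t2 _ tq))) => x.
by rewrite /normsq /=; ring.
Qed.

Lemma tame_normsqX c k : tame (fun x => normsq (x - c) ^+ k).
Proof.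
elim: k => [|k IH]; first exact: tame1.
by apply: tame_ext (tame_normsq c IH) => x; rewrite exprS.
Qed.

(** Multiplication by [(1 + x_1^2) (1 + x_2^2)] keeps [q] tame, so [q * eta] is dominated by the
    inverse of that product, whose integral is [pi^2]. *)
Lemma tame_decay q : tame q -> exists2 C : R, 0 <= C & forall x,
  `|q x * eta x| <= C * ((oneDsqr x.1)^-1 * (oneDsqr x.2)^-1).
Proof.
move=> tq.
have t1 := tameD tq (tame_fst (tame_fst tq)).
have := tameD t1 (tame_snd (tame_snd t1)).
move=> /(_ 0%N 0%N)[C CE]; exists C; first exact: le_trans (normr_ge0 _) (CE 0).
move=> x; have a0 := oneDsqr_gt0 x.1; have b0 := oneDsqr_gt0 x.2.
rewrite -invfM ler_pdivlMr ?mulr_gt0//.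
rewrite -(ger0_norm (mulr_ge0 (ltW a0) (ltW b0))) -(normrM (q x * eta x)).
apply: le_trans (CE x); apply: eqW.
by congr `|_|; rewrite /oneDsqr; ring.
Qed.

Local Open Scope ereal_scope.

Lemma integral_oneDsqrV : \int[@lebesgue_measure R]_x ((oneDsqr x)^-1)%:E = pi%:E.
Proof.
rewrite ge0_symfun_integralT//=.
- rewrite (_ : [set x | _] = `[0%R, +oo[%classic); last first.
    by apply/seteqP; split => x/=; rewrite in_itv/= andbT.
  by rewrite integral0y_oneDsqr -EFinM mulrCA divff// mulr1.
- exact: continuous_oneDsqrV.
- by move=> x/=; rewrite /oneDsqr sqrrN.
Qed.

Lemma measurable_oneDsqrV : measurable_fun [set: R] (fun x : R => (oneDsqr x)^-1%R).
Proof. by apply: continuous_measurable_fun; exact: continuous_oneDsqrV. Qed.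

Lemma integral_decay :
  \int[@leb2 R]_x ((oneDsqr x.1)^-1 * (oneDsqr x.2)^-1)%R%:E = (pi ^+ 2)%:E.
Proof.
have m1 := measurable_oneDsqrV.
have o0 (x : R) : (0 <= (oneDsqr x)^-1)%R by rewrite invr_ge0 ltW// oneDsqr_gt0.
rewrite fubini_tonelli1/=; last 2 first.
- apply/measurable_EFinP/measurable_funM.
    exact: measurableT_comp m1 measurable_fst.
  exact: measurableT_comp m1 measurable_snd.
- by move=> x; rewrite lee_fin mulr_ge0.
transitivity (\int[@lebesgue_measure R]_x (pi%:E * ((oneDsqr x)^-1%R)%:E)).
  apply: eq_integral => x _; rewrite /fubini_F /=.
  under eq_integral do rewrite EFinM.
  rewrite ge0_integralZl//; last exact/measurable_EFinP.
  by rewrite integral_oneDsqrV muleC.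
rewrite ge0_integralZl//; last 2 first.
- exact/measurable_EFinP.
- by rewrite lee_fin pi_ge0.
by rewrite integral_oneDsqrV -EFinM expr2.
Qed.

Variable P : probability plane R.
Hypothesis dP : forall g : plane -> \bar R, measurable_fun setT g ->
  (forall x, 0 <= g x) -> \int[P]_x g x = \int[leb2]_x (g x * (eta x)%:E).

Lemma tame_L1 q : mf (q : plane -> R) -> tame q -> L1 P q.
Proof.
move=> mq tq; have [C C0 CE] := tame_decay tq.
have mh : measurable_fun [set: plane] (fun x : plane => ((oneDsqr x.1)^-1 * (oneDsqr x.2)^-1)%R%:E).
  apply/measurable_EFinP/measurable_funM.
    exact: measurableT_comp measurable_oneDsqrV measurable_fst.
  exact: measurableT_comp measurable_oneDsqrV measurable_snd.
apply/integrableP; split; first exact/measurable_EFinP.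
rewrite dP//; last by apply/measurable_EFinP/measurableT_comp.
apply: (@le_lt_trans _ _ (\int[leb2]_x
   (C%:E * ((oneDsqr x.1)^-1 * (oneDsqr x.2)^-1)%R%:E))).
  apply: ge0_le_integral => //.
  - by move=> x _; rewrite mule_ge0 // lee_fin.
  - apply: emeasurable_funM; apply/measurable_EFinP; last exact: profile_measurable.
    exact: measurableT_comp.
  - exact: measurable_funeM.
  - move=> x _; rewrite -!EFinM lee_fin; apply: le_trans (CE x).
    by rewrite normrM (ger0_norm (eta_ge0 x)).
rewrite ge0_integralZl//.
by rewrite integral_decay -EFinM ltry.
Qed.

Lemma profile_le (C : R) (A : set plane) : (forall x, eta x <= C)%R -> measurable A ->
  P A <= C%:E * leb2 A.
Proof.
move=> etaC mA.
have C0 : (0 <= C)%R := le_trans (eta_ge0 (0, 0)%R) (etaC (0, 0)%R).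
rewrite -[A]setIT -integral_indic// dP; last 2 first.
- by apply/measurable_EFinP; exact: measurable_indic.
- by move=> x; rewrite lee_fin.
have mA1 : measurable_fun [set: plane] (fun x => (\1_A x : R)%:E).
  by apply/measurable_EFinP; exact: measurable_indic.
apply: (@le_trans _ _ (\int[leb2]_x (C%:E * (\1_A x)%:E))); last first.
  by rewrite ge0_integralZl ?lee_fin// integral_indic// setIT.
apply: ge0_le_integral => //.
- by move=> x _; rewrite mule_ge0 // lee_fin.
- apply: emeasurable_funM => //; apply/measurable_EFinP; exact: profile_measurable.
- exact: measurable_funeM.
- by move=> x _; rewrite -!EFinM lee_fin [X in (X <= _)%R]mulrC ler_wpM2r.
Qed.
End Profile.

(** * From one-sided velocities to derivatives and Lipschitz bounds *)

Section Velocity.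
Context {R : realType}.
Implicit Types (c : R -> R * R) (t : R) (v : R * R).

Lemma has_velocity_dist c t v b : has_velocity c t v -> forall e : R, 0 < e ->
  exists2 d : R, 0 < d & forall s, 0 <= s -> s != t -> `|s - t| < d ->
    `|pr b v - (s - t)^-1 * (pr b (c s) - pr b (c t))| < e.
Proof.
move=> hv e e0.
have /cvg_ballP/(_ e e0) := hv.
rewrite /within /= !near_withinE => /nbhs_ballP[d /= d0 dE].
exists d => // s s0 st sd.
have [] := dE s _ st s0; first by rewrite /ball /= distrC.
by rewrite /ball /= /pr; case: b.
Qed.

Lemma has_velocity_derive c t v b : has_velocity c t v -> 0 < t ->
  is_derive t 1 (fun s => pr b (c s)) (pr b v).
Proof.
move=> hv t0; apply: is_deriveI; apply/cvgrPdist_lt => e e0.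
have [d d0 dE] := has_velocity_dist b hv e0.
have dt0 : 0 < Num.min d t by rewrite lt_min d0.
rewrite near_withinE; apply/nbhs_ballP; exists (Num.min d t) => //= h.
rewrite /ball /= sub0r normrN lt_min => /andP[hd ht] h0.
have := dE (h + t); rewrite addrK; apply => //.
- by move: ht; rewrite ltr_norml => /andP[ht _]; rewrite -lerBlDr sub0r ltW.
- by rewrite -subr_eq0 addrK.
Qed.

Lemma has_velocity_cvg c t v b : has_velocity c t v -> 0 <= t ->
  forall e : R, 0 < e -> exists2 d : R, 0 < d & forall s, 0 <= s -> `|s - t| < d ->
    `|pr b (c s) - pr b (c t)| <= e.
Proof.
move=> hv t0 e e0; have [d d0 dE] := has_velocity_dist b hv ltr01.
have K0 : 0 < `|pr b v| + 1 by rewrite ltr_wpDl.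
exists (Num.min d (e / (`|pr b v| + 1))); first by rewrite lt_min d0 divr_gt0.
move=> s s0; rewrite lt_min => /andP[sd se].
have [->|st] := eqVneq s t; first by rewrite subrr normr0 ltW.
have st0 : 0 < `|s - t| by rewrite normr_gt0 subr_eq0.
have := ltW (dE s s0 st sd); set q := pr b (c s) - _ => h.
have {h} h : `|(s - t)^-1 * q| <= `|pr b v| + 1.
  rewrite -lerBlDl; apply: le_trans (h); rewrite -[X in _ <= X]normrN opprB.
  exact: lerB_dist.
have : `|q| <= (`|pr b v| + 1) * `|s - t|.
  by rewrite -ler_pdivrMr// mulrC -normfV -(normrM (s - t)^-1).
move=> /le_trans; apply; rewrite mulrC -ler_pdivlMr//; exact: ltW.
Qed.

Lemma has_velocity_within c (v : R -> R * R) (tau : R) b :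
  (forall t, 0 <= t <= tau -> has_velocity c t (v t)) ->
  {within `[0, tau], continuous (fun s => pr b (c s))}.
Proof.
move=> hv; apply/subspace_continuousP => x /=; rewrite in_itv/= => x0T.
have x0 : 0 <= x by case/andP: x0T.
apply/cvgrPdist_le => e e0.
have [d d0 dE] := has_velocity_cvg b (hv x x0T) x0 e0.
rewrite near_withinE; apply/nbhs_ballP; exists d => //= s.
rewrite /ball /= in_itv /= => xs /andP[s0 _].
by rewrite distrC; apply: dE => //; rewrite distrC.
Qed.

(** The mean value theorem on [[s, t]]: interior points are positive times, where the velocity is a
    two-sided derivative, and continuity extends to [s = 0]. *)
Lemma has_velocity_lipschitz c (v : R -> R * R) b (K : R) :
  (forall t, 0 <= t -> has_velocity c t (v t)) ->
  (forall t, 0 < t -> `|pr b (v t)| <= K) ->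
  forall s t, 0 <= s -> 0 <= t -> `|pr b (c s) - pr b (c t)| <= K * `|s - t|.
Proof.
move=> hv vK s t; wlog st : s t / s <= t.
  move=> H s0 t0; case: (leP s t) => [st|/ltW ts]; first exact: H.
  by rewrite distrC (distrC s); exact: H.
move=> s0 t0; move: st; rewrite le_eqVlt => /predU1P[->|st].
  by rewrite !subrr !normr0 mulr0.
have vd x : x \in `]s, t[%R -> is_derive x 1 (fun s => pr b (c s)) (pr b (v x)).
  rewrite in_itv/= => /andP[sx _]; have x0 := le_lt_trans s0 sx.
  exact: has_velocity_derive (hv x (ltW x0)) x0.
have cw : {within `[s, t], continuous (fun s => pr b (c s))}.
  apply: (@continuous_subspaceW _ _ _ `[0, t]).
    by apply: subset_itvr; rewrite bnd_simp.
  by apply: (has_velocity_within (v := v)) => y /andP[y0 _]; exact: hv.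
have [y yst yE] := MVT st vd cw.
rewrite distrC yE (normrM (pr b (v y))) distrC; apply: ler_wpM2r => //; apply: vK.
by move: yst; rewrite in_itv/= => /andP[sy _]; exact: le_lt_trans sy.
Qed.

End Velocity.

Lemma normsqZ {R : realType} (c : R) (x : R * R) : normsq (c *: x) = c ^+ 2 * normsq x.
Proof. by rewrite /normsq [RHS]mulrDr -!exprMn. Qed.

(** * From the Yudovich solution to the moment argument *)

Section Trajectories.
Context {R : realType}.
Local Notation plane := (measurableTypeR R * measurableTypeR R)%type.
Variables (M : nat) (gam : 'I_M -> R) (p0 : 'I_M -> R * R).
Variable eta : R * R -> R.
Hypothesis eta_schwartz : schwartz eta.
Hypothesis eta_ge0 : forall x, 0 <= eta x.
Variable P : probability plane R.
Hypothesis dP : forall g : plane -> \bar R, measurable_fun setT g ->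
  (forall x, (0 <= g x)%E) ->
  (\int[P]_x g x = \int[leb2]_x (g x * (eta x)%:E))%E.
Variable eps : R.
Hypothesis eps0 : 0 < eps.

Definition blob (m : 'I_M) (x : R * R) : R :=
  (eps ^+ 2)^-1 * eta (eps^-1 *: (x - p0 m)).

Definition blow (m : 'I_M) (z : plane) : plane := (p0 m + eps *: z)%R.

Lemma measurable_blow m : measurable_fun [set: plane] (blow m).
Proof. exact: measurable_affine. Qed.

Lemma measurable_blob m : measurable_fun [set: plane] (blob m : plane -> R).
Proof.
apply: measurable_funM => //.
have := measurable_affine eps^-1 (- (eps^-1 *: p0 m) : plane).
move=> /(measurableT_comp (profile_measurable eta_schwartz)).
congr (measurable_fun _ _); apply/funext => x /=.
by rewrite scalerBr addrC.
Qed.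

Lemma blob_ge0 m x : 0 <= blob m x.
Proof. by rewrite mulr_ge0 // invr_ge0 exprn_ge0// ltW. Qed.

(** The substitution [x = p_m^0 + eps z] produces the area factor [eps^2], which cancels the
    normalization of the blob. *)
Lemma integral_blob m (g : plane -> \bar R) : measurable_fun setT g ->
  (forall x, (0 <= g x)%E) ->
  (\int[leb2]_x (g x * (blob m x)%:E) = \int[P]_z (g (blow m z)))%E.
Proof.
move=> mg g0.
have mb : measurable_fun setT (fun x : plane => (blob m x)%:E).
  by apply/measurable_EFinP; exact: measurable_blob.
have mgb : measurable_fun setT (g \o blow m) by exact: measurableT_comp (measurable_blow m).
rewrite (integral_leb2_scale (p0 m) eps0); last 2 first.
- exact: emeasurable_funM.
- by move=> x; rewrite mule_ge0 // lee_fin blob_ge0.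
rewrite dP//.
rewrite -ge0_integralZl//; last 3 first.
- apply: emeasurable_funM => //; exact: (measurableT_comp mb (measurable_blow m)).
- by move=> x _; rewrite mule_ge0 // lee_fin blob_ge0.
- by rewrite lee_fin exprn_ge0// ltW.
apply: eq_integral => x _ /=.
rewrite muleCA -EFinM /blob mulrA mulfV ?mul1r ?expf_neq0 ?gt_eqF//.
by rewrite /blow [(p0 m + _)%R]addrC addrK scalerA mulVf ?scale1r// gt_eqF.
Qed.

Variables (w : R -> R * R -> R) (F : R -> R * R -> R * R).
Hypothesis w_measurable : measurable_fun ([set z | 0 <= z.2] : set (R * R * R))
  (fun z : R * R * R => w z.2 z.1).
Hypothesis F_flow : is_flow (fun t => biot_savart (w t)) F.
Hypothesis F_preserving : forall t, 0 <= t -> measure_preserving (F t).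
Hypothesis F_transport : forall t, 0 <= t ->
  {ae leb2, forall x, w t (F t x) = initial_vorticity gam p0 eta eps x}.

Let F0 x : F 0 x = x. Proof. by case: F_flow. Qed.

Lemma measurable_flow t : 0 <= t -> measurable_fun [set: plane] (F t : plane -> plane).
Proof. by move=> t0 _ A mA; rewrite setTI; exact: (F_preserving t0 mA).1. Qed.

Lemma measurable_vorticity t : 0 <= t -> measurable_fun [set: plane] (w t : plane -> R).
Proof.
move=> t0; pose E : set (plane * measurableTypeR R) := [set z | 0 <= z.2].
have mE : measurable E.
  have -> : E = setT `&` snd @^-1` `[0, +oo[%classic.
    by rewrite setTI; apply/seteqP; split => z /=; rewrite in_itv/= andbT.
  exact: measurable_snd.
have := @measurable_comp _ _ _ plane (plane * measurableTypeR R)%type R E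
  (fun z => w z.2 z.1) setT (fun x => (x, t)) mE.
apply; last exact: measurable_fun_pair.
- by move=> _ /= [x _ <-].
- exact: w_measurable.
Qed.

Lemma initial_vorticityE x : initial_vorticity gam p0 eta eps x = \sum_(m < M) gam m * blob m x.
Proof. by apply: eq_bigr => m _; rewrite mulrA. Qed.

Definition trajectory t m z := F t (blow m z).

Lemma measurable_trajectory t : 0 <= t -> forall m b, mf (fun z : plane => pr b (trajectory t m z)).
Proof.
move=> t0 m b.
have := measurableT_comp (measurable_flow t0) (measurable_blow m).
move=> h; case: b.
  exact: measurableT_comp measurable_snd h.
exact: measurableT_comp measurable_fst h.
Qed.

(** The flow preserves area and [blow] contracts it by [eps^2], so a square of half-side [s] pulls
    back to a set of area [4 s^2 / eps^2], on which [eta <= C]. *)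
Lemma trajectory_density (C : R) t m : (forall x, eta x <= C) -> 0 <= t ->
  box_density P (trajectory t m) (4 * C / eps ^+ 2).
Proof.
move=> etaC t0 x s s0.
pose B : set plane := ball x.1 s `*` ball x.2 s.
have mB : measurable B by apply: measurableX; exact: measurable_ball.
set A := [set z | _].
have AE : A = [set z | (F t @^-1` B) (blow m z)].
  by apply/seteqP; split => z; rewrite /A /B /= /ball /= distrC (distrC _ x.2).
have [mFB FB] := F_preserving t0 mB.
have mA : measurable A.
  by rewrite AE -[X in measurable X]setTI; exact: measurable_blow.
have leb2A : ((eps ^+ 2)%:E * leb2 A)%E = (4 * s ^+ 2)%:E.
  rewrite AE -(leb2_scale eps0 (p0 m) mFB) FB.
  rewrite [leb2 _]product_measure1E; try exact: measurable_ball.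
  apply: etrans (congr2 mule (lebesgue_measure_ball x.1 (ltW s0)) (lebesgue_measure_ball x.2 (ltW s0))) _.
  by rewrite -EFinM; congr (_%:E); ring.
apply: le_trans (profile_le eta_schwartz eta_ge0 dP etaC mA) _.
move: (leb2 A) leb2A => L LE.
have -> : L = ((eps ^+ 2)^-1 * (4 * s ^+ 2))%:E.
  by rewrite EFinM -LE muleA -EFinM mulVf ?mul1e// expf_neq0// gt_eqF.
rewrite -EFinM lee_fin; apply: eqW.
by field; rewrite gt_eqF.
Qed.

(** The Biot-Savart integral is pulled back by the flow; there the vorticity equals its initial
    value almost everywhere, which splits into blobs, and each blob is rescaled to [P].
    Integrability of every piece, needed to split the sum, comes from the density bound. *)
Lemma velocity_identity (D : R) t m b (z : plane) :
  (forall l, box_density P (trajectory t l) (D / eps ^+ 2)) -> 0 <= t ->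
  pr b (biot_savart (w t) (trajectory t m z)) = vel P gam (trajectory t) b m z.
Proof.
move=> dens t0; set x := trajectory t m z.
have kL l : L1 P (fun z' : plane => pr b (bs_kernel (x - trajectory t l z'))).
  exact: (kernel_L1 (measurable_trajectory t0) dens).
pose K (y : plane) : R := pr b (bs_kernel (x - y)).
have mK : measurable_fun [set: plane] K.
  have m1 : measurable_fun [set: plane] (fun y : plane => (x - y).1).
    by apply: measurable_funB => //; exact: measurable_fst.
  have m2 : measurable_fun [set: plane] (fun y : plane => (x - y).2).
    by apply: measurable_funB => //; exact: measurable_snd.
  by rewrite /K; case: (b); [exact: (measurable_kernel2 m1 m2)|exact: (measurable_kernel1 m1 m2)].
have mKF : measurable_fun [set: plane] (K \o F t : plane -> R).
  exact: measurableT_comp mK (measurable_flow t0).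
have -> : pr b (biot_savart (w t) x) = fine (\int[leb2]_y (K y * w t y)%:E)%E.
  by rewrite /K; case: (b).
have mb l : measurable_fun [set: plane] (fun y : plane => K (F t y) * blob l y).
  by apply: measurable_funM => //; exact: measurable_blob.
have blobI l : (\int[leb2]_y (K (F t y) * blob l y)%:E = (ext P (trajectory t) b m l z)%:E)%E.
  rewrite (EFin_Ex (kL l)).
  have tr g : measurable_fun setT g -> (forall x, (0 <= g x)%E) ->
      (\int[leb2]_x (g x * (blob l x)%:E) = \int[P]_z (g (blow l z) * (1%R)%:E))%E.
    by move=> mg g0; rewrite integral_blob//; apply: eq_integral => y _; rewrite mule1.
  have E := @integral_transfer R _ _ plane plane leb2 P (blob l) (blow l) (fun=> 1)
    (blob_ge0 l) (fun=> ler01) tr _ mKF.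
  apply: etrans E _.
  by apply: eq_integral => y _ /=; rewrite mulr1.
have blobL l : leb2.-integrable setT (fun y : plane => (K (F t y) * blob l y)%:E).
  apply/integrableP; split; first by apply/measurable_EFinP; exact: mb.
  rewrite (_ : (\int[_]_y _)%E = (\int[leb2]_y (`|K (F t y)|%:E * (blob l y)%:E))%E); last first.
    by apply: eq_integral => y _; rewrite /= -EFinM (normrM (K _)) (ger0_norm (blob_ge0 l y)).
  rewrite (@integral_blob l (fun y => `|K (F t y)|%:E))//; last first.
    by apply/measurable_EFinP; exact: measurableT_comp mKF.
  by have /integrableP[_] := kL l.
transitivity (fine (\int[leb2]_y (K (F t y) * w t (F t y))%:E)%E).
  congr fine.
  have tr (g : plane -> \bar R) : measurable_fun setT g -> (forall x, (0 <= g x)%E) ->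
      (\int[leb2]_x (g x * (1%R)%:E) = \int[leb2]_x (g (F t x) * (1%R)%:E))%E.
    move=> mg g0; under eq_integral do rewrite mule1.
    under [RHS]eq_integral do rewrite mule1.
    exact: integral_measure_preserving (F_preserving t0) _ mg g0.
  have mKw : measurable_fun [set: plane] (fun y : plane => K y * w t y).
    by apply: measurable_funM => //; exact: measurable_vorticity.
  have := @integral_transfer R _ _ plane plane leb2 leb2 (fun=> 1) (F t) (fun=> 1)
    (fun=> ler01) (fun=> ler01) tr _ mKw.
  under eq_integral do rewrite mulr1.
  by under [RHS]eq_integral do rewrite mulr1.
have -> : (\int[leb2]_y (K (F t y) * w t (F t y))%:E =
    \int[leb2]_y \sum_(l < M) ((gam l)%:E * (K (F t y) * blob l y)%:E))%E.
  apply: ae_eq_integral => //.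
  - apply/measurable_EFinP; apply: measurable_funM => //.
    exact: measurableT_comp (measurable_vorticity t0) (measurable_flow t0).
  - apply: emeasurable_sum => l; apply: measurable_funeM.
    by apply/measurable_EFinP; exact: mb.
  - have [N [mN N0 sN]] := F_transport t0; exists N; split => // y yN.
    apply: sN => wE; apply: yN => _; rewrite /= wE initial_vorticityE.
    rewrite mulr_sumr -sumEFin; apply: eq_bigr => l _.
    by rewrite -EFinM; congr (_%:E); ring.
rewrite integral_sum//; last by move=> l; exact: integrableZl.
rewrite /vel (eq_bigr (fun l => (gam l * ext P (trajectory t) b m l z)%:E)); last first.
  by move=> l _; rewrite integralZl// blobI -EFinM.
by rewrite sumEFin.
Qed.

Let mean : R * R := (Ex P (fun z => z.1), Ex P (fun z => z.2)).

Lemma profile_L1 b : L1 P (pr b : plane -> R).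
Proof.
apply: (tame_L1 eta_schwartz eta_ge0 dP).
  by case: b; [exact: measurable_snd|exact: measurable_fst].
by case: b; [have := tame_snd (tame1 eta_schwartz)|have := tame_fst (tame1 eta_schwartz)];
  apply: tame_ext => x; rewrite mulr1.
Qed.

Lemma trajectory0 m z : trajectory 0 m z = blow m z.
Proof. exact: F0. Qed.

Lemma pr_blow b m z : pr b (blow m z) = pr b (p0 m) + eps * pr b z.
Proof. by case: b. Qed.

(** The profile need not be centered, so a center of mass starts at distance [eps |mean|] from its
    vortex; this is the source of the constant [A0]. *)
Lemma ctr_trajectory0 m : ctr P (trajectory 0) m = p0 m + eps *: mean.
Proof.
have h b : Ex P (fun z => pr b (trajectory 0 m z)) = pr b (p0 m) + eps * Ex P (pr b : plane -> R).
  under eq_Ex do rewrite trajectory0 pr_blow.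
  rewrite (ExD (L1_cst P _) (L1Zl eps (profile_L1 b))) Ex_cst ExZl//.
  exact: profile_L1.
by rewrite /ctr (h false) (h true).
Qed.

Lemma dev_trajectory0 m z k : enorm (dev P (trajectory 0) m z) ^+ (2 * k) =
  eps ^+ (2 * k) * normsq (z - mean) ^+ k.
Proof.
rewrite !exprM sqr_enorm -exprMn; congr (_ ^+ k).
rewrite /dev ctr_trajectory0 trajectory0 /blow opprD addrACA subrr add0r.
by rewrite -scalerBr normsqZ.
Qed.

Lemma moment_L1 k : L1 P (fun z : plane => normsq (z - mean) ^+ k).
Proof.
apply: (tame_L1 eta_schwartz eta_ge0 dP); last exact: tame_normsqX.
apply: measurable_funX; apply: measurable_normsq; exact: measurable_funB.
Qed.

Lemma trajectory_evolution (C : R) (p : R -> 'I_M -> R * R) :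
  (forall x, eta x <= C) -> eps <= 1 -> (forall m, p 0 m = p0 m) ->
  evolution P gam p (4 * C) (normsq mean)
    (fun k => Ex P (fun z : plane => normsq (z - mean) ^+ k)) eps trajectory.
Proof.
move=> etaC eps1 pE.
have dens t m : 0 <= t -> box_density P (trajectory t m) (4 * C / eps ^+ 2).
  exact: trajectory_density.
have Fv t x : 0 <= t -> has_velocity (F ^~ x) t (biot_savart (w t) (F t x)).
  by case: F_flow => _ Fv _; exact: Fv.
have velE t m b z : 0 <= t ->
    pr b (biot_savart (w t) (trajectory t m z)) = vel P gam (trajectory t) b m z.
  by move=> t0; apply: velocity_identity => // l; exact: dens.
have lip s t : 0 <= s -> 0 <= t -> forall m b z,
    `|pr b (trajectory s m z) - pr b (trajectory t m z)| <=
    gnorm gam * ((1 + 4 * (4 * C)) / eps) * `|s - t|.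
  move=> s0 t0 m b z.
  apply: (@has_velocity_lipschitz _ (F ^~ (blow m z))
    (fun t => biot_savart (w t) (trajectory t m z)) b) => //.
    by move=> t' t'0; exact: Fv.
  move=> t' t'0; rewrite (velE t' m b z (ltW t'0)).
  apply: le_trans (ler_norm_sum _ _ _) _.
  rewrite /gnorm mulr_suml; apply: ler_sum => l _; rewrite (normrM (gam l)).
  apply: ler_wpM2l => //; apply: ext_le => //.
    exact: measurable_trajectory (ltW t'0).
  by move=> m'; exact: dens (ltW t'0).
have L0 m b : L1 P (fun z : plane => pr b (trajectory 0 m z)).
  apply: eq_L1 (L1D (L1_cst P (pr b (p0 m))) (L1Zl eps (profile_L1 b))) => z.
  by rewrite trajectory0 pr_blow.
split => //.
- exact: measurable_trajectory.
- move=> t t0 m b; apply: L1_le (L1D (L1_norm (L0 m b)) (L1_cst P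
    (gnorm gam * ((1 + 4 * (4 * C)) / eps) * `|t - 0|))) _.
    exact: measurable_trajectory.
  move=> z /=; rewrite -lerBlDl; apply: le_trans (lip t 0 t0 (lexx 0) m b z).
  exact: lerB_dist.
- by move=> t t0 m; exact: dens.
- move=> t t0 m b z; rewrite -(velE t m b z (ltW t0)).
  exact: has_velocity_derive (Fv t (blow m z) (ltW t0)) t0.
- move=> k m; have E : (fun z => enorm (dev P (trajectory 0) m z) ^+ (2 * k)) =
     (fun z : plane => eps ^+ (2 * k) * normsq (z - mean) ^+ k).
    by apply/funext => z; exact: dev_trajectory0.
  rewrite E; split; first by apply: L1Zl; exact: moment_L1.
  by rewrite ExZl; [rewrite mulrC|exact: moment_L1].
- move=> m; rewrite ctr_trajectory0 pE addrC addKr normsqZ.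
  by rewrite mulrC.
Qed.

Lemma measurable_trajectory_preimage t m (B : set plane) : 0 <= t ->
  measurable B -> measurable [set z | B (trajectory t m z)].
Proof.
move=> t0 mB; rewrite -[X in measurable X]setTI.
exact: (measurableT_comp (measurable_flow t0) (measurable_blow m)).
Qed.

(** After pulling back by the flow, the triangle inequality over the blobs discards cancellations
    between vortices of opposite sign. *)
Lemma escaping_mass (B : set plane) t : measurable B -> 0 <= t ->
  (\int[leb2]_(x in B) `|w t x|%:E <=
   \sum_(m < M) (`|gam m|%:E * P [set z | B (trajectory t m z)]))%E.
Proof.
move=> mB t0.
have mw : measurable_fun [set: plane] (fun x : plane => `|w t x|%:E).
  by apply/measurable_EFinP; apply: measurableT_comp => //; exact: measurable_vorticity.
pose g := (fun x : plane => `|w t x|%:E) \_ B.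
have mg : measurable_fun [set: plane] g.
  by apply/(measurable_restrictT _ mB); exact: (measurable_funS measurableT (@subsetT _ B) mw).
have g0 x : (0 <= g x)%E by rewrite /g patchE; case: ifP.
have mBF : measurable_fun [set: plane] (fun x => (\1_B (F t x) : R)%:E).
  apply/measurable_EFinP; apply: (measurableT_comp (measurable_indic mB)).
  exact: measurable_flow.
have mgF : measurable_fun [set: plane] (g \o F t : plane -> \bar R).
  exact: measurableT_comp mg (measurable_flow t0).
have mblob m : measurable_fun [set: plane] (fun y : plane => (blob m y)%:E).
  by apply/measurable_EFinP; exact: measurable_blob.
have mh m : measurable_fun [set: plane]
    (fun y : plane => (`|gam m|%:E * ((\1_B (F t y) : R)%:E * (blob m y)%:E))%E).
  by apply: measurable_funeM; exact: emeasurable_funM.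
have b0 m y : (0 <= (blob m y)%:E)%E by rewrite lee_fin blob_ge0.
rewrite integral_mkcond (integral_measure_preserving (F_preserving t0) mg g0).
apply: (@le_trans _ _ (\int[leb2]_y \sum_(m < M)
    (`|gam m|%:E * ((\1_B (F t y) : R)%:E * (blob m y)%:E)))%E).
  apply: ae_ge0_le_integral => //.
  - by move=> x _; apply: sume_ge0 => m _; rewrite !mule_ge0.
  - exact: emeasurable_sum.
  - have [N [mN N0 sN]] := F_transport t0; exists N; split => // y yN.
    apply: sN => wE; apply: yN => _; rewrite /g patchE indicE.
    case: ifP => _; last by apply: sume_ge0 => m _; rewrite !mule_ge0.
    rewrite /= wE initial_vorticityE.
    rewrite (eq_bigr (fun m => (`|gam m| * blob m y)%:E)); last first.
      by move=> m _; rewrite mul1e EFinM.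
    rewrite sumEFin lee_fin; apply: le_trans (ler_norm_sum _ _ _) _.
    by apply: ler_sum => m _; rewrite (normrM (gam m)) (ger0_norm (blob_ge0 m y)).
rewrite ge0_integral_sum//; last by move=> m y _; rewrite !mule_ge0.
apply: lee_sum => m _; rewrite ge0_integralZl//; last 2 first.
- exact: emeasurable_funM.
- by move=> y _; rewrite mule_ge0.
apply: lee_wpmul2l => //.
rewrite (@integral_blob m (fun y => (\1_B (F t y) : R)%:E))//.
rewrite -[X in (_ <= P X)%E]setIT -integral_indic//.
exact: measurable_trajectory_preimage.
Qed.

End Trajectories.

Lemma pr_scale_sum {R : realType} b (I : Type) (r : seq I) (Q : pred I) (a : I -> R)
    (v : I -> R * R) :
  pr b (\sum_(i <- r | Q i) a i *: v i) = \sum_(i <- r | Q i) a i * pr b (v i).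
Proof.
have prD (x y : R * R) : pr b (x + y) = pr b x + pr b y by case: (b).
have pr0 : pr b (0 : R * R) = 0 by case: (b).
by rewrite (big_morph _ prD pr0); apply: eq_bigr => i _; case: b {prD pr0}.
Qed.

(** For each pair the squared distance is continuous on the compact interval and attains a positive
    minimum; there are finitely many pairs. *)
Lemma uniform_separation {R : realType} (M : nat) (p : R -> 'I_M -> R * R) (T : R) :
  0 <= T ->
  (forall m b, {within `[0, T], continuous (fun s => pr b (p s m))}) ->
  (forall t m l, 0 <= t <= T -> m != l -> p t m <> p t l) ->
  exists2 de : R, 0 < de &
    forall t m l, 0 <= t <= T -> m != l -> de <= enorm (p t m - p t l).
Proof.
move=> T0 pc pn.
have pair (ml : 'I_M * 'I_M) : exists d : R, 0 < d /\
    (ml.1 != ml.2 -> forall t, 0 <= t <= T -> d <= enorm (p t ml.1 - p t ml.2)).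
  case: ml => m l /=; have [->|ml] := eqVneq m l; first by exists 1.
  have cf : {within `[0, T], continuous (fun s =>
      normsq (pr false (p s m) - pr false (p s l), pr true (p s m) - pr true (p s l)))}.
    by apply: within_continuous_normsq => s; apply: cvgB;
      [exact: (@pc m false)|exact: (@pc l false)|exact: (@pc m true)|exact: (@pc l true)].
  have [c cT cmin] := EVT_min T0 cf.
  have c0T : 0 <= c <= T by move: cT; rewrite in_itv.
  exists (enorm (p c m - p c l)); split.
    rewrite lt_neqAle enorm_ge0 andbT eq_sym; apply/negP => /eqP/enorm_eq0/eqP.
    by rewrite subr_eq0 => /eqP; exact: pn.
  move=> _ t t0T; rewrite /enorm ler_sqrt; last exact: normsq_ge0.
  by apply: cmin; rewrite in_itv.
have [d dE] := choice pair.
(* The initial value 1 keeps the minimum positive and also covers an empty family. *)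
exists (\big[Num.min/1]_ml d ml).
  by apply/bigmin_gtP; split=> // ml _; have [] := dE ml.
move=> t m l t0T ml; apply: (@le_trans _ _ (d (m, l))); first exact: bigmin_le.
by have [_ /(_ ml t t0T)] := dE (m, l).
Qed.

Theorem corollary1p7 (R : realType) (M : nat)
  (gam : 'I_M -> R) (hgam : forall m, gam m != 0)
  (p0 : 'I_M -> R * R) (hp0 : injective p0)
  (Tstar : \bar R) (p : R -> 'I_M -> R * R)
  (hp : maximal_helmholtz gam p0 Tstar p)
  (eta : R * R -> R) (heta_schwartz : schwartz eta)
  (heta_ge0 : forall x, 0 <= eta x)
  (heta_mass : (\int[leb2]_x (eta x)%:E = 1)%E)
  (T : R) (hT0 : 0 < T) (hT : (T%:E < Tstar)%E) :
  forall a gamma : R, a < 1 / 2 -> 0 < gamma ->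
  exists2 eps0 : R, 0 < eps0 &
    forall eps : R, 0 < eps -> eps <= eps0 ->
    forall w : R -> R * R -> R,
      yudovich_solution (initial_vorticity gam p0 eta eps) w ->
      forall t : R, 0 <= t -> t <= T ->
        (\int[leb2]_(x in ~` \bigcup_(m in [set: 'I_M]) eball (p t m) (eps `^ a))
            `|w t x|%:E <= (eps `^ gamma)%:E)%E.

Proof.
move=> a gamma a12 gamma0.
have [Tstar0 [p00 hpv] _] := hp.
have T0 := ltW hT0.
have pv t m : 0 <= t <= T -> has_velocity (p ^~ m) t
    (\sum_(l < M | l != m) gam l *: bs_kernel (p t m - p t l)).
  move=> /andP[t0 tT]; apply: (hpv t t0 _).2.
  by apply: le_lt_trans hT; rewrite lee_fin.
have pc m b : {within `[0, T], continuous (fun s => pr b (p s m))}.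
  by apply: has_velocity_within => t; exact: pv.
have [de de0 dE] : exists2 de : R, 0 < de &
    forall t m l, 0 <= t <= T -> m != l -> de <= enorm (p t m - p t l).
  apply: uniform_separation => // t m l /andP[t0 tT]; apply: (hpv t t0 _).1.
  by apply: le_lt_trans hT; rewrite lee_fin.
have [C C0 etaC] := profile_bounded heta_schwartz.
have [P dP] := @density_probability R _ (measurableTypeR R * measurableTypeR R)%type
  leb2 eta heta_ge0 (profile_measurable heta_schwartz) heta_mass.
set mean : R * R := (Ex P (fun z => z.1), Ex P (fun z => z.2)).
(* [concentration] asks for a separation of five truncation radii. *)
have de50 : 0 < de / 5 by rewrite divr_gt0.
have C40 : 0 <= 4 * C by rewrite mulr_ge0.
(* The exponent [gamma + 1] leaves one factor [eps] to absorb the sum of the intensities at the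
   end. *)
have [|||eps1 eps10 conc] := @concentration R _ _ P M gam p (4 * C) (de / 5)
  (normsq mean) T (fun k => Ex P (fun z => normsq (z - mean) ^+ k))
  de50 C40 T0 _ pc _ a (gamma + 1) a12.
- move=> t m b /andP[t0 tT]; rewrite -pr_scale_sum.
  by apply: has_velocity_derive => //; apply: pv; rewrite !ltW.
- move=> t m l t0T ml; rewrite mulrC divfK; last by rewrite pnatr_eq0.
  exact: dE.
- by rewrite addr_gt0.
have g0 := gnorm_ge0 gam.
have g1 : 0 < 1 + gnorm gam by rewrite ltr_wpDr.
(* The second bound gives both [eps <= 1] and [eps * gnorm gam <= 1]; neither bound depends on the
   solution [w]. *)
exists (Num.min eps1 (1 + gnorm gam)^-1).
  by rewrite lt_min eps10 invr_gt0.
move=> eps eps0; rewrite le_min => /andP[epsle epsg] w [w_meas _ _ [F [F_flow F_pres F_trans]]] t t0 tT.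
have eps_le1 : eps <= 1.
  by apply: le_trans epsg _; rewrite invf_le1// lerDl.
have ev := trajectory_evolution heta_schwartz heta_ge0 dP eps0 w_meas F_flow F_pres F_trans
  etaC eps_le1 p00.
set B := ~` _.
have mball m : measurable (eball (p t m) (eps `^ a) : set (measurableTypeR R * measurableTypeR R)).
  apply: measurable_lt_cst; apply: measurable_enorm; exact: measurable_funB.
have mB : measurable (B : set (measurableTypeR R * measurableTypeR R)).
  by apply: measurableC; apply: countable_bigcupT_measurable => // m; exact: mball.
have t0T : 0 <= t <= T by rewrite t0.
have far m : (P [set z | B (trajectory p0 eps F t m z)] <= (eps `^ (gamma + 1))%:E)%E.
  apply: le_trans (conc eps _ ev epsle t m t0T).
  have mX b := measurable_trajectory p0 eps F_pres t0 m b.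
  have mE : mf (fun z => enorm (trajectory p0 eps F t m z - p t m)).
    by apply: measurable_enorm; apply: measurable_funB => //;
      [exact: (mX false)|exact: (mX true)].
  apply: le_measure; rewrite ?inE.
  - exact: measurable_trajectory_preimage.
  - rewrite (_ : [set z | _] = ~` [set z | enorm (trajectory p0 eps F t m z - p t m) < eps `^ a]).
      by apply: measurableC; exact: measurable_lt_cst.
    by apply/seteqP; split => z /=; rewrite leNgt => /negP.
  - move=> z /= Bz; rewrite leNgt; apply/negP => zE; apply: Bz; exists m => //.
apply: le_trans (escaping_mass heta_schwartz heta_ge0 dP eps0 w_meas F_pres F_trans mB t0) _.
apply: (@le_trans _ _ (\sum_(m < M) (`|gam m| * eps `^ (gamma + 1))%:E)%E).
  by apply: lee_sum => m _; rewrite EFinM; apply: lee_wpmul2l; [rewrite lee_fin|exact: far].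
rewrite sumEFin lee_fin -mulr_suml -/(gnorm gam).
rewrite powRD; last by rewrite (gt_eqF eps0) implybT.
rewrite (powRr1 (ltW eps0)) mulrCA -[leRHS]mulr1; apply: ler_wpM2l; first exact: powR_ge0.
have epsg1 : eps * (1 + gnorm gam) <= 1 by rewrite -ler_pdivlMr// div1r.
by apply: le_trans epsg1; rewrite mulrC; apply: ler_wpM2l; [exact: ltW|rewrite lerDr].

Qed.
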